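(* Let $p$ be a prime with $0<p\equiv 7\pmod{16}$ and let $\mathbb{K}=\mathbb{Q}(\sqrt[4]{p})$. Then the class number $h_{\mathbb{K}}$ of $\mathbb{K}$ satisfies $h_{\mathbb{K}}\equiv 2\pmod 4$; equivalently, the $2$-part of the ideal class group of $\mathbb{K}$ is isomorphic to $\mathbb{Z}/2\mathbb{Z}$.
   Context: $\sqrt[4]{p}$ denotes the real positive fourth root of $p$. *)

(* Defs.v *)
From mathcomp Require Import all_boot all_order all_algebra.
From mathcomp Require Import algC algnum.
Set Implicit Arguments. Unset Strict Implicit. Unset Printing Implicit Defensive.
Import Order.TTheory GRing.Theory Num.Theory.
Local Open Scope ring_scope.

(* The real positive fourth root of p, as an element of algC. *)
Definition fourth_root (p : nat) : algC := 4.-root (p%:R).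

Definition is_subfield (S : algC -> Prop) : Prop :=
  [/\ S 0, S 1,
      (forall x y, S x -> S y -> S (x - y)),
      (forall x y, S x -> S y -> S (x * y)) &
      (forall x, S x -> x != 0 -> S x^-1)].

Definition genfield (a : algC) (x : algC) : Prop :=
  forall S, is_subfield S -> S a -> S x.

Definition ring_of_integers (K : algC -> Prop) (x : algC) : Prop :=
  K x /\ x \in Aint.

Definition nz_ideal (K : algC -> Prop) (I : algC -> Prop) : Prop :=
  [/\ (forall x, I x -> ring_of_integers K x),
      I 0,
      (forall x y, I x -> I y -> I (x - y)),
      (forall r x, ring_of_integers K r -> I x -> I (r * x)) &
      (exists x, I x /\ x != 0)].

Definition ideal_equiv (K : algC -> Prop) (I J : algC -> Prop) : Prop :=
  exists a b, [/\ ring_of_integers K a, a != 0, ring_of_integers K b, b != 0 &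
    forall z, (exists x, I x /\ z = a * x) <-> (exists y, J y /\ z = b * y)].

Definition class_number (K : algC -> Prop) (h : nat) : Prop :=
  exists R : 'I_h -> (algC -> Prop),
    [/\ (forall i, nz_ideal K (R i)),
        (forall i j, ideal_equiv K (R i) (R j) -> i = j) &
        (forall I, nz_ideal K I -> exists i, ideal_equiv K I (R i))].

(* Main.v *)
(** Put a = p^(1/4), t = a^2, k = Q(t), K = Q(a), with rings of integers Ok = Z[t] and
    O = Z[a].  The Pell equation and p = 7 mod 8 give pi in Ok with pi^2 = 2 * unit; the
    prime PP of O above 2 satisfies PP^2 = (pi).  The class group of K modulo the class of PP
    has odd order, and PP has class of order exactly 2, because of three facts.

    (1) Norms of elements of O are, up to sign, of the form 2^v m with m = +-1 mod 8 if v is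
    even and m = +-3 mod 8 if v is odd: the prime 2 can be removed from the norm by
    multiplying by (1 + a) / pi, and 1 + a has norm 1 - p = 2 * (-3) mod 16.  Hence PP is not
    principal; its class is not a square either, as the product of an ideal and its conjugate
    over k has even PP-adic valuation.

    (2) There is a unit of K whose relative norm to k is 2 up to squares.  Otherwise, by
    Hilbert 90, every unit would be a unit of k times a square, and infinite descent would
    contradict the existence of units of K outside k.

    (3) If I^2 = (x), then the relative norm of x is a unit of k times a square, hence, by (2),
    may be assumed to be a square.  By Hilbert 90, x is an element c of k up to squares, so
    some ideal J in the class of I has J^2 = (c).  Only pi and t ramify and k has odd class
    number, so c is a product of powers of pi and t up to units and squares, and J is
    principal or equivalent to PP. *)

Require Import Defs.
From HB Require Import structures.
From mathcomp Require Import all_boot all_order all_fingroup all_algebra all_solvable.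
From mathcomp Require Import falgebra fieldext galois.
From mathcomp Require Import algC algnum.
From mathcomp Require Import boolp ring zify.
Set Implicit Arguments. Unset Strict Implicit. Unset Printing Implicit Defensive.
Import Order.TTheory GRing.Theory Num.Theory.
Local Open Scope ring_scope.


(** * Ideals of subrings of algC *)

(** Ideals are studied through their squares. If B^2 = (c) with c in the base ring R of a quadratic
    extension R[s], the contraction J of B to R satisfies J^2 <= (c) and contains 4 s^2 c in its
    square, so up to squares c is supported at divisors of 4 s^2. Over Z with s^2 = p, then over
    [Ok] with s^2 = t, this does the work of the theory of ambiguous ideals. Hilbert 90 in the form
    f^2 = x r brings an element x whose relative norm is a square back to an element r of the
    smaller ring.

    A positive unit of [Ok] is w^2 or w^2 / 2. Hence the unit of (2) makes every unit that can occur
    in (3) a relative norm of a unit, up to squares.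

    The descent in (2) is measured by (e - sg e)^2 / (e sg e). Factors from k leave it unchanged,
    and it is at least 1/4 for a unit e outside k: at the complex place of K the two conjugates ta e
    and ta (sg e) have the same absolute value, which bounds the conjugate quantity by 4. Squaring e
    multiplies it by at least 4. *)

Notation pset := (algC -> Prop).

Definition is_subring (R : pset) : Prop :=
  [/\ R 1, (forall x y, R x -> R y -> R (x - y)) &
      (forall x y, R x -> R y -> R (x * y))].

Definition agrp (H : pset) : Prop :=
  H 0 /\ (forall x y, H x -> H y -> H (x - y)).

Definition rmod (R I : pset) : Prop :=
  agrp I /\ (forall r x, R r -> I x -> I (r * x)).

Definition nonz (I : pset) : Prop := exists x, I x /\ x != 0.

Definition ideal (R I : pset) : Prop :=
  [/\ rmod R I, (forall x, I x -> R x) & nonz I].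

(* The additive group generated by the products, described impredicatively so that no
   finite sums have to be handled. *)
Definition mulI (I J : pset) : pset := fun z =>
  forall H, agrp H -> (forall x y, I x -> J y -> H (x * y)) -> H z.

Definition scaleI (a : algC) (I : pset) : pset := fun z => exists x, I x /\ z = a * x.

Definition frac_of (R : pset) : pset := fun x =>
  exists a b, [/\ R a, R b, b != 0 & x = a / b].

Definition equivI (R I J : pset) : Prop :=
  exists a b, [/\ R a, a != 0, R b, b != 0 & scaleI a I = scaleI b J].

Lemma pset_eq (I J : pset) :
  (forall x, I x -> J x) -> (forall x, J x -> I x) -> I = J.
Proof. by move=> h1 h2; apply/funext=> x; apply/propext; split; [apply: h1|apply: h2]. Qed.

Section Agrp.
Variable H : pset.
Hypothesis hH : agrp H.
Lemma agrp0 : H 0. Proof. by case: hH. Qed.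
Lemma agrpB x y : H x -> H y -> H (x - y). Proof. by case: hH => _; apply. Qed.
Lemma agrpN x : H x -> H (- x). Proof. by move=> hx; rewrite -sub0r; apply: agrpB agrp0 hx. Qed.
Lemma agrpD x y : H x -> H y -> H (x + y).
Proof. by move=> hx hy; rewrite -[y]opprK; apply: agrpB hx (agrpN hy). Qed.
Lemma agrpMn x n : H x -> H (x *+ n).
Proof. by move=> hx; elim: n => [|n IH]; rewrite ?mulr0n ?mulrS; [apply: agrp0|apply: agrpD]. Qed.
Lemma agrpMz x n : H x -> H (x *~ n).
Proof.
by move=> hx; case: n => n; rewrite ?NegzE ?mulrNz; [|apply: agrpN]; apply: agrpMn.
Qed.
End Agrp.

Section Subr.
Variable R : pset.
Hypothesis hR : is_subring R.
Lemma sring1 : R 1. Proof. by case: hR. Qed.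
Lemma sringM x y : R x -> R y -> R (x * y). Proof. by case: hR => _ _; apply. Qed.
Lemma sring_agrp : agrp R.
Proof. by case: hR => h1 hB _; split=> //; rewrite -(subrr 1); apply: hB. Qed.
Lemma sringB x y : R x -> R y -> R (x - y). Proof. exact: agrpB sring_agrp _ _. Qed.
Lemma sringD x y : R x -> R y -> R (x + y). Proof. exact: agrpD sring_agrp _ _. Qed.
Lemma sringN x : R x -> R (- x). Proof. exact: agrpN sring_agrp _. Qed.
Lemma sring0 : R 0. Proof. exact: agrp0 sring_agrp. Qed.
Lemma sring_int n : R n%:~R. Proof. exact: agrpMz sring_agrp _ _ sring1. Qed.
Lemma sring_nat n : R n%:R. Proof. exact: agrpMn sring_agrp _ _ sring1. Qed.
Lemma sringX x n : R x -> R (x ^+ n).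
Proof. by move=> hx; elim: n => [|n IH]; rewrite ?expr0 ?exprS; [apply: sring1|apply: sringM]. Qed.
Lemma rmod_self : rmod R R. Proof. by split; [apply: sring_agrp|apply: sringM]. Qed.
Lemma ideal_self : ideal R R.
Proof. by split=> //; [apply: rmod_self|exists 1; rewrite oner_eq0; split=> //; apply: sring1]. Qed.
End Subr.

Ltac ring_mem hR := repeat first [ assumption | exact: (sring0 hR) | exact: (sring1 hR)
  | exact: (sring_nat hR) | exact: (sring_int hR)
  | simple apply (sringM hR) | simple apply (sringB hR) | simple apply (sringD hR)
  | simple apply (sringN hR) | simple apply (sringX hR) ].

Section Products.
Implicit Types I J K : pset.

Lemma agrp_mulI I J : agrp (mulI I J).
Proof.
split=> [H hH _|x y hx hy H hH hI]; first exact: agrp0.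
by apply: (agrpB hH); [apply: hx|apply: hy].
Qed.

Lemma mem_mulI I J x y : I x -> J y -> mulI I J (x * y).
Proof. by move=> hx hy H hH; apply. Qed.

Lemma mulI_sub I J H : agrp H -> (forall x y, I x -> J y -> H (x * y)) ->
  forall z, mulI I J z -> H z.
Proof. by move=> hH hI z; apply. Qed.

Lemma mulIC I J : mulI I J = mulI J I.
Proof.
by apply: pset_eq; apply: mulI_sub => [|x y hx hy]; try exact: agrp_mulI;
  rewrite mulrC; apply: mem_mulI.
Qed.

Lemma agrp_pre H (f : algC -> algC) : agrp H -> f 0 = 0 -> {morph f : x y / x - y} ->
  agrp (fun x => H (f x)).
Proof. by move=> hH h0 fB; split=> [|x y hx hy]; rewrite ?h0 ?fB; [apply: agrp0|apply: agrpB]. Qed.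

Lemma mulIA_sub I J K z : mulI (mulI I J) K z -> mulI I (mulI J K) z.
Proof.
move: z; apply: mulI_sub => [|w k hw hk]; first exact: agrp_mulI.
move: w hw; apply: (@mulI_sub _ _ (fun w => mulI I (mulI J K) (w * k))) => [|x y hx hy].
  by apply: (agrp_pre (agrp_mulI _ _)) => [|x y]; rewrite ?mul0r ?mulrBl.
by rewrite -mulrA; apply: mem_mulI => //; apply: mem_mulI.
Qed.

Lemma mulIA I J K : mulI I (mulI J K) = mulI (mulI I J) K.
Proof.
apply: pset_eq; last exact: mulIA_sub.
move=> z; rewrite mulIC (mulIC J) => /mulIA_sub; rewrite mulIC (mulIC J) //.
Qed.

Lemma mulIAC I J K : mulI (mulI I J) K = mulI (mulI I K) J.
Proof. by rewrite -!mulIA (mulIC J). Qed.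

Lemma mulIACA I J K L : mulI (mulI I J) (mulI K L) = mulI (mulI I K) (mulI J L).
Proof. by rewrite !mulIA (mulIAC I). Qed.

Lemma scE a I x : a != 0 -> scaleI a I x <-> I (x / a).
Proof.
move=> ha; split=> [[y [hy ->]]|h]; first by rewrite mulrC mulKf.
by exists (x / a); split=> //; rewrite mulrC divfK.
Qed.

Lemma sc1 I : scaleI 1 I = I.
Proof. by apply: pset_eq => x; [case=> y [h ->]; rewrite mul1r|exists x; rewrite mul1r]. Qed.

Lemma scM a b I : scaleI (a * b) I = scaleI a (scaleI b I).
Proof.
apply: pset_eq => x; first by case=> y [h ->]; exists (b * y); rewrite mulrA; split=> //; exists y.
by case=> _ [[y [h ->]] ->]; exists y; rewrite mulrA.
Qed.

Lemma sc_inj a I J : a != 0 -> scaleI a I = scaleI a J -> I = J.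
Proof. by move=> ha /(congr1 (scaleI a^-1)); rewrite -!scM mulVf // !sc1. Qed.

Lemma sc_mem a I x : I x -> scaleI a I (a * x). Proof. by exists x. Qed.

Lemma agrp_sc a I : agrp I -> agrp (scaleI a I).
Proof.
move=> hI; split=> [|_ _ [x [hx ->]] [y [hy ->]]].
  by exists 0; rewrite mulr0; split=> //; apply: agrp0.
by exists (x - y); rewrite mulrBr; split=> //; apply: agrpB.
Qed.

Lemma mulI_scl a I J : mulI (scaleI a I) J = scaleI a (mulI I J).
Proof.
apply: pset_eq.
  apply: mulI_sub => [|_ y [x [hx ->]] hy]; first by apply: agrp_sc; apply: agrp_mulI.
  by rewrite -mulrA; apply: sc_mem; apply: mem_mulI.
move=> _ [x [hx ->]]; move: x hx.
apply: (@mulI_sub _ _ (fun x => mulI (scaleI a I) J (a * x))) => [|x y hx hy].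
  by apply: (agrp_pre (agrp_mulI _ _)) => [|x y]; rewrite ?mulr0 ?mulrBr.
by rewrite mulrA; apply: mem_mulI => //; apply: sc_mem.
Qed.

Lemma mulI_scr a I J : mulI I (scaleI a J) = scaleI a (mulI I J).
Proof. by rewrite mulIC mulI_scl mulIC. Qed.

Lemma mulI_mono I I' J J' : (forall x, I x -> I' x) -> (forall x, J x -> J' x) ->
  forall x, mulI I J x -> mulI I' J' x.
Proof.
move=> h1 h2; apply: mulI_sub; first exact: agrp_mulI.
by move=> x y /h1 hx /h2 hy; apply: mem_mulI.
Qed.
End Products.

Section Mod.
Variable R : pset.
Hypothesis hR : is_subring R.

Lemma mulI_R I : rmod R I -> mulI R I = I.
Proof.
case=> hI hRI; apply: pset_eq; first by apply: mulI_sub.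
by move=> x hx; rewrite -[x]mul1r; apply: mem_mulI => //; apply: sring1.
Qed.

Lemma rmod_sc a I : rmod R I -> rmod R (scaleI a I).
Proof.
case=> hI hRI; split; first exact: agrp_sc.
by move=> r _ hr [x [hx ->]]; rewrite mulrCA; apply: sc_mem; apply: hRI.
Qed.

Lemma rmod_mulI I J : rmod R I -> rmod R (mulI I J).
Proof.
case=> hI hRI; split=> [|r x hr]; first exact: agrp_mulI.
move: x; apply: (@mulI_sub _ _ (fun x => mulI I J (r * x))) => [|x y hx hy].
  by apply: (agrp_pre (agrp_mulI _ _)) => [|x y]; rewrite ?mulr0 ?mulrBr.
by rewrite mulrA; apply: mem_mulI => //; apply: hRI.
Qed.

Lemma ideal_rmod I : ideal R I -> rmod R I. Proof. by case. Qed.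
Lemma ideal_sub I x : ideal R I -> I x -> R x. Proof. by case=> _ h _; apply: h. Qed.
Lemma ideal_agrp I : ideal R I -> agrp I. Proof. by case=> -[]. Qed.
Lemma ideal_mul I r x : ideal R I -> R r -> I x -> I (r * x). Proof. by case=> -[_ h] _ _; apply: h. Qed.
Lemma ideal_mulr I r x : ideal R I -> R r -> I x -> I (x * r).
Proof. by rewrite mulrC; apply: ideal_mul. Qed.

Lemma nonz_mulI I J : nonz I -> nonz J -> nonz (mulI I J).
Proof.
move=> [x [hx x0]] [y [hy y0]]; exists (x * y); rewrite mulf_neq0 //; split=> //.
exact: mem_mulI.
Qed.

Lemma nonz_sc a I : a != 0 -> nonz I -> nonz (scaleI a I).
Proof. by move=> a0 [x [hx x0]]; exists (a * x); rewrite mulf_neq0 //; split=> //; apply: sc_mem. Qed.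

Lemma ideal_mulI I J : ideal R I -> ideal R J -> ideal R (mulI I J).
Proof.
move=> hI hJ; split; first by apply: rmod_mulI; apply: ideal_rmod.
  apply: mulI_sub => [|x y hx hy]; first exact: sring_agrp.
  by apply: sringM => //; [apply: ideal_sub hx|apply: ideal_sub hy].
by case: hI hJ => [_ _ hI] [_ _ hJ]; apply: nonz_mulI.
Qed.

Lemma ideal_sc a I : R a -> a != 0 -> ideal R I -> ideal R (scaleI a I).
Proof.
move=> ha a0 hI; split; first by apply: rmod_sc; apply: ideal_rmod.
  by move=> _ [x [hx ->]]; apply: sringM => //; apply: ideal_sub hx.
by case: hI => _ _; apply: nonz_sc.
Qed.

Lemma ideal_pr a : R a -> a != 0 -> ideal R (scaleI a R).
Proof. by move=> ha a0; apply: ideal_sc => //; apply: ideal_self. Qed.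

Lemma sc_self a : scaleI a R a. Proof. by exists 1; rewrite mulr1; split=> //; apply: sring1. Qed.

Lemma mulI_RR : mulI R R = R. Proof. by apply: mulI_R; apply: rmod_self. Qed.

Lemma sc_unit u I : rmod R I -> R u -> R u^-1 -> u != 0 -> scaleI u I = I.
Proof.
move=> [hI hRI] hu hu' u0; apply: pset_eq => x; first by case=> y [hy ->]; apply: hRI.
by move=> hx; apply/scE => //; rewrite mulrC; apply: hRI.
Qed.

Lemma sc_mem_unit a b : a != 0 -> scaleI a R = scaleI b R -> R (a / b) /\ R (b / a).
Proof.
move=> a0 hab; have b0 : b != 0.
  apply/eqP=> b0; have: scaleI b R a by rewrite -hab; apply: sc_self.
  by case=> x [_ e]; move: a0; rewrite e b0 mul0r eqxx.
by split; apply/scE => //; [rewrite -hab|rewrite hab]; apply: sc_self.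
Qed.

Lemma rmod1 I : rmod R I -> (forall x, I x -> R x) -> I 1 -> I = R.
Proof.
by move=> [_ hRI] hs h1; apply: pset_eq => // x hx; rewrite -[x]mulr1; apply: hRI.
Qed.

(** Integral closedness for square roots, the form in which it serves to extract roots of ideal
    identities. *)
Definition sqcl (K : pset) := forall x, K x -> R (x ^+ 2) -> R x.

(** For y in I the square of y / x lies in R, so I / x is contained in R. Its square is R, and 1 in
    (I / x)^2 forces 1 in I / x. *)
Lemma sq_principal I x : sqcl (frac_of R) -> x != 0 -> rmod R I ->
  (forall y, I y -> frac_of R (y / x)) ->
  mulI I I = scaleI (x ^+ 2) R -> I = scaleI x R.
Proof.
move=> hc x0 hI hfr hII.
have hsub y : I y -> R (y / x).
  move=> hy; apply: hc; first exact: hfr.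
  have: mulI I I (y * y) by apply: mem_mulI.
  by rewrite hII scE ?expf_neq0 // expr_div_n expr2.
have hI' : rmod R (scaleI x^-1 I) by apply: rmod_sc.
have hs z : scaleI x^-1 I z -> R z.
  by case=> y [hy ->]; rewrite mulrC; apply: hsub.
have e1 : mulI (scaleI x^-1 I) (scaleI x^-1 I) = R.
  rewrite mulI_scl mulI_scr hII -!scM.
  by rewrite -[RHS]sc1; congr (scaleI _ _); field.
have h1 : scaleI x^-1 I 1.
  have : mulI (scaleI x^-1 I) (scaleI x^-1 I) 1 by rewrite e1; apply: sring1.
  move: (1 : algC); apply: mulI_sub; first by case: hI'.
  by move=> a b /hs ha hb; case: hI' => _; apply.
apply: (@sc_inj x^-1); first by rewrite invr_eq0.
by rewrite -scM mulVf // sc1; apply: rmod1.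
Qed.

Lemma equivI_refl I : equivI R I I.
Proof. by exists 1, 1; rewrite oner_eq0; split=> //; apply: sring1. Qed.

Lemma equivI_sym I J : equivI R I J -> equivI R J I.
Proof. by case=> a [b [ha a0 hb b0 h]]; exists b, a. Qed.

Lemma equivI_trans J I K : equivI R I J -> equivI R J K -> equivI R I K.
Proof.
case=> a [b [ha a0 hb b0 h]] [c [d [hc c0 hd d0 h']]].
exists (c * a), (b * d); rewrite !mulf_neq0 //; split=> //; try exact: sringM.
by rewrite (scM c a) h -scM [c * b]mulrC (scM b c) h' -scM.
Qed.

Lemma equivI_mul I J I' J' : equivI R I I' -> equivI R J J' ->
  equivI R (mulI I J) (mulI I' J').
Proof.
case=> a [b [ha a0 hb b0 h]] [c [d [hc c0 hd d0 h']]].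
exists (a * c), (b * d); rewrite !mulf_neq0 //; split=> //; try exact: sringM.
by rewrite (scM a c) -mulI_scr -mulI_scl h h' mulI_scl mulI_scr -scM.
Qed.

Lemma equivI_sc a I : R a -> a != 0 -> equivI R (scaleI a I) I.
Proof. by move=> ha a0; exists 1, a; rewrite oner_eq0; split=> //; [apply: sring1|rewrite sc1]. Qed.

Lemma equivI_fr x I J : frac_of R x -> x != 0 -> I = scaleI x J -> equivI R I J.
Proof.
case=> a [b [ha hb b0 ->]]; rewrite mulf_eq0 negb_or => /andP[a0 _] ->.
by exists b, a; split=> //; rewrite -scM mulrC divfK.
Qed.

Lemma equivI_ex I J : equivI R I J -> exists2 x, frac_of R x & x != 0 /\ I = scaleI x J.
Proof.
case=> a [b [ha a0 hb b0 h]]; exists (b / a); first by exists b, a.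
split; first by rewrite mulf_neq0 ?invr_eq0.
by apply: (@sc_inj a) => //; rewrite h -scM mulrC divfK.
Qed.

Lemma fr_R x : R x -> frac_of R x.
Proof. by move=> hx; exists x, 1; rewrite oner_eq0 divr1; split=> //; apply: sring1. Qed.
Lemma frM x y : frac_of R x -> frac_of R y -> frac_of R (x * y).
Proof.
move=> [a [b [ha hb b0 ->]]] [c [d [hc hd d0 ->]]].
by exists (a * c), (b * d); rewrite mulf_neq0 // mulf_div; split=> //; apply: sringM.
Qed.
Lemma frV x : frac_of R x -> frac_of R x^-1.
Proof.
move=> [a [b [ha hb b0 ->]]]; have [->|a0] := eqVneq a 0.
  by rewrite mul0r invr0; apply: fr_R; apply: sring0.
by exists b, a; rewrite invf_div.
Qed.
Lemma frD x y : frac_of R x -> frac_of R y -> frac_of R (x + y).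
Proof.
move=> [a [b [ha hb b0 ->]]] [c [d [hc hd d0 ->]]].
exists (a * d + c * b), (b * d); rewrite mulf_neq0 //; split=> //; last by rewrite addf_div.
  by apply: sringD => //; apply: sringM.
exact: sringM.
Qed.
Lemma frN x : frac_of R x -> frac_of R (- x).
Proof. by move=> [a [b [ha hb b0 ->]]]; exists (- a), b; rewrite mulNr; split=> //; apply: sringN. Qed.
Lemma fr_div x y : R x -> R y -> frac_of R (x / y).
Proof. by move=> hx hy; apply: frM; [|apply: frV]; apply: fr_R. Qed.

(* The hypothesis on [x] says that R/q is a field. *)
Lemma overideal q n m D : R q -> q != 0 -> R m ->
  (forall x, R x -> R (x / q) \/ exists2 y, R y & R ((1 - x * y) / q)) ->
  ideal R D -> D (q ^+ n * m) ->
  exists i D', [/\ D = scaleI (q ^+ i) D', ideal R D' & D' m].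
Proof.
move=> hq q0 hm hmax; elim: n D => [|n IH] D hD.
  by rewrite expr0 mul1r => hDm; exists 0%N, D; rewrite expr0 sc1.
move=> hDm; have [hall|] := pselect (forall x, D x -> R (x / q)).
  have hD1 : ideal R (scaleI q^-1 D).
    split; first by apply: rmod_sc; apply: ideal_rmod.
      by move=> _ [x [hx ->]]; rewrite mulrC; apply: hall.
    by case: hD => _ _; apply: nonz_sc; rewrite invr_eq0.
  have [||i [D' [e1 h1 h2]]] := IH (scaleI q^-1 D) => //.
    by exists (q ^+ n.+1 * m); split=> //; rewrite exprS -mulrA mulKf.
  exists i.+1, D'; split=> //.
  by rewrite exprS scM -e1 -scM divff ?sc1.
move=> /existsNP[x /not_implyP[hx hxq]].
have hRx := ideal_sub hD hx.
have [//|[y hy hxy]] := hmax x hRx.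
apply: IH => //; set w := (1 - x * y) / q in hxy.
(* The relation 1 = x y + q w, multiplied by q^n m, lowers the exponent of q. *)
have -> : q ^+ n * m = (q ^+ n.+1 * m) * w + x * (y * (q ^+ n * m)).
  by rewrite /w exprS; field.
apply: (agrpD (ideal_agrp hD)); first exact: ideal_mulr.
by apply: ideal_mulr => //; apply: sringM => //; apply: sringM => //; apply: sringX.
Qed.
End Mod.

(** * Quadratic extensions *)

Definition quad_ext (R : pset) (s : algC) : pset := fun x =>
  exists a b, [/\ R a, R b & x = a + b * s].

Section QuadraticStep.
Variables (R : pset) (s : algC) (sg : {rmorphism algC -> algC}).
Hypotheses (hR : is_subring R) (s0 : s != 0) (hs2 : R (s ^+ 2)).
Hypotheses (sgs : sg s = - s) (sgR : forall x, R x -> sg x = x).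
Let S := quad_ext R s.

Lemma qext_base x : R x -> S x.
Proof. by move=> hx; exists x, 0; rewrite mul0r addr0; split=> //; apply: sring0. Qed.

Lemma qext_gen : S s.
Proof. by exists 0, 1; rewrite mul1r add0r; split=> //; [apply: sring0|apply: sring1]. Qed.

Lemma is_subring_qext : is_subring S.
Proof.
split; first by apply: qext_base; apply: sring1.
  move=> _ _ [a [b [ha hb ->]]] [c [d [hc hd ->]]].
  by exists (a - c), (b - d); split; [exact: sringB|exact: sringB|ring].
move=> _ _ [a [b [ha hb ->]]] [c [d [hc hd ->]]].
exists (a * c + b * d * s ^+ 2), (a * d + b * c); split; last by ring.
  by ring_mem hR.
by ring_mem hR.
Qed.

Lemma qext_sg a b : R a -> R b -> sg (a + b * s) = a - b * s.
Proof. by move=> ha hb; rewrite rmorphD rmorphM sgs !sgR // mulrN. Qed.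

Lemma qext_conj x : S x -> S (sg x).
Proof.
case=> a [b [ha hb ->]]; rewrite qext_sg //; exists a, (- b); split=> //; first exact: sringN.
by rewrite mulNr.
Qed.

Lemma qext_conjK x : S x -> sg (sg x) = x.
Proof. by case=> a [b [ha hb ->]]; rewrite qext_sg // rmorphB rmorphM sgs !sgR //; ring. Qed.

Lemma qext_trace x : S x -> R (x + sg x).
Proof.
case=> a [b [ha hb ->]]; rewrite qext_sg // (_ : _ + _ = a + a); last by ring.
exact: sringD.
Qed.

Lemma qext_norm x : S x -> R (x * sg x).
Proof.
case=> a [b [ha hb ->]]; rewrite qext_sg // (_ : _ * _ = a * a - b * b * s ^+ 2); last by ring.
by ring_mem hR.
Qed.

Lemma qext_fix x : S x -> sg x = x -> R x.
Proof.
case=> a [b [ha hb ->]]; rewrite qext_sg // => /eqP.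
rewrite -subr_eq0 (_ : _ - _ = (- 2) * (b * s)); last by ring.
by rewrite !mulf_eq0 oppr_eq0 pnatr_eq0 (negbTE s0) orbF => /eqP->; rewrite mul0r addr0.
Qed.

Lemma qext_inj a b a' b' : R a -> R b -> R a' -> R b' ->
  a + b * s = a' + b' * s -> a = a' /\ b = b'.
Proof.
move=> ha hb ha' hb' e; have e' := congr1 sg e; rewrite !qext_sg // in e'.
have ea : a = a'.
  apply: (@mulfI _ 2); first by rewrite pnatr_eq0.
  transitivity ((a + b * s) + (a - b * s)); first by ring.
  by rewrite e e'; ring.
split=> //; apply: (mulIf s0); rewrite ea in e; exact: addrI e.
Qed.

Lemma fr_qext x : frac_of S x -> exists y n, [/\ S y, R n, n != 0 & x = y / n].
Proof.
case=> a [b [ha hb b0 ->]]; have b0' : sg b != 0 by rewrite fmorph_eq0.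
exists (a * sg b), (b * sg b); rewrite mulf_neq0 //; split=> //.
- by apply: sringM => //; [apply: is_subring_qext|apply: qext_conj].
- exact: qext_norm.
by field; apply/andP; split.
Qed.

Lemma fr_qextE x : frac_of S x -> exists a b, [/\ frac_of R a, frac_of R b & x = a + b * s].
Proof.
case/fr_qext=> y [n [[a [b [ha hb ->]]] hn n0 ->]].
by exists (a / n), (b / n); split; [exact: fr_div|exact: fr_div|field].
Qed.

Definition restrI (B : pset) : pset := fun x => B x /\ R x.

Lemma ideal_res B : ideal S B -> ideal R (restrI B).
Proof.
move=> hB; have hS := is_subring_qext; split.
- split; first split=> [|x y [h1 h2] [h3 h4]].
  + by split; [apply: agrp0 (ideal_agrp hB)|apply: sring0].
  + by split; [apply: agrpB (ideal_agrp hB) _ _ _ _|apply: sringB].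
  + move=> r x hr [h1 h2]; split; last exact: sringM.
    by apply: (ideal_mul hB) => //; apply: qext_base.
- by move=> x [].
case: (hB) => _ _ [x [hx x0]]; have hSx := ideal_sub hB hx.
exists (x * sg x); rewrite mulf_neq0 ?fmorph_eq0 //; split=> //; split; last exact: qext_norm.
by apply: (ideal_mulr hB) => //; apply: qext_conj.
Qed.

(* [B] is stable under conjugation, because (sg y * z / c)^2 is integral for y, z in [B].
   Multiplication by [2 * s] then clears the denominators of the components of an element
   of [B] along [1] and [s]. *)
Lemma square_descent B c : sqcl S (frac_of S) -> ideal S B -> R c -> c != 0 ->
  mulI B B = scaleI c S ->
  (forall x, mulI (restrI B) (restrI B) x -> R (x / c)) /\
  mulI (restrI B) (restrI B) (4 * s ^+ 2 * c).
Proof.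
move=> hcl hB hRc c0 hBB; have hS := is_subring_qext.
have hBS := ideal_sub hB; have hBa := ideal_agrp hB.
have hBc x y : B x -> B y -> S (x * y / c).
  by move=> hx hy; apply/scE => //; rewrite -hBB; apply: mem_mulI.
have hfix y : B y -> B (sg y).
  move=> hy; have hSy := hBS _ hy.
  have hz z : B z -> S (sg y * z / c).
    move=> hz; have hSz := hBS _ hz; apply: hcl.
      by apply: fr_div => //; [apply: sringM => //; apply: qext_conj|apply: qext_base].
    rewrite (_ : _ ^+ 2 = sg (y * y / c) * (z * z / c)).
      by apply: sringM => //; [apply: qext_conj|]; apply: hBc.
    by rewrite fmorph_div rmorphM (sgR hRc); field.
  (* As c lies in B B, sg y lies in (sg y / c) B B, a sum of terms (sg y z / c) x whose first factor
     is in S. *)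
  have : scaleI (sg y / c) (mulI B B) (sg y).
    by rewrite hBB -scM divfK //; apply: sc_self.
  rewrite -mulI_scl; move: (sg y) hz => w hw.
  apply: mulI_sub => // _ x [z [hz ->]] hx.
  by apply: (ideal_mul hB) => //; rewrite mulrAC; apply: hw.
split.
  apply: mulI_sub => [|x y [hx hRx] [hy hRy]].
    by apply: (agrp_pre (sring_agrp hR)) => [|x y]; rewrite ?mul0r ?mulrBl.
  apply: qext_fix; first exact: hBc.
  by rewrite fmorph_div rmorphM !sgR.
set J := restrI B.
have hJa : agrp J by apply: ideal_agrp; apply: ideal_res.
have hJJ := agrp_mulI J J.
have hdec x : B x -> exists j1 j2, [/\ J j1, J j2 & 2 * s * x = j1 + j2 * s].
  move=> hx; have hSx := hBS _ hx.
  exists ((x - sg x) * s), (x + sg x); split; last by ring.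
    split; first by apply: (ideal_mulr hB) => //; [apply: qext_gen|apply: (agrpB hBa) => //; apply: hfix].
    case: hSx => a [b [ha hb ->]]; rewrite qext_sg //.
    rewrite (_ : _ * _ = 2 * b * s ^+ 2); last by ring.
    by apply: (sringM hR) => //; apply: (sringM hR) => //; apply: sring_nat.
  by split; [apply: (agrpD hBa) => //; apply: hfix|apply: qext_trace].
(* H is J^2 + J^2 s. It contains 4 s^2 c, because c is a sum of products x y and 4 s^2 x y = (2 s
   x)(2 s y). Since c is in R, comparing components puts 4 s^2 c in J^2. *)
pose H := fun z => exists m1 m2, [/\ mulI J J m1, mulI J J m2 & z = m1 + m2 * s].
have hH : agrp H.
  split; first by exists 0, 0; rewrite mul0r addr0; split=> //; apply: (agrp0 hJJ).
  move=> _ _ [a [b [ha hb ->]]] [a' [b' [ha' hb' ->]]].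
  by exists (a - a'), (b - b'); split; [exact: (agrpB hJJ)|exact: (agrpB hJJ)|ring].
have hJR : rmod R (mulI J J) by apply: rmod_mulI; apply: ideal_rmod; apply: ideal_res.
have : H ((4 * s ^+ 2) * c).
  have : mulI B B c by rewrite hBB; apply: sc_self.
  move: c {hRc c0 hBB hBc hfix} => c.
  apply: (@mulI_sub B B (fun c => H (4 * s ^+ 2 * c))) => [|x y hx hy].
    by apply: (agrp_pre hH) => [|x y]; rewrite ?mulr0 ?mulrBr.
  have [a [b [ha hb e]]] := hdec _ hx; have [a' [b' [ha' hb' e']]] := hdec _ hy.
  rewrite (_ : _ * _ = (2 * s * x) * (2 * s * y)); last by ring.
  rewrite e e'; exists (a * a' + s ^+ 2 * (b * b')), (a * b' + b * a'); split; last by ring.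
    by apply: (agrpD hJJ); [|case: hJR => _; apply=> //]; apply: mem_mulI.
  by apply: (agrpD hJJ); apply: mem_mulI.
case=> m1 [m2 [h1 h2 e]].
have hJRs z : mulI J J z -> R z.
  by apply: mulI_sub; [apply: sring_agrp|move=> x y [_ hx] [_ hy]; apply: sringM].
have [e1 _] : 4 * s ^+ 2 * c = m1 /\ 0 = m2.
  apply: qext_inj; rewrite ?mul0r ?addr0 //; try exact: hJRs; last exact: sring0.
  by do 2!apply: (sringM hR) => //; apply: sring_nat.
by rewrite e1.
Qed.

(** Explicit Hilbert 90 for the element x / d of norm 1: take f = x + d, a multiple of 1 + x / d,
    and r = x + sg x + 2 d. It fails only if x = - d. *)
Lemma hilbert90 x d : S x -> R d -> x * sg x = d ^+ 2 ->
  x = - d \/ exists f r, [/\ S f, R r, f != 0, r != 0 & f ^+ 2 = x * r].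
Proof.
move=> hx hd e; have [/eqP|f0] := eqVneq (x + d) 0.
  by rewrite addr_eq0 => /eqP; left.
right; exists (x + d), (x + sg x + 2 * d).
have e2 : (x + d) ^+ 2 = x * (x + sg x + 2 * d).
  transitivity (x ^+ 2 + 2 * x * d + d ^+ 2); first by ring.
  by rewrite -e; ring.
split=> //.
- by apply: (sringD is_subring_qext) => //; apply: qext_base.
- by apply: (sringD hR); [apply: qext_trace|apply: (sringM hR) => //; apply: sring_nat].
by apply: contraNneq f0 => r0; rewrite -sqrf_eq0 e2 r0 mulr0.
Qed.

End QuadraticStep.

(** * The rings of integers *)

Lemma Aint_sqrt x : x ^+ 2 \in Aint -> x \in Aint.
Proof.
move=> hx; apply: (@root_monic_Aint (minCpoly (x ^+ 2) \Po 'X^2)).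
- by rewrite rootE horner_comp hornerXn; apply: root_minCpoly.
- by rewrite monicE lead_coef_comp ?size_polyXn // (monicP (minCpoly_monic _)) lead_coefXn expr1n mulr1.
by apply: polyOver_comp => //; apply: rpredX; apply: polyOverX.
Qed.

Definition ZZ : pset := fun x => x \in Num.int.

Lemma ZZP x : ZZ x <-> exists n : int, x = n%:~R.
Proof. by split=> [/intrP //|[n ->]]; apply: intr_int. Qed.

Lemma ZZ_ring : is_subring ZZ.
Proof. by rewrite /ZZ; split=> [|x y hx hy|x y hx hy]; rewrite ?rpredB ?rpredM ?rpred1. Qed.

Lemma fr_ZZ_Aint x : frac_of ZZ x -> x \in Aint -> ZZ x.
Proof.
case=> a [b [/ZZP[m ->] /ZZP[n ->] _ ->]]; apply: Cint_rat_Aint.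
by apply/CratP; exists (m%:~R / n%:~R); rewrite fmorph_div !rmorph_int.
Qed.

Lemma int_parity (a : int) : exists i, a = 2 * i \/ a = 2 * i + 1.
Proof. by exists (a %/ 2)%Z; lia. Qed.

(** Modulo 4 the left side is a^2 + b^2, as p = 3 mod 4. This is why Z[sqrt p] is integrally
    closed. *)
Lemma mod4_even (q a b n : int) : a * a - (q * 16 + 7) * (b * b) = 4 * n ->
  exists i j, a = 2 * i /\ b = 2 * j.
Proof.
have [i [->|->]] := int_parity a; have [j [->|->]] := int_parity b; try lia.
by move=> _; exists i, j.
Qed.

(** The equations are the two components of A^2 - t B^2 = 4 N, where A = a0 + a1 t and B = b0 + b1 t
    are twice the coordinates of an integral element over k. *)
Lemma mod4_even2 (q a0 a1 b0 b1 n0 n1 : int) :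
  a0 * a0 + (q * 16 + 7) * (a1 * a1) - 2 * (q * 16 + 7) * (b0 * b1) = 4 * n0 ->
  2 * (a0 * a1) - b0 * b0 - (q * 16 + 7) * (b1 * b1) = 4 * n1 ->
  exists i0 i1 j0 j1, [/\ a0 = 2 * i0, a1 = 2 * i1, b0 = 2 * j0 & b1 = 2 * j1].
Proof.
have [i0 [->|->]] := int_parity a0; have [i1 [->|->]] := int_parity a1;
  have [j0 [->|->]] := int_parity b0; have [j1 [->|->]] := int_parity b1; try lia.
by move=> _ _; exists i0, i1, j0, j1.
Qed.

(* [qs] and [qt] extend to algC the nontrivial automorphisms of Q(qa)/Q(sqrt p) and of
   Q(sqrt p)/Q; the four embeddings of Q(qa) are the restrictions of the identity, [qs],
   [qt] and [qt \o qs]. *)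
Record quartic := Quartic {
  qp : nat; qa : algC; qs : {rmorphism algC -> algC}; qt : {rmorphism algC -> algC};
  q_prime : prime qp; q_mod : (qp %% 16 = 7)%N; qa_gt0 : 0 < qa;
  qa4 : qa ^+ 4 = qp%:R; qs_a : qs qa = - qa; qt_t : qt (qa ^+ 2) = - qa ^+ 2 }.

Section Basics.
Variable D : quartic.
Local Notation p := (qp D).
Local Notation al := (qa D).
Local Notation sg := (qs D).
Local Notation ta := (qt D).

Definition sqrt_p := al ^+ 2.
Local Notation t := sqrt_p.
Definition Ok := quad_ext ZZ t.
Definition O := quad_ext Ok al.

Lemma q_decomp : exists q : nat, p = (q * 16 + 7)%N.
Proof. by exists (p %/ 16)%N; rewrite {1}(divn_eq p 16) q_mod. Qed.

Lemma al0 : al != 0. Proof. by rewrite gt_eqF ?qa_gt0. Qed.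
Lemma t_gt0 : 0 < t. Proof. by rewrite exprn_gt0 ?qa_gt0. Qed.
Lemma t0 : t != 0. Proof. by rewrite gt_eqF ?t_gt0. Qed.
Lemma tt : t ^+ 2 = p%:R. Proof. by rewrite -qa4 -exprM. Qed.
Lemma sg_al : sg al = - al. Proof. exact: qs_a. Qed.
Lemma ta_t : ta t = - t. Proof. exact: qt_t. Qed.
Lemma ta_ZZ x : ZZ x -> ta x = x. Proof. by case/ZZP=> n ->; rewrite rmorph_int. Qed.
Lemma ZZ_tt : ZZ (t ^+ 2). Proof. by rewrite tt; apply: sring_nat ZZ_ring _. Qed.

Lemma Ok_ring : is_subring Ok. Proof. exact: is_subring_qext ZZ_ring ZZ_tt. Qed.
Lemma Ok_t : Ok t. Proof. exact: (qext_gen _ ZZ_ring). Qed.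
Lemma sg_Ok x : Ok x -> sg x = x.
Proof.
case=> a [b [/ZZP[m ->] /ZZP[n ->] ->]].
by rewrite rmorphD rmorphM !rmorph_int rmorphXn /= sg_al sqrrN.
Qed.
Lemma O_ring : is_subring O. Proof. exact: is_subring_qext Ok_ring Ok_t. Qed.
Lemma Ok_O x : Ok x -> O x. Proof. exact: (qext_base _ Ok_ring). Qed.
Lemma O_al : O al. Proof. exact: (qext_gen _ Ok_ring). Qed.

Lemma Okintro (a b : int) : Ok (a%:~R + b%:~R * t).
Proof. by exists a%:~R, b%:~R; split=> //; apply/ZZP; eexists. Qed.

Lemma OkE x : Ok x -> exists a b : int, x = a%:~R + b%:~R * t.
Proof. by case=> a [b [/ZZP[m ->] /ZZP[n ->] ->]]; exists m, n. Qed.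

Lemma Ok_inj (a b c d : int) : a%:~R + b%:~R * t = c%:~R + d%:~R * t -> a = c /\ b = d.
Proof.
case/(qext_inj t0 ta_t ta_ZZ) => [||||e1 e2]; try by apply/ZZP; eexists.
by split; apply/eqP; rewrite -(eqr_int algC); apply/eqP.
Qed.

Lemma pC0 : p%:R != 0 :> algC.
Proof. by rewrite pnatr_eq0 -lt0n prime_gt0 ?q_prime. Qed.

Lemma Euclid_int (a b : int) : (p%:Z %| a * b)%Z -> (p%:Z %| a)%Z \/ (p%:Z %| b)%Z.
Proof. by rewrite !dvdzE abszM Euclid_dvdM ?q_prime // => /orP. Qed.

Lemma Ok_div_t (a b : int) : Ok ((a%:~R + b%:~R * t) / t) <-> (p%:Z %| a)%Z.
Proof.
have e : (a%:~R + b%:~R * t) / t = b%:~R + a%:~R / p%:R * t by rewrite -tt; field; exact: t0.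
split=> [/OkE[c [d e']]|/dvdzP[c ec]].
  have : c%:~R * t + (d * p%:Z)%:~R = a%:~R + b%:~R * t.
    rewrite -[RHS](divfK t0) e' intrM -[p%:Z%:~R]/(p%:R : algC) -tt; ring.
  rewrite addrC => /Ok_inj[<- _]; exact: dvdz_mull.
rewrite e ec intrM mulfK ?pC0 //; exact: Okintro.
Qed.

Lemma al_Aint : al \in Aint.
Proof. by do 2!apply: Aint_sqrt; rewrite -exprM qa4; apply: Aint_Cnat; rewrite natr_nat. Qed.

Lemma O_Aint x : O x -> x \in Aint.
Proof.
case=> a [b [/OkE[m [n ->]] /OkE[m' [n' ->]] ->]]; have hal := al_Aint.
by rewrite !(rpredD, rpredM, rpredX) // Aint_int.
Qed.

Lemma int_eq (a b : int) : a%:~R = b%:~R :> algC -> a = b.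
Proof. by move/eqP; rewrite eqr_int => /eqP. Qed.

Lemma Ok_closed x : frac_of Ok x -> x \in Aint -> Ok x.
Proof.
move=> hfr hx; have htx : ta x \in Aint by rewrite Aint_aut.
case: (fr_qextE ZZ_ring ZZ_tt ta_t ta_ZZ hfr) => a [b [ha hb e]].
have hZ := ZZ_ring; have hta c : frac_of ZZ c -> ta c = c.
  by case=> c1 [c2 [h1 h2 _ ->]]; rewrite fmorph_div !ta_ZZ.
have etx : ta x = a - b * t by rewrite e rmorphD rmorphM ta_t !hta // mulrN.
have hA : ZZ (2 * a).
  apply: fr_ZZ_Aint; first by apply: frM => //; apply: fr_R => //; apply: sring_nat.
  by rewrite (_ : 2 * a = x + ta x) ?rpredD // etx e; ring.
have eN : x * ta x = a * a - p%:R * (b * b) by rewrite etx e -tt; ring.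
have hN : ZZ (x * ta x).
  apply: fr_ZZ_Aint; last by rewrite rpredM.
  rewrite eN; apply: frD => //; first exact: frM.
  by apply: frN => //; do 2?[apply: frM => //]; apply: fr_R => //; apply: sring_nat.
have [A eA] := (ZZP _).1 hA; have [N eNN] := (ZZP _).1 hN.
(* The norm equation gives (p 2b)^2 = p ((2a)^2 - 4 N), so m = p 2b is an integer divisible by p. *)
have hB : ZZ (p%:R * (2 * b)).
  apply: fr_ZZ_Aint.
    by do 2?[apply: frM => //]; apply: fr_R => //; apply: sring_nat.
  apply: Aint_sqrt; rewrite (_ : _ ^+ 2 = p%:R * ((2 * a) ^+ 2 - 4 * (x * ta x))).
    by rewrite eA eNN; rewrite !(rpredM, rpredB, rpredX) ?Aint_int // Aint_Cnat ?natr_nat.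
  by rewrite eN; ring.
have [m em] := (ZZP _).1 hB.
have e1 : m * m = p%:Z * (A * A - 4 * N).
  apply: int_eq; rewrite !(intrM, intrB) -em -eA -eNN eN -[p%:Z%:~R]/(p%:R : algC); ring.
have [B eB] : exists B, m = B * p%:Z.
  by apply/dvdzP; case: (@Euclid_int m m) => //; rewrite e1 dvdz_mulr.
have eb : 2 * b = B%:~R.
  by apply: (mulfI pC0); rewrite em eB intrM mulrC.
have e2 : A * A - p%:Z * (B * B) = 4 * N.
  apply: int_eq; rewrite !(intrM, intrB) -eb -eA -eNN eN -[p%:Z%:~R]/(p%:R : algC); ring.
have [q eq] := q_decomp.
have [i [j [ei ej]]] : exists i j, A = 2 * i /\ B = 2 * j.
  by apply: (@mod4_even q _ _ N); rewrite -e2 eq; lia.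
have ea : a = i%:~R.
  by apply: (@mulfI _ 2); rewrite ?pnatr_eq0 // eA ei intrM.
have {}eb : b = j%:~R.
  by apply: (@mulfI _ 2); rewrite ?pnatr_eq0 // eb ej intrM.
by rewrite e ea eb; apply: Okintro.
Qed.

Lemma sqcl_Ok : sqcl Ok (frac_of Ok).
Proof.
move=> x hx hx2; apply: Ok_closed => //; apply: Aint_sqrt; apply: O_Aint.
exact: Ok_O.
Qed.

Lemma O_closed x : frac_of O x -> x \in Aint -> O x.
Proof.
move=> hfr hx; have hsx : sg x \in Aint by rewrite Aint_aut.
have hk := Ok_ring; have hal := al_Aint.
case: (fr_qextE Ok_ring Ok_t sg_al sg_Ok hfr) => a [b [ha hb e]].
have hfk c : Ok c -> frac_of Ok c by move=> hc; apply: fr_R.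
have hsg c : frac_of Ok c -> sg c = c.
  by case=> c1 [c2 [h1 h2 _ ->]]; rewrite fmorph_div !sg_Ok.
have esx : sg x = a - b * al by rewrite e rmorphD rmorphM sg_al !hsg // mulrN.
have hA : Ok (2 * a).
  apply: Ok_closed; first by apply: frM => //; apply: hfk; exact: sring_nat.
  by rewrite (_ : 2 * a = x + sg x) ?rpredD // esx e; ring.
have hN : Ok (x * sg x).
  apply: Ok_closed; last by rewrite rpredM.
  rewrite (_ : _ * _ = a * a - b * b * t); last by rewrite esx e /sqrt_p; ring.
  by apply: frD => //; [exact: frM|apply: frN => //; apply: frM => //; [exact: frM|apply: hfk; exact: Ok_t]].
(* The same argument with t in place of p: z = 2bt satisfies z^2 = t (x - sg x)^2, so p divides its
   rational component z0, and z / t = 2b lies in [Ok]. *)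
have ez : (x - sg x) * al = 2 * b * t by rewrite esx e /sqrt_p; ring.
have hz : Ok (2 * b * t).
  apply: Ok_closed; last by rewrite -ez rpredM // rpredB.
  by apply: frM => //; [apply: frM => //|]; apply: hfk; [exact: sring_nat|exact: Ok_t].
have hw : Ok ((x - sg x) ^+ 2).
  apply: Ok_closed; last by rewrite rpredX // rpredB.
  rewrite (_ : _ ^+ 2 = 2 * b * (2 * b * t)); last by rewrite esx e /sqrt_p; ring.
  by apply: frM; [done|apply: frM => //; apply: hfk; exact: sring_nat|exact: hfk].
have hB : Ok (2 * b).
  have [z0 [z1 ezz]] := OkE hz; have [w0 [w1 ew]] := OkE hw.
  have [e1 _] : z0 * z0 + p%:Z * (z1 * z1) = p%:Z * w1 /\ 2 * z0 * z1 = w0.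
    apply: Ok_inj; rewrite !(intrM, intrD) -[p%:Z%:~R]/(p%:R : algC) -tt.
    transitivity ((2 * b * t) ^+ 2); first by rewrite ezz; ring.
    rewrite -ez exprMn ew -/t; ring.
  rewrite -(mulfK t0 (2 * b)) ezz; apply/Ok_div_t.
  have : (p%:Z %| z0 * z0)%Z by apply/dvdzP; exists (w1 - z1 * z1); lia.
  by case/Euclid_int.
have [a0 [a1 ea]] := OkE hA; have [b0 [b1 eb]] := OkE hB; have [n0 [n1 en]] := OkE hN.
have [q eq] := q_decomp.
have [e0 e1] : a0 * a0 + p%:Z * (a1 * a1) - 2 * p%:Z * (b0 * b1) = 4 * n0 /\
    2 * (a0 * a1) - b0 * b0 - p%:Z * (b1 * b1) = 4 * n1.
  apply: Ok_inj; rewrite !(intrM, intrD, rmorphN) /= !(intrM, intrD) -[p%:Z%:~R]/(p%:R : algC) -tt.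
  transitivity (4 * (x * sg x)); last by rewrite en; ring.
  transitivity ((2 * a) ^+ 2 - (2 * b) ^+ 2 * t); first by rewrite ea eb; ring.
  by rewrite esx e /sqrt_p; ring.
have [||i0 [i1 [j0 [j1 [h0 h1 h2 h3]]]]] := @mod4_even2 q a0 a1 b0 b1 n0 n1.
- by rewrite -e0 eq; lia.
- by rewrite -e1 eq; lia.
exists (i0%:~R + i1%:~R * t), (j0%:~R + j1%:~R * t); split; try exact: Okintro.
apply: (@mulfI _ 2); rewrite ?pnatr_eq0 // e.
transitivity (2 * a + 2 * b * al); first by ring.
by rewrite ea eb h0 h1 h2 h3 !intrM; ring.
Qed.

Lemma sqcl_O : sqcl O (frac_of O).
Proof. by move=> x hx hx2; apply: O_closed => //; apply: Aint_sqrt; apply: O_Aint. Qed.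

Lemma genfieldE : genfield al = frac_of O.
Proof.
have hO := O_ring; apply: pset_eq => x.
  apply; last by apply: fr_R => //; apply: O_al.
  split=> [||y z hy hz|y z hy hz|y hy _]; first by apply: fr_R => //; apply: sring0.
  - by apply: fr_R => //; apply: sring1.
  - by apply: frD => //; apply: frN.
  - exact: frM.
  exact: frV.
case=> u [v [hu hv v0 ->]] S [S0 S1 SB SM SV] Sa.
have SN y : S y -> S (- y) by move=> hy; rewrite -sub0r; apply: SB.
have SD y z : S y -> S z -> S (y + z).
  by move=> hy hz; rewrite -[z]opprK; apply: SB => //; apply: SN.
have SZ (n : int) : S n%:~R.
  have Sn (m : nat) : S m%:R by elim: m => // m IH; rewrite mulrSr; apply: SD.
  by case: n => m; rewrite ?NegzE ?rmorphN; [apply: Sn|apply: SN; apply: Sn].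
have Sk y : Ok y -> S y.
  by case/OkE=> a [b ->]; apply: SD => //; apply: (SM) => //; rewrite /sqrt_p expr2; apply: (SM).
have SO y : O y -> S y.
  by case=> a [b [/Sk ha /Sk hb ->]]; apply: SD => //; apply: SM.
by apply: SM; [apply: SO|apply: SV => //; apply: SO].
Qed.

Lemma ring_of_integersE : ring_of_integers (genfield al) = O.
Proof.
rewrite genfieldE; apply: pset_eq => x; first by case; apply: O_closed.
by move=> hx; split; [apply: fr_R => //; apply: O_ring|apply: O_Aint].
Qed.

Lemma nz_idealE I : nz_ideal (genfield al) I <-> ideal O I.
Proof.
rewrite /nz_ideal ring_of_integersE; split=> [[h1 h2 h3 h4 h5]|[[[h2 h3] h4] h1 h5]]; split=> //.
Qed.

Lemma ideal_equivE I J : ideal_equiv (genfield al) I J <-> equivI O I J.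
Proof.
rewrite /ideal_equiv ring_of_integersE.
split=> [[a [b [ha a0 hb b0 h]]]|[a [b [ha a0 hb b0 h]]]]; exists a, b; split=> //.
  by apply/funext=> z; apply/propext; apply: h.
by move=> z; rewrite -/(scaleI a I z) -/(scaleI b J z) h.
Qed.
End Basics.

(** * Automorphisms of algC changing the sign of a root *)

Local Notation QtoC p := (map_poly (ratr : rat -> algC) p).

(** The hypothesis makes x and - x conjugate over Q, so x -> - x defines an embedding of the number
    field Q(x), which extends to algC. *)
Lemma aut_neg (x : algC) :
  (forall q, root (QtoC q) x -> root (QtoC q) (- x)) ->
  {nu : {rmorphism algC -> algC} | nu x = - x}.
Proof.
move=> hx; have [Q [QC [[|z []] // [Dz]]] genQ] := num_field_exists [:: x].
pose phi := kHomExtend 1%AS \1%VF z (- z).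
have hom1 : kHom 1%AS 1%AS (\1%VF : 'End(Q)) by rewrite kHom1.
have pz0 : root (map_poly \1%VF (minPoly 1%AS z)) (- z).
  rewrite -(fmorph_root QC) rmorphN /= Dz -map_poly_comp.
  rewrite (@eq_map_poly _ _ _ QC) => [|a]; last by rewrite /= id_lfunE.
  set p1 := map_poly _ _.
  have [q1 Dp1] : exists q1, p1 = QtoC q1.
    have aP i : (minPoly 1%AS z)`_i \in 1%VS by apply/polyOverP; apply: minPolyOver.
    have {aP} a_ i := sig_eqW (vlineP _ _ (aP i)).
    exists (\poly_(i < size (minPoly 1%AS z)) sval (a_ i)).
    apply/polyP=> i; rewrite coef_poly coef_map coef_poly /=.
    case: ifP => _; rewrite ?rmorph0 //; case: (a_ i) => a /= ->.
    by rewrite alg_num_field fmorph_rat.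
  have : root p1 x by rewrite -Dz fmorph_root root_minPoly.
  by rewrite Dp1; apply: hx.
have phim : monoid_morphism phi.
  by apply/kHom_monoid_morphism; rewrite -genQ span_seq1 /= kHomExtendP.
pose phimM := GRing.isMonoidMorphism.Build _ _ phi phim.
pose phiRM : {rmorphism _ -> _} := HB.pack (fun_of_lfun phi) phimM.
have [nu Dnu] := extend_algC_subfield_aut QC phiRM.
by exists nu; rewrite -Dz -Dnu /= /phi (kHomExtend_val hom1 pz0) rmorphN.
Qed.

(** The hypothesis says that x lies outside Q(x^2). The odd part of q must then vanish at x, and the
    even part does not see the sign. *)
Lemma root_neg (x : algC) q :
  (forall u v : {poly rat}, (QtoC u).[x ^+ 2] * x = (QtoC v).[x ^+ 2] ->
     (QtoC u).[x ^+ 2] = 0) ->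
  root (QtoC q) x -> root (QtoC q) (- x).
Proof.
move=> hx; have e y : (QtoC q).[y] =
    (QtoC (even_poly q)).[y ^+ 2] + (QtoC (odd_poly q)).[y ^+ 2] * y.
  rewrite -{1}(poly_even_odd q) rmorphD rmorphM /= !map_comp_poly map_polyXn map_polyX.
  by rewrite hornerD hornerM !horner_comp hornerXn hornerX.
rewrite /root !e sqrrN => /eqP h.
have u0 : (QtoC (odd_poly q)).[x ^+ 2] = 0.
  apply: (hx _ (- even_poly q)); rewrite rmorphN hornerN.
  by apply/eqP; rewrite -addr_eq0 addrC h.
by move: h; rewrite u0 !mul0r => ->.
Qed.

Lemma quartic_exists p : prime p -> (p %% 16 = 7)%N ->
  exists D : quartic, qp D = p /\ qa D = fourth_root p.
Proof.
move=> p_pr p7; set a := fourth_root p.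
have a4 : a ^+ 4 = p%:R by rewrite rootCK.
have a_gt0 : 0 < a by rewrite rootC_gt0 // ltr0n prime_gt0.
set t := a ^+ 2; have tt : t ^+ 2 = p%:R by rewrite -exprM.
have t_gt0 : 0 < t by apply: exprn_gt0.
have t_rat : t \notin Crat.
  apply/negP=> ht.
  have : t \in Num.int.
    apply: Cint_rat_Aint => //; apply: Aint_sqrt.
    by rewrite tt Aint_Cnat // natr_nat.
  case/intrP=> n en.
  have : (n * n = p)%R by apply/eqP; rewrite -(eqr_int algC) intrM -en -expr2 tt.
  move/(congr1 absz); rewrite abszM /= => e.
  have : (p %| `|n| * `|n|)%N by rewrite e.
  rewrite Euclid_dvdM // orbb => hpn.
  have := dvdn_mul hpn hpn; rewrite e -[X in (_ %| X)%N]muln1 dvdn_pmul2l ?prime_gt0 //.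
  by rewrite dvdn1 => /eqP p1; rewrite p1 in p_pr.
have rat_val (u : {poly rat}) c : c \in Crat -> (QtoC u).[c] \in Crat.
  case/CratP=> r ->; rewrite horner_map; apply/CratP; by eexists.
have [|ta hta] := @aut_neg t.
  move=> q; apply: root_neg => u v; rewrite tt => h.
  apply: contraNeq t_rat => u0.
  rewrite -(mulKf u0 t) h; apply: rpredM; first rewrite rpredV.
    by apply: rat_val; apply: rpred_nat.
  by apply: rat_val; apply: rpred_nat.
(* Here u(t) a = v(t) must force u(t) = 0. Squaring and applying [ta] gives - t u(-t)^2 = v(-t)^2
   between reals, hence u(-t) = 0. *)
have [|sg hsg] := @aut_neg a.
  move=> q; apply: root_neg => u v; rewrite -/t => h.
  have hv (w : {poly rat}) : ta (QtoC w).[t] = (QtoC w).[- t].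
    rewrite -hta -horner_map /= -map_poly_comp; congr _.[_].
    by apply: eq_map_poly => c; rewrite /= fmorph_rat.
  have hr (w : {poly rat}) : (QtoC w).[- t] \is Num.real.
    apply: rpred_horner; last by rewrite rpredN gtr0_real.
    by apply/polyOverP => i; rewrite coef_map /= Creal_Crat //; apply/CratP; eexists.
  have e : (QtoC u).[t] ^+ 2 * t = (QtoC v).[t] ^+ 2 by rewrite -h exprMn.
  have e' : (QtoC u).[- t] ^+ 2 * (- t) = (QtoC v).[- t] ^+ 2.
    by rewrite -!hv -hta -!(rmorphXn ta) -rmorphM e.
  have h1 : 0 <= (QtoC v).[- t] ^+ 2 by rewrite real_exprn_even_ge0.
  have h2 : 0 <= (QtoC u).[- t] ^+ 2 by rewrite real_exprn_even_ge0.
  have h3 : (QtoC u).[- t] ^+ 2 * t <= 0 by rewrite -oppr_ge0 -mulrN e'.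
  apply/eqP; rewrite -(fmorph_eq0 ta) hv -sqrf_eq0 eq_le h2 andbT.
  by rewrite pmulr_lle0 in h3.
by exists (@Quartic p a sg ta p_pr p7 a_gt0 a4 hsg hta).
Qed.

(** * Pigeonhole arguments *)

Lemma pigeonhole (T T' : finType) (f : T -> T') : (#|T'| < #|T|)%N ->
  exists x y, x != y /\ f x = f y.
Proof.
move=> h; have /injectivePn[x [y nxy e]] : ~~ injectiveb f.
  by apply/injectiveP => /leq_card; rewrite leqNgt h.
by exists x, y.
Qed.

Lemma expn_succ_gt d N : (1 < d)%N -> (0 < N)%N -> ((N ^ d).+1 < N.+1 ^ d)%N.
Proof.
case: d => [|[|d]] // _ hN; elim: d => [|d IH]; first by rewrite !expnS !expn0; nia.
rewrite expnS [X in (_ < X)%N]expnS.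
apply: (@leq_trans (N.+1 * (N ^ d.+2).+2)); last by rewrite leq_mul2l IH orbT.
by rewrite mulSn mulnS; lia.
Qed.

Lemma truncn_close (x y : algC) : 0 <= x -> 0 <= y -> Num.truncn x = Num.truncn y ->
  `|x - y| < 1.
Proof.
move=> hx hy e; have /andP[x1 x2] := truncn_itv hx; have /andP[y1 y2] := truncn_itv hy.
rewrite -natr1 in x2; rewrite -natr1 in y2; rewrite e in x1 x2.
rewrite real_ltr_norml ?rpredB ?ger0_real //; apply/andP; split.
  by rewrite ltrBrDl ltrBlDr; apply: lt_le_trans y2 _; rewrite lerD2r.
by rewrite ltrBlDr addrC; apply: lt_le_trans x2 _; rewrite lerD2r.
Qed.

(** Dirichlet's box principle: (N + 1)^d sums with coefficients in 0..N, rescaled to [0, N^d], fall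
    into N^d + 1 unit intervals. Two sums in the same interval are subtracted. *)
Lemma small_form d N (b : 'I_d -> algC) : (1 < d)%N -> (0 < N)%N -> (forall i, 0 < b i) ->
  exists c : 'I_d -> int, [/\ exists i, c i != 0, forall i, (`|c i| <= N)%N &
    `|\sum_i (c i)%:~R * b i| < (\sum_i b i) / (N ^ d.-1)%:R].
Proof.
move=> hd hN hb; set S := \sum_i b i.
have S0 : 0 < S.
  rewrite /S (bigD1 (Ordinal (ltnW hd))) //= ltr_pwDl // sumr_ge0 // => i _.
  exact: ltW.
have Nd0 : 0 < (N ^ d.-1)%:R :> algC by rewrite ltr0n expn_gt0 hN.
pose v (x : {ffun 'I_d -> 'I_N.+1}) : algC := (\sum_i (x i)%:R * b i) * (N ^ d.-1)%:R / S.
have v0 x : 0 <= v x.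
  rewrite /v divr_ge0 ?(ltW S0) // mulr_ge0 ?(ltW Nd0) // sumr_ge0 // => i _.
  by rewrite mulr_ge0 ?ler0n ?ltW.
have vN x : v x <= (N ^ d)%:R.
  have eN : (N ^ d)%:R = N%:R * (N ^ d.-1)%:R :> algC by rewrite -natrM -expnS (ltn_predK hd).
  rewrite /v ler_pdivrMr // eN mulrAC ler_wpM2r ?(ltW Nd0) //.
  rewrite mulr_sumr ler_sum // => i _.
  by rewrite ler_wpM2r ?(ltW (hb i)) // ler_nat -ltnS.
have vt x : (Num.truncn (v x) < (N ^ d).+1)%N.
  by rewrite ltnS -(ler_nat algC); apply: le_trans (vN x); case/andP: (truncn_itv (v0 x)).
have [|x [y [nxy /(congr1 val) /= e]]] := @pigeonhole _ _ (fun x => Ordinal (vt x)).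
  by rewrite card_ord card_ffun !card_ord expn_succ_gt.
have {e} := truncn_close (v0 x) (v0 y) e.
exists (fun i => (x i : nat)%:Z - (y i : nat)%:Z); split.
- have [i hi] : exists i, x i != y i.
    by apply/existsP; apply: contraNT nxy => /existsPn h; apply/eqP/ffunP => i; apply/eqP; move: (h i); rewrite negbK.
  by exists i; apply: contraNneq hi => /eqP; rewrite subr_eq0 => /eqP[/val_inj->].
- by move=> i /=; move: (ltn_ord (x i)) (ltn_ord (y i)); move: (nat_of_ord (x i)) (nat_of_ord (y i)) => u w; lia.
rewrite ltr_pdivlMr // -[X in _ < X]mul1r -ltr_pdivrMr //.
rewrite (_ : _ / S = `|v x - v y|) //.
rewrite /v -mulrBl -mulrBl -sumrB normrM normfV (gtr0_norm S0) normrM (gtr0_norm Nd0).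
congr (`|_| * _ / _); apply: eq_bigr => i _.
by rewrite rmorphB /= mulrBl.
Qed.

(** Among #|T| + 1 terms of a sequence along which f strictly decreases, two share a class. The
    strict inequality later keeps a quotient of two elements from being a trivial unit. *)
Lemma decreasing_pigeonhole (T : finType) (X : pset) (f : algC -> algC) (cl : algC -> T) :
  (forall d : algC, 0 < d -> exists x, [/\ X x, 0 < f x & f x < d]) ->
  exists x y, [/\ X x, X y, cl x = cl y & f x < f y].
Proof.
move=> h; pose Y := {x | X x /\ 0 < f x}.
have hnext (y : Y) : {z : Y | f (sval z) < f (sval y)}.
  case: y => y [hy fy] /=; apply: cid.
  by have [z [hz fz hzy]] := h _ fy; exists (exist _ z (conj hz fz)).
have y0 : Y.
  by apply: cid; have [z [hz fz _]] := h 1 ltr01; exists z.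
pose s n : Y := iter n (fun y => sval (hnext y)) y0.
have hs m n : (m < n)%N -> f (sval (s n)) < f (sval (s m)).
  elim: n => // n IH; rewrite ltnS leq_eqVlt => /orP[/eqP->|/IH].
    exact: (svalP (hnext (s n))).
  exact: lt_trans (svalP (hnext (s n))).
have [|i [j [nij e]]] := @pigeonhole _ _ (fun i : 'I_#|T|.+1 => cl (sval (s i))).
  by rewrite card_ord.
have [hi _] := svalP (s i); have [hj _] := svalP (s j).
move: nij; rewrite -val_eqE /= neq_ltn => /orP[] hij.
  by exists (sval (s j)), (sval (s i)); split=> //; apply: hs.
by exists (sval (s i)), (sval (s j)); split=> //; apply: hs.
Qed.

(** * Residues in lattices and the construction of units *)

Definition lattice (R : pset) d (b : 'I_d -> algC) :=
  forall x, R x <-> exists c : 'I_d -> int, x = \sum_i (c i)%:~R * b i.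

Section Lattice.
Variables (R : pset) (d : nat) (b : 'I_d -> algC).
Hypotheses (hR : is_subring R) (hb : lattice R b).

(** The code is the vector of chosen coordinates reduced modulo m. *)
Lemma lattice_code m : (0 < m)%N ->
  exists f : algC -> {ffun 'I_d -> 'I_m},
    forall x y, R x -> R y -> f x = f y -> R ((x - y) / m%:R).
Proof.
case: m => // m _.
have hc x : exists c : 'I_d -> int, R x -> x = \sum_i (c i)%:~R * b i.
  have [/hb[c ->]|h] := pselect (R x); first by exists c.
  by exists (fun=> 0).
pose c x := sval (cid (hc x)).
have cP x : R x -> x = \sum_i (c x i)%:~R * b i by apply: (svalP (cid (hc x))).
pose r x i : nat := `|(c x i %% m.+1%:Z)%Z|%N.
have hr x i : (r x i < m.+1)%N by rewrite /r; lia.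
exists (fun x => [ffun i => Ordinal (hr x i)]) => x y hx hy /ffunP e.
apply/hb; exists (fun i => ((c x i - c y i) %/ m.+1%:Z)%Z).
rewrite {1}(cP _ hx) {1}(cP _ hy) -sumrB mulr_suml; apply: eq_bigr => i _.
have := congr1 val (e i); rewrite !ffunE /= /r => ei.
have {ei} : c x i - c y i = ((c x i - c y i) %/ m.+1%:Z)%Z * m.+1%:Z.
  apply/esym/divzK; rewrite -eqz_mod_dvd; apply/eqP.
  have hm u : (u %% m.+1%:Z)%Z = `|(u %% m.+1%:Z)%Z|%N by rewrite gez0_abs // modz_ge0.
  by rewrite hm ei -hm.
rewrite -mulrBl -rmorphB /= => {1}->; rewrite intrM mulrAC mulfK //.
by rewrite pnatr_eq0.
Qed.

(* Two elements of the same norm m that agree modulo m differ by a unit. *)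
Lemma unit_exists (nr : algC -> algC) (rho : {rmorphism algC -> algC}) (C : nat) :
  (forall x, R x -> x != 0 -> [/\ nr x \in Num.int, nr x != 0 & R (nr x / x)]) ->
  (forall e : algC, 0 < e -> exists x, [/\ R x, x != 0, `|nr x| <= C%:R & `|x / rho x| < e]) ->
  exists u, [/\ R u, R u^-1 & `|u| != `|rho u|].
Proof.
move=> hnr hsmall.
(* The modulus C! is a multiple of every possible norm, so a single code serves for all of them. *)
have [F FP] := lattice_code (fact_gt0 C).
pose n x := `|Num.floor (nr x)|%N.
pose X x := [/\ R x, x != 0 & (n x <= C)%N].
pose cl x : bool * 'I_C.+1 * {ffun 'I_d -> 'I_C`!} := (0 <= nr x, inord (n x), F x).
have en x : R x -> x != 0 -> nr x = (Num.floor (nr x))%:~R.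
  by move=> hx x0; have [/floorK] := hnr _ hx x0.
have enr x : R x -> x != 0 -> nr x = (-1) ^+ (~~ (0 <= nr x)) * (n x)%:R.
  move=> hx x0; have e := en _ hx x0; rewrite /n natr_absz intr_norm -e.
  have hr : nr x \is Num.real by rewrite e realz.
  by rewrite -real_ltNge ?real0 // real_mulr_sign_norm.
have [e e0|x [y [[hx x0 nx] [hy y0 ny] hcl hlt]]] :=
    @decreasing_pigeonhole _ X (fun x => `|x / rho x|) cl.
  have [x [hx x0 hC hlt]] := hsmall _ e0; exists x.
  rewrite normr_gt0 mulf_neq0 ?invr_eq0 ?fmorph_eq0 //; split=> //; split=> //.
  by rewrite -(ler_nat algC) /n natr_absz intr_norm -en.
case: hcl => hs /(congr1 val) /=; rewrite !inordK // => hn hF.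
have e : nr x = nr y by rewrite (enr _ hx x0) (enr _ hy y0) hs hn.
have [_ nx0 hxx] := hnr _ hx x0; have [_ _ hyy] := hnr _ hy y0.
have n0 : (0 < n x)%N.
  by rewrite lt0n; apply: contraNneq nx0 => h; rewrite (enr _ hx x0) h mulr0.
have hdiff : R ((x - y) / nr x).
  have /dvdnP[k ek] : (n x %| C`!)%N by apply: dvdn_fact; rewrite n0.
  have k0 : (k%:R : algC) != 0.
    by rewrite pnatr_eq0; apply: contraTneq (fact_gt0 C) => k0; rewrite ek k0.
  have nx0' : ((n x)%:R : algC) != 0 by rewrite pnatr_eq0 -lt0n.
  have [b' eb] : exists b' : bool, nr x = (-1) ^+ b' * (n x)%:R by eexists; exact: enr.
  have -> : (x - y) / nr x = (-1) ^+ b' * (k%:R * ((x - y) / C`!%:R)).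
    by rewrite eb ek natrM; case: b' {eb}; field; rewrite k0 nx0'.
  apply: (sringM hR); first by case: b' {eb}; rewrite ?expr0 ?expr1; ring_mem hR.
  by apply: (sringM hR); [exact: sring_nat|exact: FP].
exists (x / y); split.
(* x - y is a multiple of the common norm, and the norm is a multiple of y in R. *)
- have -> : x / y = 1 + ((x - y) / nr x) * (nr y / y) by rewrite e; field; rewrite y0 -e nx0.
  by ring_mem hR.
- have -> : (x / y)^-1 = 1 - ((x - y) / nr x) * (nr x / x) by field; rewrite x0 nx0.
  by ring_mem hR.
(* Equal absolute values of x / y and its conjugate would make |x / rho x| and |y / rho y| equal. *)
apply: contraTneq hlt; rewrite fmorph_div !normrM !normfV => h.
rewrite (_ : `|x| / `|rho x| = `|y| / `|rho y|) ?ltxx //.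
have nz (z : algC) : z != 0 -> `|rho z| != 0 by rewrite normr_eq0 fmorph_eq0.
have hz (z : algC) : z != 0 -> `|z| != 0 by rewrite normr_eq0.
have h1 := nz _ x0; have h2 := nz _ y0; have h3 := hz _ y0; have h4 := hz _ x0.
move: h h1 h2 h3 h4; move: `|x| `|y| `|rho x| `|rho y| => a1 a2 a3 a4 h h1 h2 h3 h4.
have -> : a1 = a3 / a4 * a2 by rewrite -h divfK.
by field; rewrite h1 h2.
Qed.
End Lattice.

(** * Z[sqrt p]: units and ideals of principal square *)

Lemma archi_div (a e : algC) : 0 <= a -> 0 < e -> exists2 N : nat, (0 < N)%N & a / N%:R < e.
Proof.
move=> ha he; exists (Num.truncn (a / e)).+1 => //.
rewrite ltr_pdivrMr ?ltr0n // mulrC -ltr_pdivrMr //.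
by case/andP: (truncn_itv (divr_ge0 ha (ltW he))).
Qed.

Lemma int_norm_ge1 (x : algC) : ZZ x -> x != 0 -> 1 <= `|x|.
Proof. by case/ZZP=> n ->; rewrite intr_eq0 -intr_norm ler1z; lia. Qed.

Lemma ideal_ZZ J : ideal ZZ J -> exists2 g : int, g != 0 & J = scaleI g%:~R ZZ.
Proof.
move=> hJ; have hZ := ZZ_ring; have hJa := ideal_agrp hJ.
have hex : exists n : nat, `[< (0 < n)%N /\ J n%:R >].
  have [_ _ [x [hx x0]]] := hJ; have [m em] := (ZZP _).1 (ideal_sub hJ hx).
  exists `|m|%N; apply/asboolP; split; first by rewrite absz_gt0 -(intr_eq0 algC) -em.
  rewrite natr_absz intr_norm -em; have hr : x \is Num.real by rewrite em realz.
  by case: (real_ge0P hr) => _ //; apply: agrpN.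
case: (ex_minnP hex) => g /asboolP[g0 Jg] gmin.
have g0' : (g%:R : algC) != 0 by rewrite pnatr_eq0 -lt0n.
exists g%:Z; first by lia.
apply: pset_eq => x; last first.
  by case=> y [hy ->]; apply: (ideal_mulr hJ).
move=> hx; have [m em] := (ZZP _).1 (ideal_sub hJ hx).
have eC : m%:~R = (m %/ g)%Z%:~R * g%:R + (m %% g)%Z%:~R :> algC.
  by rewrite -[g%:R]/(g%:Z%:~R) -intrM -intrD -divz_eq.
have hr : J (`|(m %% g)%Z|%N)%:R.
  rewrite natr_absz ger0_norm; last by rewrite modz_ge0 // eqz_nat -lt0n.
  have -> : (m %% g)%Z%:~R = x - (m %/ g)%Z%:~R * g%:R :> algC.
    by rewrite em eC addrAC subrr add0r.
  by apply: (agrpB hJa) => //; apply: (ideal_mul hJ) => //; apply/ZZP; eexists.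
have r0 : (m %% g)%Z = 0.
  apply/eqP; rewrite -absz_eq0; apply: contraT; rewrite -lt0n => r0.
  have := gmin _ (introT (asboolP _) (conj r0 hr)).
  by have := @ltz_pmod m g; lia.
exists (m %/ g)%Z%:~R; split; first by apply/ZZP; eexists.
by rewrite em eC r0 addr0 mulrC.
Qed.

Lemma dvd4_cases (n : nat) : (n %| 4)%N -> [\/ n = 1%N, n = 2%N | n = 4%N].
Proof.
move=> h; have := @dvdn_leq n 4 isT h; move: h.
by case: n => [|[|[|[|[|n]]]]] // _ _; [constructor 1|constructor 2|constructor 3].
Qed.

Section OkFacts.
Variable D : quartic.
Local Notation p := (qp D).
Local Notation ta := (qt D).
Local Notation t := (sqrt_p D).
Local Notation Ok := (Ok D).

Lemma Ok_norm x : Ok x -> ZZ (x * ta x).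
Proof. exact: (qext_norm ZZ_ring (ZZ_tt D) (ta_t D) (ta_ZZ D)). Qed.
Lemma Ok_trace x : Ok x -> ZZ (x + ta x).
Proof. exact: (qext_trace ZZ_ring (ta_t D) (ta_ZZ D)). Qed.
Lemma Ok_conj x : Ok x -> Ok (ta x).
Proof. exact: (qext_conj ZZ_ring (ta_t D) (ta_ZZ D)). Qed.
Lemma Ok_conjK x : Ok x -> ta (ta x) = x.
Proof. exact: (qext_conjK (ta_t D) (ta_ZZ D)). Qed.
Lemma Ok_lattice : lattice Ok (fun i : 'I_2 => t ^+ i).
Proof.
move=> x; split=> [/OkE[a [b ->]]|[c ->]].
  exists (fun i => if i == ord0 then a else b).
  by rewrite !big_ord_recl big_ord0 /= expr0 expr1 mulr1 addr0.
by rewrite !big_ord_recl big_ord0 /= expr0 expr1 mulr1 addr0; apply: Okintro.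
Qed.

Lemma Ok_real x : Ok x -> x \is Num.real.
Proof.
case/OkE=> a [b ->]; rewrite rpredD // ?realz // rpredM ?realz //.
exact: gtr0_real (t_gt0 D).
Qed.

(** Dirichlet's solution of Pell's equation. [small_form] gives |x| < S / N and |ta x| <= N S, so
    the norm is bounded by S^2, while |x / ta x| <= |x|^2 becomes arbitrarily small. *)
Lemma Ok_unit_exists : exists u, [/\ Ok u, Ok u^-1 & `|u| != `|ta u|].
Proof.
pose S : algC := 1 + t; have t_gt0 := t_gt0 D; have S0 : 0 < S by rewrite addr_gt0.
apply: (unit_exists (Ok_ring D) Ok_lattice (nr := fun x => x * ta x)
  (C := (Num.truncn (S ^+ 2)).+1)).
  move=> x hx x0; have hn := Ok_norm hx; split=> //.
    by rewrite mulf_neq0 ?fmorph_eq0.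
  by rewrite mulrC mulKf //; apply: Ok_conj.
move=> e e0; have S20 : 0 <= S ^+ 2 by apply/ltW/exprn_gt0.
have [N N0 hN] := archi_div S20 e0.
have N0' : 0 < N%:R :> algC by rewrite ltr0n.
have [|c [[i ci] hc]] := @small_form 2 N (fun i : 'I_2 => t ^+ i) isT N0.
  by move=> i; apply: exprn_gt0.
set x := \sum_i _; rewrite /= expn1 big_ord_recl big_ord1 expr0 expr1 -/S => hx.
have xE : x = (c ord0)%:~R + (c (lift ord0 ord0))%:~R * t.
  by rewrite /x big_ord_recl big_ord1 expr0 expr1 mulr1.
have hOk : Ok x by rewrite xE; apply: Okintro.
have x0 : x != 0.
  apply: contraNneq ci => x0; move: xE; rewrite x0 -[0]addr0 -{2}(mul0r t).
  case/(@Ok_inj D 0 0) => e1 e2.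
  by case: i => -[|[|//]] hi; [rewrite (_ : Ordinal hi = ord0)|rewrite (_ : Ordinal hi = lift ord0 ord0)];
    rewrite -?e1 -?e2 //; apply: val_inj.
have hz j : `|(c j)%:~R| <= N%:R :> algC.
  by have := hc j; rewrite -(ler_nat algC) natr_absz intr_norm.
have htx : `|ta x| <= N%:R * S.
  rewrite xE rmorphD rmorphM !rmorph_int ta_t mulrDr mulr1.
  apply: le_trans (ler_normD _ _) _; apply: lerD => //.
  by rewrite mulrN normrN normrM (gtr0_norm t_gt0) ler_wpM2r // ltW.
exists x; split=> //.
  rewrite normrM; apply: le_trans (_ : S ^+ 2 <= _).
    rewrite (_ : S ^+ 2 = S / N%:R * (N%:R * S)); last by field; rewrite gt_eqF.
    by apply: ler_pM => //; apply: ltW.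
  by apply/ltW; case/andP: (truncn_itv S20).
have hn1 := int_norm_ge1 (Ok_norm hOk); rewrite mulf_neq0 ?fmorph_eq0 // in hn1.
have h1 : `|x / ta x| <= `|x| ^+ 2.
  have -> : `|x / ta x| = `|x| ^+ 2 / `|x * ta x|.
    rewrite -normrX -normf_div; congr `|_|; field.
    by rewrite fmorph_eq0 x0.
  rewrite ler_pdivrMr; last by apply: lt_le_trans ltr01 (hn1 isT).
  by rewrite ler_peMr ?exprn_ge0 ?hn1.
apply: le_lt_trans h1 _; apply: le_lt_trans (_ : _ <= (S / N%:R) ^+ 2) _.
  by rewrite lerXn2r ?nnegrE ?normr_ge0 ?divr_ge0 ?(ltW S0) ?ler0n // ltW.
apply: le_lt_trans hN; rewrite expr_div_n ler_wpM2l // lef_pV2 ?posrE ?exprn_gt0 //.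
by rewrite -natrX ler_nat; nia.
Qed.


(** Here B meets Z in (g), so c divides g^2, and g^2 divides 4 p c. Up to rational squares c is thus
    a divisor of 4 p. *)
Lemma square_descent_ZZ B (c : int) : ideal Ok B -> c != 0 -> mulI B B = scaleI c%:~R Ok ->
  exists g g' : int, [/\ g != 0, c * g' = g ^+ 2 & (g' %| 4 * p%:Z)%Z].
Proof.
move=> hB c0 hBB; have hZ := ZZ_ring.
have [||h1 h2] := square_descent hZ (t0 D) (ZZ_tt D) (ta_t D) (ta_ZZ D) (@sqcl_Ok D) hB _ _ hBB.
- by apply/ZZP; eexists.
- by rewrite intr_eq0.
have [g g0 eJ] := ideal_ZZ (ideal_res hZ (ZZ_tt D) (ta_t D) (ta_ZZ D) hB).
have g0' : (g%:~R : algC) != 0 by rewrite intr_eq0.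
have c0' : (c%:~R : algC) != 0 by rewrite intr_eq0.
have eJJ : mulI (restrI ZZ B) (restrI ZZ B) = scaleI (g%:~R ^+ 2) ZZ.
  by rewrite eJ mulI_scl mulI_scr -scM (mulI_RR hZ).
rewrite eJJ in h1 h2.
have /ZZP[g' eg'] := h1 _ (sc_self hZ _).
have [_ [/ZZP[k ->] ek]] := h2.
exists g, g'; split=> //.
  by apply: int_eq; rewrite intrM -eg' rmorphXn /=; field.
apply/dvdzP; exists k; apply: int_eq; rewrite !intrM -eg'.
apply: (mulIf c0'); rewrite -[p%:Z%:~R]/(p%:R : algC) -tt ek; field; exact: c0'.
Qed.

Lemma dvd4p_cases (g : int) : (g %| 4 * p%:Z)%Z ->
  exists e j : nat, [/\ [\/ e = 1%N, e = 2%N | e = 4%N], (j <= 1)%N & `|g|%N = (e * p ^ j)%N].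
Proof.
rewrite dvdzE abszM /= => h; have pp := q_prime D.
have [hp|hp] := boolP (p %| `|g|)%N; last first.
  exists `|g|%N, 0%N; rewrite expn0 muln1; split=> //; apply: dvd4_cases.
  by rewrite Gauss_dvdl // in h; rewrite coprime_sym prime_coprime.
case/dvdnP: hp => e ee; exists e, 1%N; rewrite expn1; split=> //; apply: dvd4_cases.
by move: h; rewrite ee dvdn_pmul2r // prime_gt0.
Qed.

(** The norm - 1 is excluded modulo 4, where a^2 - p b^2 is a^2 + b^2. *)
Lemma Ok_unit_norm u : Ok u -> Ok u^-1 -> u != 0 -> u * ta u = 1.
Proof.
move=> hu hu' u0; have [a [b e]] := OkE hu.
have /ZZP[n en] := Ok_norm hu; have /ZZP[n' en'] := Ok_norm hu'.
have e1 : n * n' = 1.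
  by apply: int_eq; rewrite intrM -en -en' fmorphV; field; rewrite fmorph_eq0 u0.
have e2 : a * a - p%:Z * (b * b) = n.
  apply: int_eq; rewrite -en e (rmorphD ta) (rmorphM ta) !(rmorph_int ta) ta_t.
  by rewrite !(intrM, rmorphB) /= !intrM -[p%:Z%:~R]/(p%:R : algC) -tt; ring.
suff -> : u * ta u = 1%:~R by [].
rewrite en; congr (_%:~R); have [q eq] := q_decomp D; rewrite eq in e2.
have [h|h] : n = 1 \/ n = -1.
    have /eqP := congr1 absz e1; rewrite abszM muln_eq1 => /andP[/eqP h _]; lia.
  by [].
exfalso; rewrite h in e2; have [i [hi|hi]] := int_parity a; have [j [hj|hj]] := int_parity b;
  rewrite hi hj in e2; lia.
Qed.

(* By Hilbert 90, u = f^2 / r with r a rational integer, so that (f)^2 = (r) and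
   [square_descent_ZZ] determines r up to squares. *)
Lemma Ok_unit_square u : Ok u -> Ok u^-1 -> 0 < u ->
  exists2 w, Ok w & u = w ^+ 2 \/ 2 * u = w ^+ 2.
Proof.
move=> hu hu' u_gt0; have u0 : u != 0 by rewrite gt_eqF.
have hZ := ZZ_ring; have hR := Ok_ring D; have t_gt0 := t_gt0 D.
have [||e|[f [r [hf /ZZP[m ->] f0 r0 efr]]]] :=
  hilbert90 hZ (ZZ_tt D) (ta_t D) (ta_ZZ D) hu (d := 1).
- exact: sring1.
- by rewrite expr1n; apply: Ok_unit_norm.
- by rewrite e oppr_gt0 ltr10 in u_gt0.
have m0 : m != 0 by rewrite -(intr_eq0 algC).
have [|g [g' [g0 eg hg']]] := square_descent_ZZ (ideal_pr hR hf f0) m0.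
  rewrite mulI_scl mulI_scr -scM (mulI_RR hR) -expr2 efr mulrC scM.
  by rewrite (sc_unit (rmod_self hR)).
have g0' : (g%:~R : algC) != 0 by rewrite intr_eq0.
have egC : m%:~R * g'%:~R = g%:~R ^+ 2 :> algC by rewrite -intrM eg rmorphXn.
have g'0 : (g'%:~R : algC) != 0.
  by apply: contraNneq g0' => h; move: egC; rewrite h mulr0 => /esym/eqP; rewrite sqrf_eq0.
have e1 : u * g'%:~R = (f * g'%:~R / g%:~R) ^+ 2.
  by rewrite expr_div_n exprMn efr -egC; field; rewrite r0 g'0.
have hreal : f * g'%:~R / g%:~R \is Num.real.
  by rewrite rpred_div ?rpredM ?realz ?Ok_real.
have g'_gt0 : 0 < g'.
  rewrite lt_def; apply/andP; split.
    by apply: contraNneq g0 => h; move: eg; rewrite h mulr0 => /esym/eqP; rewrite sqrf_eq0.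
  by rewrite -(ler0z algC) -(pmulr_rge0 _ u_gt0) e1 real_exprn_even_ge0.
have [e [j [he hj ej]]] := dvd4p_cases hg'.
(* The factor p^j is the square of t^j, so only the divisor e of 4 remains; for e = 4 the root is
   halved. *)
have {}ej : g'%:~R = e%:R * t ^+ 2 ^+ j :> algC.
  rewrite tt -natrX -natrM -ej natr_absz ger0_norm ?ltW //.
pose w := f * g'%:~R / g%:~R / t ^+ j.
have tj0 : t ^+ j != 0 by rewrite expf_neq0 // t0.
have ew : w ^+ 2 = u * e%:R.
  by rewrite /w expr_div_n -e1 ej -exprM mulnC exprM mulrA mulfK // expf_neq0.
have hw : Ok w.
  apply: sqcl_Ok; last by rewrite ew; ring_mem hR.
  rewrite /w; do !apply: (frM hR) => //; try (apply: (frV hR)); apply: (fr_R hR); ring_mem hR.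
  exact: Ok_t.
case: he ew => -> ew.
- by exists w => //; left; rewrite ew mulr1.
- by exists w => //; right; rewrite ew mulrC.
exists (w / 2); last by left; rewrite expr_div_n ew; field.
apply: sqcl_Ok; first by apply: (fr_div hR) => //; exact: (sring_nat hR 2).
by rewrite expr_div_n ew (_ : u * 4 / 2 ^+ 2 = u) //; field.
Qed.

End OkFacts.

(** * Conjugate ideals *)

Section Conj.
Variable s : {rmorphism algC -> algC}.

Definition conjI (I : pset) : pset := fun z => exists x, I x /\ z = s x.

Lemma agrp_cj I : agrp I -> agrp (conjI I).
Proof.
move=> hI; split=> [|_ _ [x [hx ->]] [y [hy ->]]].
  by exists 0; rewrite rmorph0; split=> //; apply: agrp0.
by exists (x - y); rewrite rmorphB; split=> //; apply: agrpB.
Qed.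

Lemma cj_mem I x : I x -> conjI I (s x). Proof. by exists x. Qed.

Lemma mulI_cj I J : mulI (conjI I) (conjI J) = conjI (mulI I J).
Proof.
apply: pset_eq.
  apply: mulI_sub => [|_ _ [x [hx ->]] [y [hy ->]]]; first by apply: agrp_cj; apply: agrp_mulI.
  by rewrite -rmorphM; apply: cj_mem; apply: mem_mulI.
move=> _ [x [hx ->]]; move: x hx.
apply: (@mulI_sub _ _ (fun x => mulI (conjI I) (conjI J) (s x))) => [|x y hx hy].
  by apply: (agrp_pre (agrp_mulI _ _)) => [|x y]; rewrite ?rmorph0 ?rmorphB.
by rewrite rmorphM; apply: mem_mulI; apply: cj_mem.
Qed.

Lemma cj_sc a I : conjI (scaleI a I) = scaleI (s a) (conjI I).
Proof.
apply: pset_eq; first by move=> _ [_ [[x [hx ->]] ->]]; rewrite rmorphM; exists (s x); split=> //; exists x.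
by move=> _ [_ [[x [hx ->]] ->]]; exists (a * x); rewrite rmorphM; split=> //; exists x.
Qed.

Lemma ideal_cj R I : (forall x, R x -> R (s x)) -> (forall x, R x -> s (s x) = x) ->
  ideal R I -> ideal R (conjI I).
Proof.
move=> h1 h2 hI; split.
- split; first by apply: agrp_cj; apply: ideal_agrp hI.
  move=> r _ hr [x [hx ->]]; rewrite -{1}(h2 _ hr) -rmorphM; apply: cj_mem.
  by apply: (ideal_mul hI) => //; apply: h1.
- by move=> _ [x [hx ->]]; apply: h1; apply: ideal_sub hx.
case: hI => _ _ [x [hx x0]]; exists (s x); rewrite fmorph_eq0; split=> //.
exact: cj_mem.
Qed.

Lemma cj_ring R : (forall x, R x -> R (s x)) -> (forall x, R x -> s (s x) = x) -> conjI R = R.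
Proof.
move=> h1 h2; apply: pset_eq => [_ [x [hx ->]]|x hx]; first exact: h1.
by exists (s x); rewrite h2 //; split=> //; apply: h1.
Qed.
End Conj.

Section Normalise.
Variables (R : pset) (hR : is_subring R) (q : algC) (nu : algC -> nat).
Hypothesis q0 : q != 0.
Hypothesis hprime : forall x y, R x -> R y -> R (x * y / q) -> R (x / q) \/ R (y / q).
Hypothesis hnu : forall x, R x -> x != 0 -> R (x / q) -> (nu (x / q) < nu x)%N.

Lemma square_normalise J e : ideal R J -> R e -> e != 0 -> mulI J J = scaleI e R ->
  exists m J' e', [/\ ideal R J', J = scaleI (q ^+ m) J', R e' /\ ~ R (e' / q),
    e = q ^+ m ^+ 2 * e' & mulI J' J' = scaleI e' R].
Proof.
elim: (nu e).+1 {-2}e J (ltnSn (nu e)) => // n IH {}e J hn hJ he e0 hJJ.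
have [hq|hq] := pselect (R (e / q)); last first.
  by exists 0%N, J, e; rewrite !expr0 expr1n mul1r sc1.
have hJq x : J x -> R (x / q).
  move=> hx; have hRx := ideal_sub hJ hx.
  suff /(hprime hRx hRx)[] : R (x * x / q) by [].
  have [y [hy ->]] : scaleI e R (x * x) by rewrite -hJJ; apply: mem_mulI.
  by rewrite mulrAC; apply: sringM.
have hJ1 : ideal R (scaleI q^-1 J).
  split; first by apply: rmod_sc; apply: ideal_rmod.
    by move=> _ [x [hx ->]]; rewrite mulrC; apply: hJq.
  by case: hJ => _ _; apply: nonz_sc; rewrite invr_eq0.
have hJJ1 : mulI (scaleI q^-1 J) (scaleI q^-1 J) = scaleI (e / q / q) R.
  by rewrite mulI_scl mulI_scr hJJ -!scM; congr (scaleI _ _); ring.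
have he1 : R (e / q / q).
  apply: (ideal_sub (ideal_mulI hR hJ1 hJ1)); rewrite hJJ1; exact: sc_self.
have eq0 : e / q != 0 by rewrite mulf_neq0 ?invr_eq0.
have [||m [J' [e' [h1 h2 h3 h4 h5]]]] := IH (e / q / q) (scaleI q^-1 J) _ hJ1 he1 _ hJJ1.
- apply: leq_trans (hnu hq eq0 he1) _; apply: ltnW; apply: leq_trans (hnu he e0 hq) _.
  by rewrite -ltnS.
- by rewrite mulf_neq0 ?invr_eq0.
exists m.+1, J', e'; split=> //.
  by rewrite exprS scM -h2 -scM divff ?sc1.
have -> : e = q ^+ 2 * (e / q / q) by field.
by rewrite h4 [q ^+ m.+1]exprS exprMn mulrA.
Qed.
End Normalise.

(** * The ramified primes pi and sqrt p of Z[sqrt p] *)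

Record pquartic := PQuartic {
  pq :> quartic; qpi : algC; qep : algC;
  qpi_Ok : Ok pq qpi; qep_Ok : Ok pq qep; qepV_Ok : Ok pq qep^-1; qep_gt0 : 0 < qep;
  qpi2 : 2 * qep = qpi ^+ 2 }.

(** Square roots of a positive unit u other than 1 are extracted until 2 u is a square instead. This
    ends because traces drop: if u = w^2 with w > 0, the traces k of w and m of u satisfy k^2 = m +
    2 and k > 2, the latter from w + 1/w - 2 = (w - 1)^2 / w. *)
Lemma pquartic_exists (D : quartic) : exists D' : pquartic, pq D' = D.
Proof.
suff [pi [ep [h1 h2 h3 h4 h5]]] : exists pi ep,
    [/\ Ok D pi, Ok D ep, Ok D ep^-1, 0 < ep & 2 * ep = pi ^+ 2].
  by exists (PQuartic h1 h2 h3 h4 h5).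
have hR := Ok_ring D; set ta := qt D.
have step (n : nat) : forall u (m : int), (`|m| < n)%N -> Ok D u -> Ok D u^-1 -> 0 < u -> ta u != u ->
    u + ta u = m%:~R -> exists pi ep,
    [/\ Ok D pi, Ok D ep, Ok D ep^-1, 0 < ep & 2 * ep = pi ^+ 2].
  elim: n => // n IH u m hm hu hu' u_gt0 hta em.
  have [w hw [ew|ew]] := Ok_unit_square hu hu' u_gt0; last by exists w, u.
  have u0 : u != 0 by rewrite gt_eqF.
  wlog w_gt0 : w hw ew / 0 < w.
    move=> H; have w0 : w != 0 by apply: contraNneq u0 => w0; rewrite ew w0 expr0n.
    have hr : w \is Num.real by apply: Ok_real hw.
    have [h|h|h] := real_ltgt0P hr; first by apply: (H w).
      by apply: (H (- w)); rewrite ?sqrrN ?oppr_gt0 //; apply: sringN.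
    by rewrite h eqxx in w0.
  have w0 : w != 0 by rewrite gt_eqF.
  have hw' : Ok D w^-1.
    have -> : w^-1 = w * u^-1 by rewrite ew; field.
    exact: sringM.
  have hwt : ta w != w by apply: contraNneq hta => e; rewrite ew rmorphXn /= e.
  have /ZZP[k ek] := Ok_trace hw.
  have nw := Ok_unit_norm hw hw' w0.
  have ekm : k * k = m + 2.
    apply: int_eq; rewrite intrM intrD -ek -em ew rmorphXn /= -/ta.
    transitivity (w ^+ 2 + ta w ^+ 2 + 2 * (w * ta w)); first by ring.
    by rewrite nw mulr1.
  have k2 : 2 < k.
    rewrite -(ltr_int algC) -subr_gt0 -ek.
    have -> : w + ta w - 2%:~R = (w - 1) ^+ 2 / w.
      apply: (mulIf w0); rewrite divfK //.
      transitivity (w ^+ 2 + w * ta w - 2 * w); first by rewrite -/ta; ring.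
      by rewrite nw; ring.
    rewrite divr_gt0 // lt_def sqrf_eq0 subr_eq0; apply/andP; split.
      by apply: contraNneq hwt => ->; rewrite rmorph1.
    by rewrite real_exprn_even_ge0 // rpredB ?(Ok_real hw) ?real1.
  apply: (IH w k) => //.
  have : 0 <= (k - 3) * k by apply: mulr_ge0; lia.
  lia.
have [u [hu hu' hn]] := Ok_unit_exists D.
have u0 : u != 0 by apply: contraNneq hn => ->; rewrite rmorph0.
have htau : ta u != u by apply: contraNneq hn => e; rewrite -/ta e.
have hr : u \is Num.real by apply: Ok_real hu.
have [h|h|h] := real_ltgt0P hr; last by rewrite h eqxx in u0.
  by have /ZZP[m em] := Ok_trace hu; exact: (step `|m|%N.+1 u m (ltnSn _) hu hu' h htau em).
have hu2 : Ok D (- u) by apply: sringN.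
have /ZZP[m em] := Ok_trace hu2; apply: (step `|m|%N.+1 (- u) m (ltnSn _) hu2 _ _ _ em).
- by rewrite invrN; apply: sringN.
- by rewrite oppr_gt0.
by rewrite rmorphN eqr_opp.
Qed.

Section Primes.
Variable D : pquartic.
Local Notation p := (qp D).
Local Notation t := (sqrt_p D).
Local Notation Ok := (Ok D).
Local Notation pi := (qpi D).
Local Notation ep := (qep D).

Let hR := Ok_ring D.
Let hpi : Ok pi := qpi_Ok D.
Let hep : Ok ep := qep_Ok D.
Let hep' : Ok ep^-1 := qepV_Ok D.

Lemma ep0 : ep != 0. Proof. by rewrite gt_eqF ?qep_gt0. Qed.
Lemma pi0 : pi != 0.
Proof. by rewrite -sqrf_eq0 -qpi2 mulf_neq0 ?pnatr_eq0 ?ep0. Qed.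

Lemma Ok_half : ~ Ok (2^-1).
Proof.
case/OkE=> a [b e]; have : 1 + 0 * t = (2 * a)%:~R + (2 * b)%:~R * t.
  by rewrite !intrM mul0r addr0; transitivity (2 * (2^-1 : algC)); [field|rewrite e; ring].
case/(@Ok_inj D 1 0) => e1 _; lia.
Qed.

(** The residue field of pi is F_2 and t = 1 in it: (1 + t)^2 = 2 (8 q + 4 + t), so (1 + t) / pi has
    its square in [Ok]. On the other hand 1 / pi is not in [Ok], since 1/2 is not. *)
Lemma Ok_div_pi (a b : int) : Ok ((a%:~R + b%:~R * t) / pi) <-> exists c, a + b = 2 * c.
Proof.
have p0 := pi0; have e0 := ep0.
have h2 : Ok (2 / pi).
  rewrite (_ : 2 / pi = pi * ep^-1); first by ring_mem hR.
  by apply: (mulIf p0); rewrite divfK // mulrAC -expr2 -qpi2 mulfK.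
have h1t : Ok ((1 + t) / pi).
  apply: sqcl_Ok; first by apply: (fr_div hR) => //; ring_mem hR; exact: Ok_t.
  have [q eq] := q_decomp D.
  have -> : ((1 + t) / pi) ^+ 2 = ((q%:R * 8 + 4) + t) * ep^-1.
    rewrite expr_div_n -qpi2.
    have -> : (1 + t) ^+ 2 = 2 * ((q%:R * 8 + 4) + t).
      transitivity (1 + 2 * t + t ^+ 2); first by ring.
      by rewrite tt eq natrD natrM; ring.
    by field; rewrite e0.
  by ring_mem hR; exact: Ok_t.
have hodd : ~ Ok (1 / pi).
  move=> h; apply: Ok_half.
  have -> : 2^-1 = (1 / pi) * (1 / pi) * ep.
    by transitivity (ep / pi ^+ 2); [rewrite -qpi2; field; rewrite e0|field; rewrite p0].
  by ring_mem hR.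
split=> [h|[c ec]].
  have [c [hc|hc]] := int_parity (a + b); first by exists c.
  case: hodd.
  have -> : 1 / pi = (a%:~R + b%:~R * t) / pi - b%:~R * ((1 + t) / pi) - (c - b)%:~R * (2 / pi).
    have -> : a%:~R = 2 * c%:~R + 1 - b%:~R :> algC.
      by rewrite -[2]/(2%:~R) -intrM -[1]/(1%:~R) -intrD -rmorphB; congr (_%:~R); lia.
    by rewrite rmorphB /=; field.
  by ring_mem hR.
have -> : (a%:~R + b%:~R * t) / pi = b%:~R * ((1 + t) / pi) + (c - b)%:~R * (2 / pi).
  have -> : a%:~R = 2 * c%:~R - b%:~R :> algC.
    by rewrite -[2]/(2%:~R) -intrM -rmorphB; congr (_%:~R); lia.
  by rewrite rmorphB /=; field.
by ring_mem hR.
Qed.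

Lemma Ok_pi_max x : Ok x -> Ok (x / pi) \/ exists2 y, Ok y & Ok ((1 - x * y) / pi).
Proof.
case/OkE=> a [b ->]; have [c [hc|hc]] := int_parity (a + b).
  by left; apply/Ok_div_pi; exists c.
right; exists 1; first exact: sring1.
have -> : 1 - (a%:~R + b%:~R * t) * 1 = (1 - a)%:~R + (- b)%:~R * t.
  by rewrite rmorphB rmorphN /=; ring.
by apply/Ok_div_pi; exists (- c); lia.
Qed.

Lemma Ok_pi_prime x y : Ok x -> Ok y -> Ok (x * y / pi) -> Ok (x / pi) \/ Ok (y / pi).
Proof.
move=> /OkE[a [b ->]] /OkE[c [d ->]].
have [q eq] := q_decomp D.
have -> : (a%:~R + b%:~R * t) * (c%:~R + d%:~R * t) =
    (a * c + p%:Z * (b * d))%:~R + (a * d + b * c)%:~R * t.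
  by rewrite !(intrD, intrM) -[p%:Z%:~R]/(p%:R : algC) -tt; ring.
case/Ok_div_pi=> m; rewrite eq => em.
have [c1 [hc1|hc1]] := int_parity (a + b); first by left; apply/Ok_div_pi; exists c1.
have [c2 [hc2|hc2]] := int_parity (c + d); first by right; apply/Ok_div_pi; exists c2.
exfalso; have ea : a = 2 * c1 + 1 - b by lia.
have ec : c = 2 * c2 + 1 - d by lia.
rewrite ea ec in em; lia.
Qed.

Lemma Ok_piV : ~ Ok pi^-1.
Proof.
have -> : pi^-1 = (1%:~R + 0%:~R * t) / pi by rewrite mul0r addr0 mul1r.
by case/Ok_div_pi=> c; lia.
Qed.

Lemma Ok_t_max x : Ok x -> Ok (x / t) \/ exists2 y, Ok y & Ok ((1 - x * y) / t).
Proof.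
case/OkE=> a [b ->]; have [hp|hp] := boolP (p%:Z %| a)%Z; first by left; apply/Ok_div_t.
right; have : coprimez p a.
  by rewrite coprimezE prime_coprime ?q_prime // -dvdzE.
case/coprimezP=> -[u v] /= e.
exists v%:~R; first exact: sring_int.
have -> : 1 - (a%:~R + b%:~R * t) * v%:~R = (u * p)%:~R + (- (b * v))%:~R * t.
  rewrite rmorphN /= !intrM.
  have : u%:~R * p%:Z%:~R + v%:~R * a%:~R = 1 :> algC by rewrite -!intrM -intrD e.
  by move=> e1; rewrite -{1}e1; ring.
by apply/Ok_div_t; apply: dvdz_mull.
Qed.

Lemma Ok_t_prime x y : Ok x -> Ok y -> Ok (x * y / t) -> Ok (x / t) \/ Ok (y / t).
Proof.
move=> /OkE[a [b ->]] /OkE[c [d ->]].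
have -> : (a%:~R + b%:~R * t) * (c%:~R + d%:~R * t) =
    (a * c + p%:Z * (b * d))%:~R + (a * d + b * c)%:~R * t.
  by rewrite !(intrD, intrM) -[p%:Z%:~R]/(p%:R : algC) -tt; ring.
case/Ok_div_t/dvdzP=> k ek.
have : (p%:Z %| a * c)%Z by apply/dvdzP; exists (k - b * d); lia.
by case/Euclid_int=> h; [left|right]; apply/Ok_div_t.
Qed.

End Primes.

(** Modulo 4 this would read a^2 + b^2 + d^2 = 0 with d odd. *)
Lemma neg_square_not_norm (q a b d i : int) :
  a * a - (q * 16 + 7) * (b * b) = - (d * d) -> - (d * d) = 2 * i + 1 -> False.
Proof.
have [a' [->|->]] := int_parity a; have [b' [->|->]] := int_parity b;
  have [d' [->|->]] := int_parity d; lia.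
Qed.

(** * Ideals with principal square *)

Section SquareIdeals.
Variable D : pquartic.
Local Notation p := (qp D).
Local Notation ta := (qt D).
Local Notation t := (sqrt_p D).
Local Notation Ok := (Ok D).
Local Notation O := (O D).
Local Notation pi := (qpi D).
Local Notation ep := (qep D).

Let hR := Ok_ring D.
Let hpi : Ok pi := qpi_Ok D.
Let hep : Ok ep := qep_Ok D.
Let hep' : Ok ep^-1 := qepV_Ok D.
Let ht : Ok t := Ok_t D.

Definition absNk (x : algC) : nat := `|Num.floor (x * ta x)|%N.

Lemma absNkE x : Ok x -> (absNk x)%:R = `|x * ta x|.
Proof. by move=> hx; rewrite /absNk natr_absz intr_norm floorK //; apply: Ok_norm hx. Qed.

Lemma absNk_lt q x : Ok q -> q != 0 -> 1 < `|q * ta q| -> Ok x -> x != 0 -> Ok (x / q) ->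
  (absNk (x / q) < absNk x)%N.
Proof.
move=> hq q0 hn hx x0 hxq; rewrite -(ltr_nat algC) !absNkE //.
have -> : x * ta x = (x / q * ta (x / q)) * (q * ta q).
  by rewrite fmorph_div; field; rewrite fmorph_eq0 q0.
rewrite [X in _ < X]normrM ltr_pMr // normr_gt0.
by rewrite !mulf_neq0 ?fmorph_eq0 ?invr_eq0 // mulf_neq0 ?invr_eq0.
Qed.

Lemma pi_norm : exists n : int, pi * ta pi = n%:~R /\ `|n|%N = 2%N.
Proof.
have /ZZP[n en] := Ok_norm hpi; exists n; split=> //.
have ep1 : ep * ta ep = 1 by apply: Ok_unit_norm => //; exact: ep0.
have : n * n = 4.
  apply: int_eq; rewrite intrM -en.
  transitivity (pi ^+ 2 * ta (pi ^+ 2)); first by rewrite rmorphXn /=; ring.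
  rewrite -qpi2 rmorphM rmorph_nat; transitivity (4 * (ep * ta ep)); first by ring.
  by rewrite ep1 mulr1.
move/(congr1 absz); rewrite abszM /=; case: `|n|%N => [|[|[|k]]] //; lia.
Qed.

Lemma pi_norm_gt1 : 1 < `|pi * ta pi|.
Proof. by have [n [-> en]] := pi_norm; rewrite -intr_norm ltr1z; lia. Qed.

Lemma t_norm : t * ta t = - p%:R. Proof. by rewrite ta_t mulrN -expr2 tt. Qed.

Lemma t_norm_gt1 : 1 < `|t * ta t|.
Proof. by rewrite t_norm normrN normr_nat ltr1n prime_gt1 ?q_prime. Qed.

Lemma Ok_div_conj q x : Ok q -> q != 0 -> Ok (ta q / q) -> Ok x -> Ok (ta x / q) -> Ok (x / q).
Proof.
move=> hq q0 hqq hx /(Ok_conj); rewrite fmorph_div (Ok_conjK hx) => h.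
have -> : x / q = (x / ta q) * (ta q / q) by field; rewrite fmorph_eq0 q0.
exact: sringM.
Qed.

Lemma pi_assoc : Ok (ta pi / pi).
Proof.
have [n [en an]] := pi_norm.
have -> : ta pi / pi = n%:~R / 2 * ep^-1.
  by rewrite -en -[_ * ep^-1]mulrA -invfM qpi2; field; rewrite pi0.
have [->|->] : n = 2 \/ n = -2 by lia.
  by rewrite divff ?pnatr_eq0 // mul1r.
by rewrite -[(-2)%:~R]/(- 2 : algC) mulNr divff ?pnatr_eq0 // mulN1r; apply: sringN.
Qed.

Lemma t_assoc : Ok (ta t / t).
Proof. by rewrite ta_t mulNr divff ?t0 //; apply: sringN => //; apply: sring1. Qed.

(** Some divisor g' of 4 p makes r g' a square g^2. As 2 and p ramify in [Ok], g' is a unit times a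
    square s^2 there, so s B has the same square as (g) and equals it. *)
Lemma square_int_principal B (r : int) : ideal Ok B -> r != 0 -> mulI B B = scaleI r%:~R Ok ->
  exists2 d, Ok d & d != 0 /\ B = scaleI d Ok.
Proof.
move=> hB r0 hBB; have [g [g' [g0 eg hg']]] := square_descent_ZZ hB r0 hBB.
have r0' : (r%:~R : algC) != 0 by rewrite intr_eq0.
have g0' : (g%:~R : algC) != 0 by rewrite intr_eq0.
have [e [j [he hj ej]]] := dvd4p_cases hg'.
have [v [s [hv hv' hs s0 es]]] : exists v s, [/\ Ok v, Ok v^-1, Ok s, s != 0 & g'%:~R = v * s ^+ 2].
  have [b eb] : exists b : bool, g'%:~R = (-1) ^+ b * (e * p ^ j)%N%:R :> algC.
    exists (g' < 0); rewrite -ej natr_absz -intr_sign -intrM; congr (_%:~R).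
    by rewrite -{1}[g']mulr_sign_norm.
  have [w [s [hw hw' hs s0 es]]] : exists w s, [/\ Ok w, Ok w^-1, Ok s, s != 0 & e%:R = w * s ^+ 2].
    case: he => ->.
    - exists 1, 1; rewrite invr1 oner_eq0; split=> //; try exact: sring1.
      by rewrite expr1n mulr1.
    - exists ep^-1, pi; rewrite invrK; split=> //; first exact: pi0.
      by rewrite -qpi2 mulrCA mulVf ?ep0 ?mulr1.
    exists 1, 2; rewrite invr1 pnatr_eq0; split=> //; try exact: sring1; try exact: sring_nat.
    by rewrite mul1r -natrX.
  exists ((-1) ^+ b * w), (s * t ^+ j); split.
  - by ring_mem hR.
  - by rewrite invfM -exprVn invrN1; ring_mem hR.
  - by ring_mem hR.
  - by rewrite mulf_neq0 // expf_neq0 // t0.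
  rewrite eb natrM es natrX -tt -exprM mulnC exprM; ring.
have egC : r%:~R * g'%:~R = g%:~R ^+ 2 :> algC by rewrite -intrM eg rmorphXn.
have v0 : v != 0.
  apply: contraNneq g0' => v0; move: egC.
  by rewrite es v0 mul0r mulr0 => /esym/eqP; rewrite sqrf_eq0.
have hsB : mulI (scaleI s B) (scaleI s B) = scaleI (g%:~R ^+ 2) Ok.
  rewrite mulI_scl mulI_scr hBB -!scM.
  have -> : g%:~R ^+ 2 = (s * (s * r%:~R)) * v.
    by rewrite -egC es; ring.
  by rewrite [RHS]scM (sc_unit (rmod_self hR) hv hv' v0) mulrA.
have eB : scaleI s B = scaleI g%:~R Ok.
  apply: (sq_principal hR (@sqcl_Ok D) g0' (rmod_sc _ (ideal_rmod hB)) _ hsB) => _ [y [hy ->]].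
  by apply: (fr_div hR); [apply: (sringM hR) => //; apply: ideal_sub hy|exact: sring_int].
have eB' : B = scaleI (g%:~R / s) Ok by apply: (sc_inj s0); rewrite eB -scM mulrC divfK.
exists (g%:~R / s); last by split=> //; rewrite mulf_neq0 ?invr_eq0.
by apply: (ideal_sub hB); rewrite eB'; apply: sc_self.
Qed.

(* This plays the role of the oddness of the class number of Q(sqrt p). *)
Lemma square_principal J e : ideal Ok J -> Ok e -> e != 0 -> mulI J J = scaleI e Ok ->
  exists2 d, Ok d & d != 0 /\ J = scaleI d Ok.
Proof.
move=> hJ he e0 hJJ.
(* The ramified primes pi and t are divided out, which makes the norm of e prime to 2 p. *)
have [m [J1 [e1 [hJ1 eJ1 [he1 hpi1] ee1 hJJ1]]]] := square_normalise hR (pi0 D)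
  (@Ok_pi_prime D) (fun x => @absNk_lt pi x hpi (pi0 D) pi_norm_gt1) hJ he e0 hJJ.
have e10 : e1 != 0 by apply: contraNneq e0 => h; rewrite ee1 h mulr0.
have [n [J2 [e2 [hJ2 eJ2 [he2 ht2] ee2 hJJ2]]]] := square_normalise hR (t0 D)
  (@Ok_t_prime D) (fun x => @absNk_lt t x ht (t0 D) t_norm_gt1) hJ1 he1 e10 hJJ1.
have e20 : e2 != 0 by apply: contraNneq e10 => h; rewrite ee2 h mulr0.
have hpi2 : ~ Ok (e2 / pi).
  by move=> h; apply: hpi1; rewrite ee2 -mulrA; ring_mem hR.
suff [d hd [d0 ed]] : exists2 d, Ok d & d != 0 /\ J2 = scaleI d Ok.
  exists (pi ^+ m * t ^+ n * d); first by ring_mem hR.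
  split; first by apply: mulf_neq0 => //; apply: mulf_neq0; apply: expf_neq0; [apply: pi0|apply: t0].
  by rewrite eJ1 eJ2 ed -!scM ?mulrA.
move: J2 e2 hJ2 he2 hJJ2 e20 hpi2 ht2 {J e hJ he e0 hJJ J1 e1 hJ1 eJ1 he1 hpi1 ee1 hJJ1 e10 eJ2 ee2 m n}.
move=> J e hJ he hJJ e0 hpie hte.
have /ZZP[k ek] := Ok_norm he.
have hta := @Ok_conj D; have htaK := @Ok_conjK D.
have k0 : k != 0 by rewrite -(intr_eq0 algC) -ek mulf_neq0 ?fmorph_eq0.
(* J times its conjugate has square (k), k being the norm of e. Since k is odd and prime to p, the
   descent to Z leaves only k = d^2 or k = - d^2. *)
have hBB : mulI (mulI J (conjI ta J)) (mulI J (conjI ta J)) = scaleI k%:~R Ok.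
  rewrite mulIACA hJJ mulI_cj hJJ cj_sc (cj_ring hta htaK).
  by rewrite mulI_scl mulI_scr -scM (mulI_RR hR) ek.
have [g [g' [g0 eg hg']]] := square_descent_ZZ (ideal_mulI hR hJ (ideal_cj hta htaK hJ)) k0 hBB.
have kodd : exists i, k = 2 * i + 1.
  have [i [hi|hi]] := int_parity k; last by exists i.
  have : Ok (e * ta e / pi).
    have -> : e * ta e / pi = (k%:~R + 0%:~R * t) / pi by rewrite mul0r addr0 ek.
    by apply/Ok_div_pi; exists i; lia.
  case/(Ok_pi_prime he (Ok_conj he)) => // /(Ok_div_conj hpi (pi0 D) pi_assoc he) //.
have kp : ~ (p%:Z %| k)%Z.
  move=> hk; have : Ok (e * ta e / t).
    have -> : e * ta e / t = (k%:~R + 0%:~R * t) / t by rewrite mul0r addr0 ek.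
    exact/Ok_div_t.
  by case/(Ok_t_prime he (Ok_conj he)) => // /(Ok_div_conj ht (t0 D) t_assoc he).
have [i ki] := kodd.
have [e' [j [he' hj ej]]] := dvd4p_cases hg'.
have p3 : (3 < p)%N by have [q ->] := q_decomp D; lia.
have j0 : j = 0%N.
  case: j hj ej => [|[|//]] // _; rewrite expn1 => ej; exfalso.
  have hpg : (p%:Z %| g)%Z.
    have : (p%:Z %| g * g)%Z by rewrite -expr2 -eg dvdz_mull // dvdzE ej dvdn_mull.
    by case/Euclid_int.
  have : (p * p %| `|k| * (e' * p))%N.
    by rewrite -ej -abszM eg expr2 abszM dvdn_mul.
  rewrite mulnA dvdn_pmul2r ?prime_gt0 ?q_prime // Euclid_dvdM ?q_prime //.
  case/orP=> [h|/dvdn_leq h]; first by apply: kp.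
  have e'4 : e' = 4%N.
    by case: he' h => -> h //; have := h isT; lia.
  have := h; rewrite e'4 => /(_ isT) hp4.
  have := q_prime D; rewrite (_ : p = 4%N) //; lia.
rewrite j0 expn0 muln1 in ej.
have [d ed] : exists d : int, `|k|%N = (`|d| * `|d|)%N.
  have eabs : (`|k| * e' = `|g| * `|g|)%N by rewrite -ej -abszM eg expr2 abszM.
  case: he' eabs => ->.
  - by rewrite muln1 => h; exists g.
  - move=> h; exfalso; have [i' [hi'|hi']] := int_parity g; last by lia.
    have : (`|k| = 2 * (`|i'| * `|i'|))%N by lia.
    lia.
  move=> h; have [i' [hi'|hi']] := int_parity g; last by lia.
  by exists i'; lia.
have kd : k = d ^+ 2.
  have [//|kd] : k = d ^+ 2 \/ k = - d ^+ 2 by rewrite expr2; lia.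
  exfalso; have [a [b eab]] := OkE he; have [q eq] := q_decomp D.
  have eN : a * a - p%:Z * (b * b) = k.
    apply: int_eq; rewrite -ek eab (rmorphD ta) (rmorphM ta) !(rmorph_int ta) ta_t.
    by rewrite !(intrM, rmorphB) /= !intrM -[p%:Z%:~R]/(p%:R : algC) -tt; ring.
  apply: (@neg_square_not_norm q a b d i); rewrite -expr2 -kd // -eN eq.
  by rewrite PoszD PoszM.
have hr : e * ta e = d%:~R ^+ 2 by rewrite ek kd rmorphXn.
have [|ee|[f [r [hf /ZZP[m ->] f0 r0 efr]]]] :=
  hilbert90 ZZ_ring (ZZ_tt D) (ta_t D) (ta_ZZ D) he (d := d%:~R) _ hr.
- by apply/ZZP; eexists.
- apply: (@square_int_principal J (- d)) => //; last by rewrite rmorphN /= -ee.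
  by rewrite -(intr_eq0 algC) rmorphN /= -ee.
have m0 : m != 0 by rewrite -(intr_eq0 algC).
(* As f^2 = e m, multiplying J by m / f replaces the generator e of the square by the rational
   integer m. *)
have hBB' : mulI (scaleI (m%:~R / f) J) (scaleI (m%:~R / f) J) = scaleI m%:~R Ok.
  rewrite mulI_scl mulI_scr hJJ -!scM; congr (scaleI _ _).
  transitivity (m%:~R ^+ 2 * e / f ^+ 2); first by field.
  by rewrite efr; field; rewrite e0 r0.
have mf0 : m%:~R / f != 0 by rewrite mulf_neq0 ?invr_eq0.
have hfr x : J x -> frac_of Ok (m%:~R / f * x).
  move=> hx; apply: (frM hR); first by apply: (fr_div hR) => //; exact: sring_int.
  by apply: (fr_R hR); apply: ideal_sub hx.
have hB : ideal Ok (scaleI (m%:~R / f) J).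
  split; first by apply: rmod_sc; apply: ideal_rmod.
    move=> _ [x [hx ->]]; apply: sqcl_Ok; first exact: hfr.
    have : mulI (scaleI (m%:~R / f) J) (scaleI (m%:~R / f) J) ((m%:~R / f * x) * (m%:~R / f * x)).
      by apply: mem_mulI; apply: sc_mem.
    rewrite hBB' -expr2 => -[y [hy ->]]; apply: sringM => //; exact: sring_int.
  by case: hJ => _ _; apply: nonz_sc.
have [d' hd' [d'0 eB]] := square_int_principal hB m0 hBB'.
have eJ : J = scaleI (d' * f / m%:~R) Ok.
  apply: (sc_inj mf0); rewrite eB -scM; congr (scaleI _ _); field; by rewrite f0 r0.
exists (d' * f / m%:~R); first by apply: (ideal_sub hJ); rewrite eJ; apply: sc_self.
by split=> //; rewrite !mulf_neq0 ?invr_eq0.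
Qed.

(* Only the primes [pi] and sqrt p of [Ok] ramify in [O], hence the exponents. *)
Lemma square_generator B c : ideal O B -> Ok c -> c != 0 -> mulI B B = scaleI c O ->
  exists u d i j, [/\ Ok u, Ok u^-1, Ok d, d != 0 & c * u * pi ^+ i * t ^+ j = d ^+ 2].
Proof.
move=> hB hc c0 hBB.
have [h1 h2] := square_descent hR (al0 D) ht (sg_al D) (@sg_Ok D) (@sqcl_O D) hB hc c0 hBB.
have hJ := ideal_res hR ht (sg_al D) (@sg_Ok D) hB.
set J := restrI Ok B in h1 h2 hJ; rewrite -/t in h2.
have hD : ideal Ok (scaleI c^-1 (mulI J J)).
  split; first by apply: rmod_sc; apply: rmod_mulI; apply: ideal_rmod.
    by move=> _ [x [hx ->]]; rewrite mulrC; apply: h1.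
  by apply: nonz_sc; [rewrite invr_eq0|case: (ideal_mulI hR hJ hJ)].
(* With s = al, 4 s^2 is 4 t, and 4 = pi^4 / ep^2. Thus the ideal J^2 / c contains a product of
   powers of pi and t, and [overideal] shows that it is itself generated by such a product. *)
have hD4 : scaleI c^-1 (mulI J J) (pi ^+ 4 * (ep^-1 ^+ 2 * t)).
  apply/scE; rewrite ?invr_eq0 // invrK.
  rewrite (_ : _ * c = 4 * t * c) //; congr (_ * c).
  have -> : pi ^+ 4 = (2 * ep) ^+ 2 by rewrite qpi2 -exprM.
  by field; rewrite ep0.
have [|i [D1 [e1 hD1 hD1t]]] := overideal hR hpi (pi0 D) _ (@Ok_pi_max D) hD hD4.
  by ring_mem hR.
have hD1t' : D1 (t ^+ 1 * 1).
  rewrite mulr1 expr1 (_ : t = ep ^+ 2 * (ep^-1 ^+ 2 * t)).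
    by apply: (ideal_mul hD1) => //; ring_mem hR.
  by field; rewrite ep0.
have [|j [D2 [e2 hD2 hD2t]]] := overideal hR ht (t0 D) _ (@Ok_t_max D) hD1 hD1t'.
  exact: sring1.
have eD2 : D2 = Ok by apply: rmod1 hD2t; [apply: ideal_rmod|move=> x; apply: ideal_sub].
have pt0 : pi ^+ i * t ^+ j != 0.
  by apply: mulf_neq0; apply: expf_neq0; [apply: pi0|apply: t0].
have eJJ : mulI J J = scaleI (c * (pi ^+ i * t ^+ j)) Ok.
  have ci0 : c^-1 != 0 by rewrite invr_eq0.
  by apply: (sc_inj ci0); rewrite e1 e2 eD2 -!scM mulKf.
have cpt0 : c * (pi ^+ i * t ^+ j) != 0 by rewrite mulf_neq0.
have [|d hd [d0 eJ]] := square_principal hJ _ cpt0 eJJ; first by ring_mem hR.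
have eq2 : scaleI (d ^+ 2) Ok = scaleI (c * (pi ^+ i * t ^+ j)) Ok.
  by rewrite -eJJ eJ mulI_scl mulI_scr -scM (mulI_RR hR).
have d20 : d ^+ 2 != 0 by rewrite expf_neq0.
have [hu hu'] := sc_mem_unit hR d20 eq2.
exists (d ^+ 2 / (c * (pi ^+ i * t ^+ j))), d, i, j; split=> //.
  by rewrite invf_div.
have := divfK cpt0 (d ^+ 2); move: (_ / _) => v <-; ring.
Qed.
End SquareIdeals.

(** * The genus character *)

(* The quadratic character (2/.), extended to even integers by [-1] at [2];
   [psi n = true] means the value is [-1]. *)
Definition psi (n : nat) : bool :=
  odd (logn 2 n) (+) ((n`_2^' %% 8 == 3) || (n`_2^' %% 8 == 5))%N.

Lemma odd_mod8_mul m n : odd m -> odd n ->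
  ((m * n %% 8 == 3) || (m * n %% 8 == 5))%N =
  ((m %% 8 == 3) || (m %% 8 == 5))%N (+) ((n %% 8 == 3) || (n %% 8 == 5))%N.
Proof.
move=> om on; rewrite -modnMm.
have : odd (m %% 8) by rewrite odd_mod.
have : odd (n %% 8) by rewrite odd_mod.
have : (m %% 8 < 8)%N by rewrite ltn_mod.
have : (n %% 8 < 8)%N by rewrite ltn_mod.
by case: (m %% 8)%N => [|[|[|[|[|[|[|[|?]]]]]]]] //; case: (n %% 8)%N => [|[|[|[|[|[|[|[|?]]]]]]]].
Qed.

Lemma psiM m n : (0 < m)%N -> (0 < n)%N -> psi (m * n) = psi m (+) psi n.
Proof.
move=> m0 n0; rewrite /psi lognM // partnM // oddD odd_mod8_mul.
- by rewrite addbACA.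
- by rewrite odd_2'nat part_pnat.
by rewrite odd_2'nat part_pnat.
Qed.

Lemma psi_odd n : odd n -> psi n = ((n %% 8 == 3) || (n %% 8 == 5))%N.
Proof.
move=> on; have n2 : (2^'.-nat n)%N by rewrite -odd_2'nat.
rewrite /psi part_pnat_id // lognE /= dvdn2 on andbF //.
Qed.

Lemma psi2 : psi 2 = true. Proof. by rewrite /psi (pfactorK 1 (isT : prime 2)) part_p'nat. Qed.

Lemma psi_sq n : (0 < n)%N -> psi (n * n) = false.
Proof. by move=> n0; rewrite psiM // addbb. Qed.

Lemma sqr_parity (u : int) : exists w, u * u = u + 2 * w.
Proof.
have [j [->|->]] := int_parity u; first by exists (2 * (j * j) - j); lia.
by exists (2 * (j * j) + j); lia.
Qed.

(** A + B t is a relative norm, with A = x0 + x2 and B = x1 + x3 modulo 2. If exactly one of A, B is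
    odd, the other is divisible by 4, so A^2 - p B^2 is 1 or - p modulo 8, and both are 1. *)
Lemma quartic_norm_mod8 (q x0 x1 x2 x3 A B : int) :
  A = x0 * x0 + (q * 16 + 7) * (x2 * x2) - 2 * (q * 16 + 7) * (x1 * x3) ->
  B = 2 * (x0 * x2) - x1 * x1 - (q * 16 + 7) * (x3 * x3) ->
  (exists k, A * A - (q * 16 + 7) * (B * B) = 8 * k + 1) \/
  (exists k, A * A - (q * 16 + 7) * (B * B) = 2 * k) /\ exists k, x0 + x1 + x2 + x3 = 2 * k.
Proof.
have [w0 h0] := sqr_parity x0; have [w1 h1] := sqr_parity x1.
have [s hs] := int_parity (x0 + x2); have [r hr] := int_parity (x1 + x3).
case: hs => hs; case: hr => hr eA eB.
- right; split; last by exists (s + r); lia.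
  have e2 : x2 = 2 * s - x0 by lia.
  have e3 : x3 = 2 * r - x1 by lia.
  rewrite e2 e3 in eA eB; have [a [ea|ea]] := int_parity A; last by exfalso; lia.
  have [b [eb|eb]] := int_parity B; last by exfalso; lia.
  by exists (2 * (a * a) - 2 * (q * 16 + 7) * (b * b)); rewrite ea eb; lia.
- left; have e2 : x2 = 2 * s - x0 by lia.
  have e3 : x3 = 2 * r + 1 - x1 by lia.
  rewrite e2 e3 in eA eB; have [a' [ea|ea]] := int_parity A; last by exfalso; lia.
  have [a [ea'|ea']] := int_parity a'; last by exfalso; lia.
  have [b [eb|eb]] := int_parity B; first by exfalso; lia.
  have [w hw] := sqr_parity b.
  by exists (2 * (a * a) - (q * 16 + 7) * (b + w) - 2 * q - 1); rewrite ea ea' eb; lia.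
- left; have e2 : x2 = 2 * s + 1 - x0 by lia.
  have e3 : x3 = 2 * r - x1 by lia.
  rewrite e2 e3 in eA eB; have [b' [eb|eb]] := int_parity B; last by exfalso; lia.
  have [b [eb'|eb']] := int_parity b'; last by exfalso; lia.
  have [a [ea|ea]] := int_parity A; first by exfalso; lia.
  have [w hw] := sqr_parity a.
  by exists (a + w - 2 * (q * 16 + 7) * (b * b)); rewrite ea eb eb'; lia.
right; split; last by exists (s + r + 1); lia.
have e2 : x2 = 2 * s + 1 - x0 by lia.
have e3 : x3 = 2 * r + 1 - x1 by lia.
rewrite e2 e3 in eA eB; have [a [ea|ea]] := int_parity A; first by exfalso; lia.
have [b [eb|eb]] := int_parity B; first by exfalso; lia.
exists (2 * (a * a + a) - (q * 16 + 7) * 2 * (b * b + b) - (q * 8 + 3)); rewrite ea eb; lia.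
Qed.

(** * Absolute norms from O *)

Section Norms.
Variable D : pquartic.
Local Notation p := (qp D).
Local Notation al := (qa D).
Local Notation sg := (qs D).
Local Notation ta := (qt D).
Local Notation t := (sqrt_p D).
Local Notation Ok := (Ok D).
Local Notation O := (O D).
Local Notation pi := (qpi D).

Let hR := Ok_ring D.
Let hO := O_ring D.
Let hpi : Ok pi := qpi_Ok D.
Let ht : Ok t := Ok_t D.

Lemma O_norm x : O x -> Ok (x * sg x).
Proof. exact: (qext_norm hR ht (sg_al D) (@sg_Ok D)). Qed.
Lemma O_trace x : O x -> Ok (x + sg x).
Proof. exact: (qext_trace hR (sg_al D) (@sg_Ok D)). Qed.
Lemma O_conj x : O x -> O (sg x).
Proof. exact: (qext_conj hR (sg_al D) (@sg_Ok D)). Qed.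
Lemma O_conjK x : O x -> sg (sg x) = x.
Proof. exact: (qext_conjK (sg_al D) (@sg_Ok D)). Qed.
Definition nK (x : algC) : algC := (x * sg x) * ta (x * sg x).

Lemma nK_ZZ x : O x -> ZZ (nK x).
Proof. by move=> hx; apply: Ok_norm; apply: O_norm. Qed.

Lemma nKM x y : nK (x * y) = nK x * nK y.
Proof. by rewrite /nK !rmorphM; ring. Qed.

Lemma nK_eq0 x : (nK x == 0) = (x == 0).
Proof. by rewrite /nK !mulf_eq0 !fmorph_eq0 mulf_eq0 fmorph_eq0 !orbb. Qed.

Lemma nK_Ok x : Ok x -> nK x = (x * ta x) ^+ 2.
Proof. by move=> hx; rewrite /nK (sg_Ok hx) rmorphM; ring. Qed.

Definition absNK (x : algC) : nat := `|Num.floor (nK x)|%N.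

Lemma absNKE x : O x -> (absNK x)%:R = `|nK x|.
Proof. by move=> hx; rewrite /absNK natr_absz intr_norm floorK //; apply: nK_ZZ. Qed.

Lemma absNK_eq x (n : nat) : O x -> `|nK x| = n%:R -> absNK x = n.
Proof. by move=> hx e; apply/eqP; rewrite -(eqr_nat algC) absNKE // e. Qed.

Lemma absNKM x y : O x -> O y -> absNK (x * y) = (absNK x * absNK y)%N.
Proof.
move=> hx hy; apply: absNK_eq; first exact: sringM.
by rewrite nKM normrM natrM !absNKE.
Qed.

Lemma absNK_gt0 x : O x -> x != 0 -> (0 < absNK x)%N.
Proof. by move=> hx x0; rewrite -(ltr0n algC) absNKE // normr_gt0 nK_eq0. Qed.

Lemma OE x : O x -> exists x0 x1 x2 x3 : int,
  x = (x0%:~R + x2%:~R * t) + (x1%:~R + x3%:~R * t) * al.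
Proof.
by case=> a [b [/OkE[x0 [x2 ->]] /OkE[x1 [x3 ->]] ->]]; exists x0, x1, x2, x3.
Qed.

Lemma nK_coord (x0 x1 x2 x3 : int) :
  let A := x0 * x0 + p%:Z * (x2 * x2) - 2 * p%:Z * (x1 * x3) in
  let B := 2 * (x0 * x2) - x1 * x1 - p%:Z * (x3 * x3) in
  nK ((x0%:~R + x2%:~R * t) + (x1%:~R + x3%:~R * t) * al) = (A * A - p%:Z * (B * B))%:~R.
Proof.
move=> A B; rewrite /nK.
have -> : ((x0%:~R + x2%:~R * t) + (x1%:~R + x3%:~R * t) * al) *
   sg ((x0%:~R + x2%:~R * t) + (x1%:~R + x3%:~R * t) * al) = A%:~R + B%:~R * t.
  rewrite (qext_sg (sg_al D) (@sg_Ok D)); try exact: Okintro.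
  rewrite /A /B !(intrM, rmorphB, rmorphD) /= !intrM -[p%:Z%:~R]/(p%:R : algC) -tt /sqrt_p.
  ring.
rewrite (rmorphD ta) (rmorphM ta) !(rmorph_int ta) ta_t.
rewrite [RHS]rmorphB /= !intrM -[p%:Z%:~R]/(p%:R : algC) -tt; ring.
Qed.

(* The prime ideal of [O] above 2. *)
Definition PP : pset := fun x => exists a b, [/\ Ok a, Ok b, Ok ((a + b) / pi) & x = a + b * al].

Lemma PP_ideal : ideal O PP.
Proof.
split; first split.
- split; first by exists 0, 0; rewrite addr0 !mul0r addr0; split=> //; exact: sring0.
  move=> _ _ [a [b [ha hb hab ->]]] [c [d [hc hd hcd ->]]].
  exists (a - c), (b - d); split; [by ring_mem hR|by ring_mem hR| |by ring].
  have -> : (a - c + (b - d)) / pi = (a + b) / pi - (c + d) / pi by ring.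
  by ring_mem hR.
- move=> _ _ [a [b [ha hb ->]]] [c [d [hc hd hcd ->]]].
  exists (a * c + b * d * t), (a * d + b * c); split; [by ring_mem hR|by ring_mem hR| |by rewrite /sqrt_p; ring].
  have -> : (a * c + b * d * t + (a * d + b * c)) / pi =
    (a + b) * ((c + d) / pi) + b * d * ((t - 1) / pi) by ring.
  have h : Ok ((t - 1) / pi).
    have -> : t - 1 = (-1)%:~R + 1%:~R * t by rewrite rmorphN /= mul1r addrC.
    by apply/Ok_div_pi; exists 0.
  by ring_mem hR.
- by move=> _ [a [b [ha hb _ ->]]]; exists a, b.
exists pi; split; last exact: pi0.
exists pi, 0; rewrite mul0r !addr0 divff ?pi0 //; split=> //; [exact: sring0|exact: sring1].
Qed.

Lemma Ok_2_pi : Ok (2 / pi).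
Proof.
have -> : 2 / pi = (2%:~R + 0%:~R * t) / pi by rewrite mul0r addr0.
by apply/Ok_div_pi; exists 1.
Qed.

Lemma Ok_1t_pi : Ok ((1 + t) / pi).
Proof.
have -> : (1 + t) / pi = (1%:~R + 1%:~R * t) / pi by rewrite mul1r.
by apply/Ok_div_pi; exists 1.
Qed.

Lemma PP_mul x y : PP x -> PP y -> O (x * y / pi).
Proof.
move=> [a [b [ha hb hab ->]]] [c [d [hc hd hcd ->]]].
exists ((a * c + b * d * t) / pi), ((a * d + b * c) / pi); split.
- have -> : (a * c + b * d * t) / pi =
    ((a + b) / pi) * d * t - a * t * ((c + d) / pi) + a * c * ((1 + t) / pi) by ring.
  by have h := Ok_1t_pi; ring_mem hR.
- have -> : (a * d + b * c) / pi =
    ((a + b) / pi) * c + a * ((c + d) / pi) - a * c * (2 / pi) by ring.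
  by have h := Ok_2_pi; ring_mem hR.
by rewrite /sqrt_p; ring.
Qed.

Lemma PP_1al : PP (1 + al).
Proof.
exists 1, 1; rewrite mul1r; split=> //; try exact: sring1.
exact: Ok_2_pi.
Qed.

Lemma PP_even (x0 x1 x2 x3 : int) : (exists k, x0 + x1 + x2 + x3 = 2 * k) ->
  PP ((x0%:~R + x2%:~R * t) + (x1%:~R + x3%:~R * t) * al).
Proof.
case=> k ek; exists (x0%:~R + x2%:~R * t), (x1%:~R + x3%:~R * t); split=> //; try exact: Okintro.
have -> : x0%:~R + x2%:~R * t + (x1%:~R + x3%:~R * t) = (x0 + x1)%:~R + (x2 + x3)%:~R * t.
  by rewrite !rmorphD /=; ring.
by apply/Ok_div_pi; exists k; lia.
Qed.

Lemma nK_pi : nK pi = 4.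
Proof.
rewrite nK_Ok //; have [n [-> en]] := pi_norm D; rewrite -rmorphXn /=.
by have [->|->] : n = 2 \/ n = -2 by lia.
Qed.

(** The absolute norm is multiplied by 2 (8 q + 3) / 4. One factor 2 disappears and the character
    keeps its value, being - 1 at both 2 and 8 q + 3. For p = 15 mod 16 the factor 8 q + 3 would
    become 8 q + 7, where the character is + 1. *)
Lemma absNK_step x : PP x -> x != 0 -> let y := x * (1 + al) / pi in
  [/\ O y, y != 0, logn 2 (absNK x) = (logn 2 (absNK y)).+1 & psi (absNK x) = psi (absNK y)].
Proof.
have [q eq] := q_decomp D; move=> hP x0 y.
have hx := ideal_sub PP_ideal hP.
have hy : O y := PP_mul hP PP_1al.
have ey : x * (1 + al) = y * pi by rewrite /y divfK ?pi0.
have h1 : O (1 + al) by apply: (ideal_sub PP_ideal); apply: PP_1al.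
have n1 : absNK (1 + al) = (2 * (8 * q + 3))%N.
  apply: absNK_eq => //.
  have -> : nK (1 + al) = - (p%:R - 1).
    rewrite /nK (rmorphD sg) rmorph1 sg_al.
    have -> : (1 + al) * (1 - al) = 1 - t by rewrite /sqrt_p; ring.
    by rewrite rmorphB rmorph1 ta_t -tt; ring.
  have -> : p%:R - 1 = (2 * (8 * q + 3))%N%:R :> algC by rewrite eq !(natrM, natrD); ring.
  by rewrite normrN normr_nat.
have npi : absNK pi = 4%N by apply: absNK_eq; [apply: Ok_O|rewrite nK_pi normr_nat].
have y0 : y != 0.
  rewrite /y !mulf_neq0 ?invr_eq0 ?pi0 //.
  by rewrite -nK_eq0 -normr_eq0 -absNKE // n1 pnatr_eq0; lia.
have hpiO : O pi by apply: Ok_O.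
have e : (absNK x * (2 * (8 * q + 3)) = absNK y * 4)%N by rewrite -n1 -npi -!absNKM // ey.
have nx := absNK_gt0 hx x0; have ny := absNK_gt0 hy y0.
split=> //.
  have := congr1 (logn 2) e; rewrite !lognM //; try lia.
  rewrite (pfactorK 1 (isT : prime 2)) (pfactorK 2 (isT : prime 2)).
  have -> : logn 2 (8 * q + 3) = 0%N by rewrite lognE dvdn2 oddD oddM /= andbF.
  lia.
have := congr1 psi e; rewrite !psiM //; try lia.
rewrite psi2 (@psi_odd (8 * q + 3)); last by rewrite oddD oddM.
rewrite (_ : psi 4 = false); last by rewrite -(psi_sq (isT : 0 < 2)%N).
rewrite (_ : ((8 * q + 3) %% 8 == 3)%N); last by lia.
by rewrite !addbF.
Qed.

(* Norms from [O] are totally split for the extended character: this is where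
   [p = 7 mod 16] enters, through the norm [1 - p] of [1 + al]. *)
Lemma psi_norm x : O x -> x != 0 -> psi (absNK x) = false.
Proof.
have [q eq] := q_decomp D.
elim: (logn 2 (absNK x)).+1 {-2}x (ltnSn (logn 2 (absNK x))) => // n IH {}x hn hx x0.
have [x0' [x1 [x2 [x3 ex]]]] := OE hx.
have /= eN := nK_coord x0' x1 x2 x3; rewrite -ex in eN.
set A := x0' * x0' + _ - _ in eN; set B := 2 * (x0' * x2) - _ - _ in eN.
have [||[k ek]|[_ hk]] := @quartic_norm_mod8 q x0' x1 x2 x3 A B; try by rewrite /A /B eq; lia.
  have {}ek : A * A - p%:Z * (B * B) = 8 * k + 1 by rewrite -ek eq; lia.
  have en : absNK x = absz (8 * k + 1).
    by apply: absNK_eq => //; rewrite eN ek natr_absz intr_norm.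
  rewrite en psi_odd; lia.
have hP : PP x by rewrite ex; apply: PP_even.
have [hy y0 hl ->] := absNK_step hP x0; apply: IH => //.
by rewrite hl in hn.
Qed.
End Norms.

(** * The prime of O above 2, and a unit outside k *)

Section PrimeTwo.
Variable D : pquartic.
Local Notation al := (qa D).
Local Notation sg := (qs D).
Local Notation ta := (qt D).
Local Notation t := (sqrt_p D).
Local Notation Ok := (Ok D).
Local Notation O := (O D).
Local Notation PP := (PP D).
Local Notation pi := (qpi D).
Local Notation ep := (qep D).

Let hR := Ok_ring D.
Let hO := O_ring D.
Let hpi : Ok pi := qpi_Ok D.
Let hep : Ok ep := qep_Ok D.
Let ht : Ok t := Ok_t D.

Lemma PPE a b : Ok a -> Ok b -> PP (a + b * al) -> Ok ((a + b) / pi).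
Proof.
move=> ha hb [a' [b' [ha' hb' h e]]].
by have [-> ->] := qext_inj (al0 D) (sg_al D) (@sg_Ok D) ha hb ha' hb' e.
Qed.

Lemma PP_Ok x : Ok x -> PP x -> Ok (x / pi).
Proof.
move=> hx; rewrite -{1}[x]addr0 -{1}(mul0r al) => /(PPE hx (sring0 hR)).
by rewrite addr0.
Qed.

Lemma PP_pi : PP pi.
Proof.
by exists pi, 0; rewrite mul0r !addr0 divff ?pi0 //; split=> //; [exact: sring0|exact: sring1].
Qed.

Lemma PP_prime x y : O x -> O y -> PP (x * y) -> PP x \/ PP y.
Proof.
move=> [a [b [ha hb ->]]] [c [d [hc hd ->]]].
have -> : (a + b * al) * (c + d * al) = (a * c + b * d * t) + (a * d + b * c) * al.
  by rewrite /sqrt_p; ring.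
move/PPE => h.
have [|||h1|h1] := @Ok_pi_prime D (a + b) (c + d); try by ring_mem hR.
- have -> : (a + b) * (c + d) / pi =
    (a * c + b * d * t + (a * d + b * c)) / pi + b * d * (2 / pi) - b * d * ((1 + t) / pi) by ring.
  have h2 := Ok_2_pi D; have h3 := Ok_1t_pi D.
  by apply: (sringB hR); [apply: (sringD hR); [apply: h|]|]; ring_mem hR.
- by left; exists a, b.
by right; exists c, d.
Qed.

Lemma PP_sg : conjI sg PP = PP.
Proof.
have h x : PP x -> PP (sg x).
  move=> [a [b [ha hb hab ->]]]; rewrite (qext_sg (sg_al D) (@sg_Ok D)) //.
  exists a, (- b); split; [by []|by ring_mem hR| |by rewrite mulNr].
  have -> : (a - b) / pi = (a + b) / pi - b * (2 / pi) by ring.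
  by have h2 := Ok_2_pi D; ring_mem hR.
apply: cj_ring => // x hx; apply: O_conjK; exact: (ideal_sub (PP_ideal D)) hx.
Qed.

(** PP^2 contains pi^2 and 1 - t = (1 + al)(1 - al). The latter is pi times an element prime to pi,
    because (1 - t) / 2 is not in [Ok]; so pi is a combination of the two. *)
Lemma PP_sq : mulI PP PP = scaleI pi O.
Proof.
have p0 := pi0 D; apply: pset_eq.
  apply: mulI_sub => [|x y hx hy]; first by apply: agrp_sc; apply: sring_agrp.
  by apply/scE => //; apply: PP_mul.
have hPPi : ideal O (mulI PP PP) by apply: ideal_mulI => //; apply: PP_ideal.
suff h : mulI PP PP pi.
  by move=> _ [x [hx ->]]; apply: (ideal_mulr hPPi).
have h1 : mulI PP PP (1 - t).
  have -> : 1 - t = (1 + al) * (1 - al) by rewrite /sqrt_p; ring.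
  apply: mem_mulI; first exact: PP_1al.
  exists 1, (-1); rewrite subrr mul0r mulN1r; split=> //; [exact: sring1|exact: sringN (sring1 hR)|exact: sring0].
have h2 : mulI PP PP (pi * pi) by apply: mem_mulI; apply: PP_pi.
have hv : Ok ((1 - t) / pi).
  have -> : 1 - t = 1%:~R + (-1)%:~R * t by rewrite rmorphN /= mulN1r.
  by apply/Ok_div_pi; exists 0.
have [h3|[y hy hz]] := Ok_pi_max hv.
  exfalso; have : Ok ((1 - t) / 2).
    have -> : (1 - t) / 2 = (1 - t) / pi / pi * ep.
      have -> : (1 - t) / pi / pi * ep = (1 - t) * ep / pi ^+ 2 by field.
      by rewrite -qpi2; field; rewrite ep0.
    by ring_mem hR.
  case/OkE=> a [b e].
  have : 1%:~R + (-1)%:~R * t = (2 * a)%:~R + (2 * b)%:~R * t.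
    rewrite !intrM rmorphN /=; transitivity (2 * ((1 - t) / 2)); first by field.
    by rewrite e; ring.
  by case/(@Ok_inj D) => e1 _; lia.
have -> : pi = (1 - t) * y + (pi * pi) * ((1 - (1 - t) / pi * y) / pi) by field.
apply: (agrpD (ideal_agrp hPPi)); apply: (ideal_mulr hPPi) => //; exact: Ok_O.
Qed.

Lemma O_lattice : lattice O (fun i : 'I_4 => al ^+ i).
Proof.
have e (x0 x1 x2 x3 : algC) : (x0 + x2 * t) + (x1 + x3 * t) * al =
    x0 * al ^+ 0 + (x1 * al ^+ 1 + (x2 * al ^+ 2 + (x3 * al ^+ 3 + 0))) by rewrite /sqrt_p; ring.
move=> x; split=> [/OE[x0 [x1 [x2 [x3 ->]]]]|[c ->]].
  exists (fun i => nth 0 [:: x0; x1; x2; x3] i).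
  by rewrite !big_ord_recl big_ord0 /= e.
rewrite !big_ord_recl big_ord0 /= -e; do 2!eexists; split; last by reflexivity.
  exact: Okintro.
exact: Okintro.
Qed.

Lemma O_inj (c : 'I_4 -> int) : \sum_i (c i)%:~R * al ^+ i = 0 -> forall i, c i = 0.
Proof.
rewrite !big_ord_recl big_ord0 /=.
set x0 := c _; set x1 := c _; set x2 := c _; set x3 := c _ => e.
have e' : (x0%:~R + x2%:~R * t) + (x1%:~R + x3%:~R * t) * al = 0 + 0 * al.
  by rewrite mul0r addr0 -[RHS]e /sqrt_p /=; ring.
have := qext_inj (al0 D) (sg_al D) (@sg_Ok D) _ _ (sring0 hR) (sring0 hR) e'.
case=> [||]; try exact: Okintro.
have Ok_eq0 (a b : int) : a%:~R + b%:~R * t = 0 -> a = 0 /\ b = 0.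
  by move=> h; apply: (@Ok_inj D); rewrite h mul0r addr0.
move=> /Ok_eq0 [h0 h2] /Ok_eq0 [h1 h3].
case=> -[|[|[|[|//]]]] hi.
- by rewrite -h0 /x0; congr c; apply: val_inj.
- by rewrite -h1 /x1; congr c; apply: val_inj.
- by rewrite -h2 /x2; congr c; apply: val_inj.
by rewrite -h3 /x3; congr c; apply: val_inj.
Qed.

Lemma norm_ta_al : `|ta al| = al.
Proof.
apply/eqP; rewrite -(@eqrXn2 _ 2) ?normr_ge0 ?(ltW (qa_gt0 D)) //; apply/eqP.
by rewrite -normrX -rmorphXn /= -/t ta_t normrN (gtr0_norm (t_gt0 D)).
Qed.

(* [e] ranges over the four embeddings of the field. *)
Lemma emb_bound (e : {rmorphism algC -> algC}) (c : 'I_4 -> int) (N : algC) : `|e al| = al ->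
  (forall i, `|(c i)%:~R| <= N) ->
  `|e (\sum_i (c i)%:~R * al ^+ i)| <= N * \sum_(i < 4) al ^+ i.
Proof.
move=> he hc; rewrite rmorph_sum mulr_sumr; apply: le_trans (ler_norm_sum _ _ _) _.
apply: ler_sum => i _; rewrite rmorphM rmorph_int rmorphXn normrM normrX /= he.
by rewrite ler_wpM2r // exprn_ge0 // ltW // qa_gt0.
Qed.

Lemma nK_norm x : `|nK D x| = `|x| * `|sg x| * (`|ta x| * `|ta (sg x)|).
Proof. by rewrite /nK rmorphM !normrM. Qed.

Lemma nK_ge1 x : O x -> x != 0 -> 1 <= `|nK D x|.
Proof. by move=> hx x0; apply: int_norm_ge1; [apply: nK_ZZ|rewrite nK_eq0]. Qed.

(** Dirichlet's argument again: |x| < S / N^3 while the other three conjugates are at most N S. The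
    norm is bounded by S^4, and |x / sg x| by S^4 / N^4. *)
Lemma O_unit_exists : exists u, [/\ O u, O u^-1 & `|u| != `|sg u|].
Proof.
have a_gt0 := qa_gt0 D; pose S : algC := \sum_(i < 4) al ^+ i.
have S_gt0 : 0 < S.
  by rewrite /S !big_ord_recl big_ord0 /= addr0 !addr_gt0 ?exprn_gt0.
apply: (unit_exists hO O_lattice (nr := nK D) (C := (Num.truncn (S ^+ 4)).+1)).
  move=> x hx x0; split; [exact: nK_ZZ|by rewrite nK_eq0|].
  rewrite (_ : nK D x / x = sg x * ta (x * sg x)); last by rewrite /nK; field.
  apply: (sringM hO); first exact: O_conj.
  by apply: Ok_O; apply: Ok_conj; apply: O_norm.
move=> e e0; have S40 : 0 <= S ^+ 4 by apply/ltW/exprn_gt0.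
have [N N0 hN] := archi_div S40 e0.
have N0' : 0 < N%:R :> algC by rewrite ltr0n.
have [|c [[i ci] hc]] := @small_form 4 N (fun i : 'I_4 => al ^+ i) isT N0.
  by move=> i; apply: exprn_gt0.
rewrite /= natrX -/S; set x := \sum_i _ => hx.
have hOx : O x by apply/O_lattice; exists c.
have x0 : x != 0 by apply: contraNneq ci => /O_inj ->.
have hz j : `|(c j)%:~R| <= N%:R :> algC.
  by have := hc j; rewrite -(ler_nat algC) natr_absz intr_norm.
have hsx : `|sg x| <= N%:R * S by apply: emb_bound => //; rewrite sg_al normrN gtr0_norm.
have htx : `|ta x| <= N%:R * S by apply: emb_bound => //; apply: norm_ta_al.
have htsx : `|ta (sg x)| <= N%:R * S.
  by apply: (@emb_bound (ta \o sg)) => //=; rewrite sg_al rmorphN normrN norm_ta_al.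
have NS0 : 0 <= N%:R * S by rewrite mulr_ge0 ?ler0n ?ltW.
have NV0 : 0 <= S / N%:R ^+ 3 by rewrite divr_ge0 ?exprn_ge0 ?ltW.
exists x; split=> //.
  apply: le_trans (_ : S ^+ 4 <= _); last first.
    by apply/ltW; case/andP: (truncn_itv S40).
  rewrite nK_norm (_ : S ^+ 4 = (S / N%:R ^+ 3) * (N%:R * S) * ((N%:R * S) * (N%:R * S))); last first.
    by field; rewrite gt_eqF.
  by rewrite !ler_pM ?mulr_ge0 //; apply: ltW.
have hn1 := nK_ge1 hOx x0.
have h1 : `|x / sg x| <= (S / N%:R ^+ 3) ^+ 2 * ((N%:R * S) * (N%:R * S)).
  have -> : `|x / sg x| = `|x| ^+ 2 * (`|ta x| * `|ta (sg x)|) / `|nK D x|.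
    rewrite nK_norm normf_div; field.
    by rewrite !normr_eq0 !fmorph_eq0 x0.
  rewrite ler_pdivrMr; last by apply: lt_le_trans ltr01 hn1.
  apply: le_trans (_ : _ <= (S / N%:R ^+ 3) ^+ 2 * ((N%:R * S) * (N%:R * S))) _.
    apply: ler_pM; [exact: exprn_ge0|exact: mulr_ge0| |exact: ler_pM].
    by rewrite lerXn2r ?nnegrE ?normr_ge0 //; exact: ltW.
  by rewrite ler_peMr //; apply: mulr_ge0; [exact: exprn_ge0|exact: mulr_ge0].
apply: le_lt_trans h1 _; apply: le_lt_trans hN.
rewrite (_ : _ * _ = S ^+ 4 / N%:R ^+ 4); last by field; rewrite gt_eqF.
rewrite ler_wpM2l // lef_pV2 ?posrE ?exprn_gt0 //.
by rewrite -natrX ler_nat -{1}(expn1 N) leq_pexp2l.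
Qed.
End PrimeTwo.

(** * A unit of O with relative norm 2 up to squares *)

Section Units.
Variable D : pquartic.
Local Notation al := (qa D).
Local Notation sg := (qs D).
Local Notation ta := (qt D).
Local Notation t := (sqrt_p D).
Local Notation Ok := (Ok D).
Local Notation O := (O D).
Local Notation PP := (PP D).
Local Notation pi := (qpi D).

Let hR := Ok_ring D.
Let hO := O_ring D.
Let hpi : Ok pi := qpi_Ok D.
Let ht : Ok t := Ok_t D.

Lemma absNK_unit u : O u -> O u^-1 -> u != 0 -> absNK D u = 1%N.
Proof.
move=> hu hu' u0; have : (absNK D u * absNK D u^-1 = 1)%N.
  by rewrite -absNKM // divff // (absNK_eq (n := 1)) ?normr1 //; [apply: sring1|rewrite /nK !(rmorph1, mulr1) normr1].
by move/eqP; rewrite muln_eq1 => /andP[/eqP].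
Qed.

Lemma no_norm2 x : O x -> absNK D x <> 2%N.
Proof.
move=> hx e; have x0 : x != 0 by apply/eqP=> x0; move: e; rewrite /absNK /nK x0 !mul0r floor0.
by have := psi_norm hx x0; rewrite e psi2.
Qed.

Lemma no_sqrt_pi x u : O x -> O u -> O u^-1 -> u != 0 -> x ^+ 2 = u * pi -> False.
Proof.
move=> hx hu hu' u0 e; apply: (no_norm2 hx).
have hpiO : O pi by apply: Ok_O.
have npi : absNK D pi = 4%N by apply: absNK_eq => //; rewrite nK_pi normr_nat.
have := congr1 (absNK D) e; rewrite expr2 !absNKM // npi (absNK_unit hu hu' u0) mul1n.
case: (absNK D x) => [|[|[|k]]] //; lia.
Qed.

(** The square of a generator would be pi times a unit, so its norm would be 2 up to sign, a value
    that the character excludes. *)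
Lemma PP_not_principal x : PP <> scaleI x O.
Proof.
move=> e; have hx : O x.
  by apply: (ideal_sub (PP_ideal D)); rewrite e; apply: sc_self.
have e2 : scaleI (x ^+ 2) O = scaleI pi O.
  by rewrite -PP_sq e mulI_scl mulI_scr -scM (mulI_RR hO).
have x0 : x ^+ 2 != 0.
  apply/eqP => x0; move: (sc_self hO pi); rewrite -e2 x0 => -[y [_ ey]].
  by have := pi0 D; rewrite ey mul0r eqxx.
have [h1 h2] := sc_mem_unit hO x0 e2.
apply: (@no_sqrt_pi x (x ^+ 2 / pi)) => //.
- by rewrite invf_div.
- by rewrite mulf_neq0 ?invr_eq0 ?pi0.
by rewrite divfK ?pi0.
Qed.

(** [ta al] is a square root of - t < 0, hence purely imaginary. So [ta] and [ta \o sg] give the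
    pair of complex embeddings of K. *)
Lemma ta_al_conj : (ta al)^* = - ta al.
Proof.
have e : (ta al) ^+ 2 = - t by rewrite -rmorphXn /= -/t ta_t.
have e' : ((ta al)^*) ^+ 2 = (ta al) ^+ 2.
  transitivity (((ta al) ^+ 2)^*); first by rewrite [RHS]rmorphXn.
  rewrite e rmorphN /=; congr (- _); apply/CrealP.
  exact: gtr0_real (t_gt0 D).
move/eqP: e'; rewrite eqf_sqr => /orP[/eqP|/eqP //] h.
have : 0 <= (ta al) ^+ 2 by rewrite real_exprn_even_ge0 //; apply/CrealP.
by rewrite e oppr_ge0 => h'; have := lt_le_trans (t_gt0 D) h'; rewrite ltxx.
Qed.

Lemma ta_sg_conj x : O x -> ta (sg x) = (ta x)^*.
Proof.
case=> a [b [ha hb ->]]; rewrite (qext_sg (sg_al D) (@sg_Ok D)) // rmorphB rmorphD !rmorphM /=.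
rewrite rmorphD rmorphM /= ta_al_conj.
have hr c : Ok c -> (ta c)^* = ta c by move=> hc; apply/CrealP; apply: Ok_real (Ok_conj hc).
by rewrite !hr // mulrN.
Qed.

Lemma O_real x : O x -> x \is Num.real.
Proof.
case=> a [b [ha hb ->]]; rewrite rpredD ?(Ok_real ha) // rpredM ?(Ok_real hb) //.
exact: gtr0_real (qa_gt0 D).
Qed.

Lemma ta_norm_ge0 x : O x -> ta (x * sg x) = `|ta x| ^+ 2.
Proof. by move=> hx; rewrite rmorphM ta_sg_conj // normCK. Qed.

(** Positivity is seen at the conjugate: [ta] maps the relative norm to |ta e|^2 > 0, and the
    product of the two is 1. *)
Lemma relnorm_unit e : O e -> O e^-1 -> e != 0 ->
  [/\ Ok (e * sg e), Ok (e * sg e)^-1 & 0 < e * sg e].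
Proof.
move=> he he' e0; have h1 : Ok (e * sg e) by apply: O_norm.
have h2 : Ok (e * sg e)^-1 by rewrite invfM -fmorphV mulrC mulrC; apply: O_norm.
split=> //; have n0 : e * sg e != 0 by rewrite mulf_neq0 ?fmorph_eq0.
have n1 := Ok_unit_norm h1 h2 n0.
have h3 : 0 < ta (e * sg e) by rewrite ta_norm_ge0 // exprn_gt0 // normr_gt0 fmorph_eq0.
by rewrite -(pmulr_lgt0 _ h3) n1.
Qed.

(** The discriminant of the polynomial (X - e)(X - sg e) divided by its constant term, which makes
    it invariant under scaling of e by k. *)
Definition disc (e : algC) := (e - sg e) ^+ 2 / (e * sg e).

(** [disc e] is a positive element of [Ok], so its norm is at least 1 in absolute value, and its
    conjugate is at most 4 because ta e and ta (sg e) are complex conjugates. *)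
Lemma disc_lower e : O e -> O e^-1 -> e != 0 -> e != sg e -> 4^-1 <= disc e.
Proof.
move=> he he' e0 esg; have [h1 h2 h3] := relnorm_unit he he' e0.
have h : Ok (disc e).
  apply: (sringM hR) => //.
  have -> : (e - sg e) ^+ 2 = (e + sg e) ^+ 2 - 4 * (e * sg e) by ring.
  by have := O_trace he; move=> h; ring_mem hR.
have d0 : 0 <= disc e.
  rewrite divr_ge0 // ?(ltW h3) // real_exprn_even_ge0 // rpredB ?O_real //; exact: O_conj.
have dn0 : disc e != 0.
  by rewrite mulf_neq0 ?invr_eq0 ?(gt_eqF h3) // expf_neq0 // subr_eq0.
have ht4 : `|ta (disc e)| <= 4.
  rewrite /disc fmorph_div rmorphXn rmorphB ta_norm_ge0 //= ta_sg_conj // normf_div !normrX normr_id.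
  have te0 : 0 < `|ta e| ^+ 2 by rewrite exprn_gt0 // normr_gt0 fmorph_eq0.
  rewrite ler_pdivrMr // (_ : 4 * _ = (`|ta e| + `|ta e|) ^+ 2); last by ring.
  rewrite lerXn2r ?nnegrE ?addr_ge0 //.
  by apply: le_trans (ler_normB _ _) _; rewrite norm_conjC.
have := int_norm_ge1 (Ok_norm h); rewrite mulf_neq0 ?fmorph_eq0 // => /(_ isT).
rewrite normrM (ger0_norm d0) => h5.
rewrite -[4^-1]mul1r ler_pdivrMr ?ltr0n //; apply: le_trans h5 _.
by rewrite ler_wpM2l.
Qed.

Lemma disc_mul u e : Ok u -> u != 0 -> e != 0 -> disc (u * e ^+ 2) = disc e * (disc e + 4).
Proof.
move=> hu u0 e0; rewrite /disc rmorphM rmorphXn /= (sg_Ok hu).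
by field; rewrite u0 e0 fmorph_eq0 e0.
Qed.

(** If the relative norm is a square, Hilbert 90 gives f^2 = e r, so (f)^2 = (r) and
    [square_generator] describes r up to squares by a unit and powers of pi and t. Now t = al^2 is a
    square in O, and an odd power of pi would make pi times a unit a square. *)
Lemma unit_square_or e : O e -> O e^-1 -> e != 0 ->
  (exists2 v, Ok v & 2 * (e * sg e) = v ^+ 2) \/
  exists u e', [/\ Ok u, u != 0, O e', O e'^-1 & e = u * e' ^+ 2].
Proof.
move=> he he' e0; have [h1 h2 h3] := relnorm_unit he he' e0.
have [w hw [ew|ew]] := Ok_unit_square h1 h2 h3; last by left; exists w.
right; have [ew'|[f [r [hf hr f0 r0 efr]]]] := hilbert90 hR ht (sg_al D) (@sg_Ok D) he hw ew.
  exists e, 1; rewrite invr1 expr1n mulr1; split=> //; try exact: sring1.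
  by rewrite ew'; apply: sringN.
have hBB : mulI (scaleI f O) (scaleI f O) = scaleI r O.
  rewrite mulI_scl mulI_scr -scM (mulI_RR hO) -expr2 efr mulrC scM.
  by rewrite (sc_unit (rmod_self hO) he he' e0).
have [u [d [i [j [hu hu' hd d0 eu]]]]] := square_generator (ideal_pr hO hf f0) hr r0 hBB.
have u0 : u != 0.
  by apply: contraNneq d0 => u0; rewrite -sqrf_eq0 -eu u0 mulr0 !mul0r.
have pj0 : pi ^+ i./2 * al ^+ j != 0.
  by apply: mulf_neq0; apply: expf_neq0; [apply: pi0|apply: al0].
pose y := d / (f * (pi ^+ i./2 * al ^+ j)).
have y0 : y != 0 by apply: mulf_neq0 => //; rewrite invr_eq0; apply: mulf_neq0.
have hy : frac_of O y.
  apply: (fr_div hO); first exact: Ok_O.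
  by apply: (sringM hO) => //; apply: (sringM hO); apply: (sringX hO); [apply: Ok_O|apply: O_al].
have ey : y ^+ 2 = u / e * pi ^+ odd i.
  have pi_i : pi ^+ i = pi ^+ odd i * (pi ^+ i./2) ^+ 2.
    by rewrite -exprM muln2 -exprD odd_double_half.
  have t_j : t ^+ j = (al ^+ j) ^+ 2 by rewrite /sqrt_p -!exprM mulnC.
  rewrite /y expr_div_n -eu [in X in _ / X]exprMn efr [in X in _ / X]exprMn pi_i t_j.
  move: pj0; rewrite mulf_eq0 negb_or => /andP[p0 a0].
  by field; rewrite e0 r0 p0 a0.
have hOu := Ok_O hu; have hOu' := Ok_O hu'.
case oi : (odd i) ey; rewrite ?expr1 ?expr0 ?mulr1 => ey.
  exfalso; apply: (@no_sqrt_pi y (u / e)) => //.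
  - by apply: sqcl_O => //; rewrite ey; apply: (sringM hO); [apply: sringM|apply: Ok_O].
  - exact: sringM.
  - by rewrite invf_div; apply: sringM.
  - by rewrite mulf_neq0 ?invr_eq0.
have hOy : O y by apply: sqcl_O => //; rewrite ey; apply: sringM.
have hOy' : O y^-1.
  by apply: sqcl_O; [apply: frV|rewrite exprVn ey invf_div; apply: sringM].
exists u, y^-1; rewrite invrK; split=> //.
by rewrite exprVn ey invf_div mulrCA divff // mulr1.
Qed.

(* Otherwise every unit is an element of [Ok] times a square, so that [disc] could be divided
   by 4 indefinitely ([disc_mul]), against [disc_lower]. *)
Lemma unit_nonsquare_norm : exists e v, [/\ O e, O e^-1, e != 0, Ok v & 2 * (e * sg e) = v ^+ 2].
Proof.
have [//|hno] := pselect (exists e v, [/\ O e, O e^-1, e != 0, Ok v & 2 * (e * sg e) = v ^+ 2]).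
exfalso.
have hsq e : O e -> O e^-1 -> e != 0 -> exists u e', [/\ Ok u, u != 0, O e', O e'^-1 & e = u * e' ^+ 2].
  move=> he he' e0; have [[v hv ev]|//] := unit_square_or he he' e0.
  by case: hno; exists e, v.
have hgrow (n : nat) e : O e -> O e^-1 -> e != 0 -> e != sg e -> 4 ^+ n / 4 <= disc e.
  elim: n e => [|n IH] e he he' e0 esg.
    by rewrite expr0 mul1r; apply: disc_lower.
  have [u [e1 [hu u0 he1 he1' ee]]] := hsq e he he' e0.
  have e10 : e1 != 0 by apply: contraNneq e0 => h; rewrite ee h expr0n mulr0.
  have e1sg : e1 != sg e1.
    by apply: contraNneq esg => h; rewrite ee rmorphM rmorphXn /= -h (sg_Ok hu).
  have h4 := disc_lower he1 he1' e10 e1sg; have hI := IH e1 he1 he1' e10 e1sg.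
  have d0 : 0 <= disc e1 by apply: le_trans h4; rewrite invr_ge0 ler0n.
  rewrite ee disc_mul // exprS -mulrA.
  apply: le_trans (_ : 4 * disc e1 <= _); first by rewrite ler_wpM2l ?ler0n.
  by rewrite mulrC ler_wpM2l // lerDr.
have [e [he he' hne]] := O_unit_exists D.
have e0 : e != 0 by apply: contraNneq hne => ->; rewrite rmorph0.
have esg : e != sg e by apply: contraNneq hne => {1}->.
have h4 := disc_lower he he' e0 esg.
have d0 : 0 <= disc e * 4.
  by apply: mulr_ge0; rewrite ?ler0n //; apply: le_trans h4; rewrite invr_ge0 ler0n.
have /andP[_ hlt] := truncn_itv d0; set N := (Num.truncn (disc e * 4)).+1 in hlt.
have := hgrow N e he he' e0 esg; rewrite ler_pdivrMr ?ltr0n // => /le_lt_trans/(_ hlt).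
by rewrite -natrX ltr_nat ltnNge ltnW // ltn_expl.
Qed.
End Units.

Lemma psiX n k : (0 < n)%N -> psi (n ^ k) = odd k && psi n.
Proof.
move=> n0; elim: k => [|k IH]; first by rewrite expn0 psi_odd.
by rewrite expnS psiM ?expn_gt0 ?n0 // IH /=; case: (odd k); case: (psi n).
Qed.

(** * The 2-torsion of the class group *)

Section Classes.
Variable D : pquartic.
Local Notation p := (qp D).
Local Notation al := (qa D).
Local Notation t := (sqrt_p D).
Local Notation Ok := (Ok D).
Local Notation O := (O D).
Local Notation PP := (PP D).
Local Notation pi := (qpi D).

Let hR := Ok_ring D.
Let hO := O_ring D.
Let hpi : Ok pi := qpi_Ok D.
Let ht : Ok t := Ok_t D.
Let hPP := PP_ideal D.

Lemma absNkM x y : Ok x -> Ok y -> absNk D (x * y) = (absNk D x * absNk D y)%N.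
Proof.
move=> hx hy; apply/eqP; rewrite -(eqr_nat algC) natrM !absNkE //; last exact: sringM.
by rewrite rmorphM mulrACA normrM.
Qed.

Lemma absNkX x n : Ok x -> absNk D (x ^+ n) = (absNk D x ^ n)%N.
Proof.
move=> hx; elim: n => [|n IH]; last by rewrite exprS expnS absNkM ?IH //; apply: sringX.
by apply/eqP; rewrite expr0 expn0 -(eqr_nat algC) absNkE ?rmorph1 ?mulr1 ?normr1 //; apply: sring1.
Qed.

Lemma absNk_unit u : Ok u -> Ok u^-1 -> u != 0 -> absNk D u = 1%N.
Proof.
by move=> hu hu' u0; apply/eqP; rewrite -(eqr_nat algC) absNkE // Ok_unit_norm // normr1.
Qed.

Lemma absNk_pi : absNk D pi = 2%N.
Proof.
apply/eqP; rewrite -(eqr_nat algC) absNkE //; have [n [-> en]] := pi_norm D.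
by rewrite -intr_norm -natr_absz en.
Qed.

Lemma absNk_t : absNk D t = p.
Proof. by apply/eqP; rewrite -(eqr_nat algC) absNkE // t_norm normrN normr_nat. Qed.

Lemma nuk_gt0 x : Ok x -> x != 0 -> (0 < absNk D x)%N.
Proof.
by move=> hx x0; rewrite -(ltr0n algC) absNkE // normr_gt0 mulf_neq0 ?fmorph_eq0.
Qed.

Lemma psi_p : psi p = false.
Proof.
have hm := q_mod D; rewrite psi_odd; last by have [q ->] := q_decomp D; rewrite oddD oddM andbF.
have -> : (p %% 8 = 7)%N by lia.
by [].
Qed.

Section SquareEquation.
Variables (c u d : algC) (i j : nat).
Hypotheses (hc : Ok c) (hu : Ok u) (hu' : Ok u^-1) (hd : Ok d) (d0 : d != 0).
Hypothesis e : c * u * pi ^+ i * t ^+ j = d ^+ 2.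

Lemma square_equation_c0 : c != 0.
Proof. by apply: contraNneq d0 => h; rewrite -sqrf_eq0 -e h !mul0r. Qed.

Lemma square_equation_u0 : u != 0.
Proof. by apply: contraNneq d0 => h; rewrite -sqrf_eq0 -e h mulr0 !mul0r. Qed.

Lemma absNk_square_equation : (absNk D c * 2 ^ i * p ^ j = absNk D d * absNk D d)%N.
Proof.
have u0 := square_equation_u0.
rewrite mulnn -absNkX // -e (@absNkM _ (t ^+ j)) ?(absNkX _ ht) ?absNk_t; try by ring_mem hR.
rewrite (@absNkM _ (pi ^+ i)) ?(absNkX _ hpi) ?absNk_pi; try by ring_mem hR.
by rewrite (@absNkM _ u) // (absNk_unit hu hu' u0) muln1.
Qed.

(** [psi] is applied to the norms of both sides: squares have value + 1, pi has norm 2 of value - 1,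
    and p = 7 mod 8 has value + 1. *)
Lemma psi_square_equation : psi (absNk D c) = odd i.
Proof.
have := congr1 psi absNk_square_equation; rewrite psi_sq ?nuk_gt0 //.
have p0 := prime_gt0 (q_prime D); have nc := nuk_gt0 hc square_equation_c0.
rewrite !psiM ?muln_gt0 ?expn_gt0 ?nc ?p0 //.
by rewrite !psiX // psi2 psi_p andbF andbT addbF; case: psi; case: odd.
Qed.

Lemma logn_square_equation : ~~ (p %| absNk D c)%N -> odd j = false.
Proof.
move=> hpn; have := congr1 (logn p) absNk_square_equation.
have nc := nuk_gt0 hc square_equation_c0; have nd := nuk_gt0 hd d0.
have pp := q_prime D; have p0 := prime_gt0 pp.
rewrite !lognM ?muln_gt0 ?expn_gt0 ?nc ?nd ?p0 // !lognX.
rewrite [logn p (absNk D c)]lognE (negbTE hpn) !andbF (logn_prime p (isT : prime 2)) (logn_prime p pp) eqxx muln1 addnn.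
have -> : (p == 2) = false by apply/eqP => h; have := q_mod D; rewrite h.
by rewrite muln0 !add0n => ->; rewrite odd_double.
Qed.
End SquareEquation.

(** Both sides have square (d^2), as PP^2 = (pi) and al^2 = t, and [sq_principal] extracts the
    root. *)
Lemma square_ideal_factor B c : ideal O B -> Ok c -> c != 0 -> mulI B B = scaleI c O ->
  exists u d i j, [/\ Ok u, Ok u^-1, Ok d /\ d != 0, c * u * pi ^+ i * t ^+ j = d ^+ 2 &
    scaleI (al ^+ j * pi ^+ i./2) (mulI B (if odd i then PP else O)) = scaleI d O].
Proof.
move=> hB hc c0 hBB.
have [u [d [i [j [hu hu' hd d0 e]]]]] := square_generator hB hc c0 hBB.
exists u, d, i, j; split=> //.
have hX : ideal O (if odd i then PP else O) by case: odd => //; apply: ideal_self.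
have u0 : u != 0 by apply: contraNneq d0 => h; rewrite -sqrf_eq0 -e h mulr0 !mul0r.
have eXX : mulI (if odd i then PP else O) (if odd i then PP else O) = scaleI (pi ^+ odd i) O.
  by case: odd; rewrite ?expr1 ?expr0 ?sc1 ?PP_sq ?mulI_RR.
apply: (sq_principal hO (@sqcl_O D) d0).
- by apply: rmod_sc; apply: rmod_mulI; apply: ideal_rmod.
- move=> _ [x [hx ->]]; apply: (frM hO); last by apply: (frV hO); apply: (fr_R hO); apply: Ok_O.
  apply: (fr_R hO); apply: (sringM hO).
    by apply: (sringM hO); apply: (sringX hO); [apply: O_al|apply: Ok_O].
  by apply: (ideal_sub _ hx); apply: ideal_mulI.
rewrite mulI_scl mulI_scr mulIACA hBB eXX mulI_scl mulI_scr (mulI_RR hO) -!scM.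
have -> : d ^+ 2 = (al ^+ j * pi ^+ i./2 * (al ^+ j * pi ^+ i./2) * c * pi ^+ odd i) * u.
  rewrite -e /sqrt_p -exprM.
  have pi_i : pi ^+ i = pi ^+ odd i * (pi ^+ i./2) ^+ 2.
    by rewrite -exprM muln2 -exprD odd_double_half.
  by rewrite pi_i mulnC exprM; ring.
have hOu := Ok_O hu; have hOu' := Ok_O hu'.
by rewrite [RHS]scM (sc_unit (rmod_self hO) hOu hOu' u0) !mulrA.
Qed.

Lemma equivI_of_sc g I d : O g -> g != 0 -> O d -> d != 0 -> scaleI g I = scaleI d O -> equivI O I O.
Proof. by move=> hg g0 hd d0 e; exists g, d. Qed.

Lemma PP_PP_equiv I : ideal O I -> equivI O (mulI (mulI I PP) PP) I.
Proof.
move=> hI; rewrite -mulIA PP_sq mulI_scr mulIC (mulI_R hO (ideal_rmod hI)).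
by apply: equivI_sc => //; [apply: Ok_O|apply: pi0].
Qed.

Lemma square_rational_class B c : ideal O B -> Ok c -> c != 0 -> mulI B B = scaleI c O ->
  equivI O B O \/ equivI O B PP.
Proof.
move=> hB hc c0 hBB.
have [u [d [i [j [hu hu' [hd d0] e es]]]]] := square_ideal_factor hB hc c0 hBB.
have hg : O (al ^+ j * pi ^+ i./2).
  by apply: (sringM hO); apply: (sringX hO); [apply: O_al|apply: Ok_O].
have g0 : al ^+ j * pi ^+ i./2 != 0.
  by apply: mulf_neq0; apply: expf_neq0; [apply: al0|apply: pi0].
have := equivI_of_sc hg g0 (Ok_O hd) d0 es.
case: (odd i); last by rewrite mulIC (mulI_R hO (ideal_rmod hB)); left.
move=> h; right; apply: (equivI_trans hO (equivI_sym (PP_PP_equiv hB))).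
have h2 := equivI_mul hO h (equivI_refl hO PP).
by rewrite (mulI_R hO (ideal_rmod hPP)) in h2.
Qed.

Lemma O_div_al a b : Ok a -> Ok b -> O ((a + b * al) / al) <-> Ok (a / t).
Proof.
move=> ha hb; have a0 := al0 D.
have e : (a + b * al) / al = b + a / t * al by rewrite /sqrt_p; field.
split=> [[c [d [hc hd e']]]|h]; last by rewrite e; exists b, (a / t).
have e1 : a + b * al = d * t + c * al.
  rewrite -[LHS](divfK a0) e' /sqrt_p; ring.
have [|-> _] := qext_inj a0 (sg_al D) (@sg_Ok D) ha hb _ hc e1; first exact: sringM.
  by rewrite mulfK ?t0.
Qed.

Lemma O_al_prime x y : O x -> O y -> O (x * y / al) -> O (x / al) \/ O (y / al).
Proof.
move=> [a [b [ha hb ->]]] [c [d [hc hd ->]]].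
have -> : (a + b * al) * (c + d * al) = (a * c + b * d * t) + (a * d + b * c) * al.
  by rewrite /sqrt_p; ring.
move=> hxy; have h : Ok ((a * c + b * d * t) / t).
  by apply/(O_div_al (b := a * d + b * c)) => //; ring_mem hR.
have : Ok (a * c / t).
  have -> : a * c / t = (a * c + b * d * t) / t - b * d by field; apply: t0.
  by apply: (sringB hR) => //; ring_mem hR.
by case/(Ok_t_prime ha hc) => h'; [left|right]; apply/O_div_al.
Qed.

Lemma absNK_al : absNK D al = p.
Proof.
apply: absNK_eq; first exact: O_al.
rewrite /nK sg_al mulrN -expr2 -/t rmorphN ta_t opprK mulNr normrN -expr2 tt normr_nat //.
Qed.

Lemma absNK_div_al x : O x -> x != 0 -> O (x / al) -> (absNK D (x / al) < absNK D x)%N.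
Proof.
move=> hx x0 hxa; have -> : absNK D x = (absNK D (x / al) * p)%N.
  by rewrite -absNK_al -absNKM ?divfK ?al0 //; apply: O_al.
rewrite ltn_Pmulr ?prime_gt1 ?q_prime // absNK_gt0 // mulf_neq0 // invr_eq0.
exact: al0.
Qed.
End Classes.

(** * Classes of order 2, and the class of PP as a non-square *)

Section TwoTorsion.
Variable D : pquartic.
Local Notation p := (qp D).
Local Notation al := (qa D).
Local Notation sg := (qs D).
Local Notation ta := (qt D).
Local Notation t := (sqrt_p D).
Local Notation Ok := (Ok D).
Local Notation O := (O D).
Local Notation PP := (PP D).
Local Notation pi := (qpi D).

Let hR := Ok_ring D.
Let hO := O_ring D.
Let hpi : Ok pi := qpi_Ok D.
Let ht : Ok t := Ok_t D.
Let hPP := PP_ideal D.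

Lemma mulI_cj_principal I x : mulI I I = scaleI x O ->
  mulI (mulI I (conjI sg I)) (mulI I (conjI sg I)) = scaleI (x * sg x) O.
Proof.
move=> h; rewrite mulIACA h mulI_cj h cj_sc (cj_ring (@O_conj D) (@O_conjK D)).
by rewrite mulI_scl mulI_scr -scM (mulI_RR hO).
Qed.

(** At the conjugate [ta] the relative norm becomes |ta c|^2 > 0 and d^2 remains a real square, so
    ta u > 0; and u ta u = 1. *)
Lemma Ok_unit_pos u c d : O c -> c != 0 -> Ok u -> Ok u^-1 -> u != 0 -> Ok d ->
  c * sg c * u = d ^+ 2 -> 0 < u.
Proof.
move=> hc c0 hu hu' u0 hd e; have n1 := Ok_unit_norm hu hu' u0.
have h1 : 0 < ta (c * sg c) by rewrite ta_norm_ge0 // exprn_gt0 // normr_gt0 fmorph_eq0.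
have h2 : 0 <= ta (c * sg c) * ta u.
  by rewrite -rmorphM e rmorphXn real_exprn_even_ge0 //; apply: Ok_real; apply: Ok_conj.
have h3 : 0 < ta u.
  by rewrite lt_def fmorph_eq0 u0 /=; rewrite pmulr_rge0 in h2.
by rewrite -(pmulr_lgt0 _ h3) n1.
Qed.

(* If I^2 = (a), the unit of [unit_nonsquare_norm] allows to assume that a has relative norm
   a square; then a is f^2 / r with r in [Ok] by Hilbert 90, and (r / f) I has square (r). *)
Lemma class_two_torsion I : ideal O I -> equivI O (mulI I I) O -> equivI O I O \/ equivI O I PP.
Proof.
move=> hI /equivI_ex[x hx [x0 hII]].
have hxO : O x.
  by apply: (ideal_sub (ideal_mulI hO hI hI)); rewrite hII; apply: sc_self.
(* The factors al are divided out of x, so that p will not divide the norm of a. *)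
have [m [I1 [a [hI1 eI1 [ha haal] ea hII1]]]] :=
  square_normalise hO (al0 D) (@O_al_prime D) (@absNK_div_al D) hI hxO x0 hII.
have aln0 : al ^+ m != 0 by rewrite expf_neq0 ?al0.
have a0 : a != 0 by apply: contraNneq x0 => h; rewrite ea h mulr0.
have hI1I : equivI O I I1.
  by rewrite eI1; apply: equivI_sc => //; apply: sringX => //; apply: O_al.
suff [h|h] : equivI O I1 O \/ equivI O I1 PP.
- by left; apply: equivI_trans hI1I h.
- by right; apply: equivI_trans hI1I h.
move: hI1 ha haal hII1 a0; move: I1 a {hI hx x0 hII hxO eI1 ea aln0 hI1I m x I}.
move=> I a hI ha haal hII a0.
set c := a * sg a; have hc : Ok c by apply: O_norm.
have c0 : c != 0 by rewrite mulf_neq0 ?fmorph_eq0.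
have hB : ideal O (mulI I (conjI sg I)).
  by apply: ideal_mulI => //; apply: ideal_cj => //; [apply: O_conj|apply: O_conjK].
have [u [d [i [j [hu hu' hd d0 e]]]]] := square_generator hB hc c0 (mulI_cj_principal hII).
have u0 : u != 0 by apply: contraNneq d0 => h; rewrite -sqrf_eq0 -e h mulr0 !mul0r.
(* The norm of c over Q is the norm of a, where the character is + 1. *)
have oi : odd i = false.
  by rewrite -(psi_square_equation hc hu hu' hd d0 e); apply: (psi_norm ha a0).
(* If p divided the norm of c, then t would divide c in [Ok], and the prime al would divide a or its
   conjugate, hence a. *)
have oj : odd j = false.
  apply: (logn_square_equation hc hu hu' hd d0 e).
  apply/negP => hp; have [c1 [c2 ec]] := OkE hc.
    have hcp : (p%:Z %| c1)%Z.
      have eN : (c1 * c1 - p%:Z * (c2 * c2))%:~R = c * ta c.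
        rewrite ec (rmorphD ta) (rmorphM ta) !(rmorph_int ta) ta_t.
        by rewrite rmorphB /= !intrM -[p%:Z%:~R]/(p%:R : algC) -tt; ring.
      have : (p%:Z %| c1 * c1 - p%:Z * (c2 * c2))%Z.
        rewrite dvdzE; suff -> : absz (c1 * c1 - p%:Z * (c2 * c2))%R = absNk D c by [].
        by apply/eqP; rewrite -(eqr_nat algC) absNkE // -eN natr_absz intr_norm.
      case/dvdzP=> k ek; have : (p%:Z %| c1 * c1)%Z by apply/dvdzP; exists (k + c2 * c2); lia.
      by case/Euclid_int.
    have : O (a * sg a / al).
      rewrite -/c ec -[_ + _](addr0 _) -(mul0r al); apply/O_div_al; [exact: Okintro|exact: sring0|].
      exact/Ok_div_t.
    case/(O_al_prime ha (O_conj ha)) => // /(O_conj); rewrite fmorph_div (O_conjK ha) sg_al => h.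
    by apply: haal; rewrite -[a / al]opprK -mulrN -invrN; apply: sringN.
pose d1 := d / (pi ^+ i./2 * t ^+ j./2).
have pt0 : pi ^+ i./2 * t ^+ j./2 != 0.
  by apply: mulf_neq0; apply: expf_neq0; [apply: pi0|apply: t0].
have half (n : nat) (y : algC) : odd n = false -> y ^+ n = (y ^+ n./2) ^+ 2.
  by move=> on; rewrite -exprM muln2 -{1}[n]odd_double_half on.
have ed1 : d1 ^+ 2 = c * u.
  by rewrite /d1 expr_div_n -e (half i) // (half j) // -mulrA -exprMn mulfK // expf_neq0.
have hd1 : Ok d1.
  apply: sqcl_Ok; last by rewrite ed1; ring_mem hR.
  by apply: (fr_div hR) => //; ring_mem hR.
have u_gt0 : 0 < u by apply: (Ok_unit_pos ha a0 hu hu' u0 hd1); rewrite ed1.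
have d10 : d1 != 0 by rewrite mulf_neq0 ?invr_eq0.
have [b [d2 [hb b0 hIIb hd2 eb]]] : exists b d2,
    [/\ O b, b != 0, mulI I I = scaleI b O, Ok d2 & b * sg b = d2 ^+ 2].
  have [w hw ew] := Ok_unit_square hu hu' u_gt0.
  have w0 : w != 0.
    by apply: contraNneq u0 => w0; case: ew => /eqP; rewrite w0 expr0n //= mulf_eq0 pnatr_eq0.
  case: ew => ew.
    exists a, (d1 / w); split=> //; last by rewrite expr_div_n ed1 -ew mulfK.
    by apply: sqcl_Ok; [apply: fr_div|rewrite expr_div_n ed1 -ew mulfK].
  (* In the case 2 u = w^2, multiplying a by a unit h with 2 (h sg h) = v^2 changes the relative
     norm d1^2 / u into (d1 v / w)^2. *)
  have [h [v [hh hh' h0 hv ev]]] := unit_nonsquare_norm D.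
  have en : a * h * sg (a * h) = (d1 * v / w) ^+ 2.
    rewrite rmorphM expr_div_n exprMn ed1 -ev -ew mulrACA -/c; field; rewrite u0 //.
  exists (a * h), (d1 * v / w); split=> //; first exact: sringM.
  - by rewrite mulf_neq0.
  - by rewrite hII scM (sc_unit (rmod_self hO) hh hh' h0).
  apply: sqcl_Ok; first by apply: (fr_div hR) => //; apply: sringM.
  by rewrite -en; apply: O_norm; apply: sringM.
have [ebd|[f [r [hf hr f0 r0 ef]]]] := hilbert90 hR ht (sg_al D) (@sg_Ok D) hb hd2 eb.
  apply: (@square_rational_class _ I b) => //; rewrite ebd; exact: sringN.
have rf0 : r / f != 0 by rewrite mulf_neq0 ?invr_eq0.
have hBB' : mulI (scaleI (r / f) I) (scaleI (r / f) I) = scaleI r O.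
  rewrite mulI_scl mulI_scr hIIb -!scM; congr (scaleI _ _).
  transitivity (r ^+ 2 * b / f ^+ 2); first by field.
  by rewrite ef; field; rewrite b0 r0.
have hfrr : frac_of O (r / f) by apply: (fr_div hO) => //; apply: Ok_O.
have hB' : ideal O (scaleI (r / f) I).
  split; first by apply: rmod_sc; apply: ideal_rmod.
    move=> _ [x [hx ->]]; apply: sqcl_O.
      by apply: (frM hO) => //; apply: (fr_R hO); apply: ideal_sub hx.
    have : mulI (scaleI (r / f) I) (scaleI (r / f) I) ((r / f * x) * (r / f * x)).
      by apply: mem_mulI; apply: sc_mem.
    by rewrite hBB' -expr2 => -[y [hy ->]]; apply: sringM => //; apply: Ok_O.
  by case: hI => _ _; apply: nonz_sc.
have hIB : equivI O I (scaleI (r / f) I).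
  by apply: equivI_sym; apply: (equivI_fr hfrr rf0).
have [h|h] := square_rational_class hB' hr r0 hBB'.
  by left; apply: equivI_trans hIB h.
by right; apply: equivI_trans hIB h.
Qed.

(** While I is contained in PP, it is replaced by I PP / pi, that is, divided by PP; the class of
    its square does not change. By [absNK_step] the 2-adic valuation of the norm of a chosen element
    drops each time. *)
Lemma avoid_PP I : ideal O I -> exists I', [/\ ideal O I', ~ (forall x, I' x -> PP x) &
  equivI O (mulI I' I') (mulI I I)].
Proof.
move=> hI; case: (hI) => _ _ [x [hx x0]].
have [n hn] : exists n, (logn 2 (absNK D x) < n)%N by exists (logn 2 (absNK D x)).+1.
elim: n x I hI hx x0 hn => [|n IH] x I hI hx x0 hn; first by rewrite ltn0 in hn.
have [hsub|hns] := pselect (forall y, I y -> PP y); last first.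
  by exists I; split=> //; apply: equivI_refl.
have pV0 : pi^-1 != 0 by rewrite invr_eq0 pi0.
have hIP : ideal O (mulI I PP) by apply: ideal_mulI.
have hI1 : ideal O (scaleI pi^-1 (mulI I PP)).
  split; first by apply: rmod_sc; apply: ideal_rmod.
    move=> _ [y [hy ->]]; have : mulI PP PP y by apply: mulI_mono hy.
    by rewrite PP_sq => -[z [hz ->]]; rewrite mulKf ?pi0.
  by case: hIP => _ _; apply: nonz_sc.
have [hy y0 hl _] := absNK_step (hsub _ hx) x0.
have [|||I' [h1 h2 h3]] := IH (x * (1 + al) / pi) _ hI1.
- exists (x * (1 + al)); split; last by rewrite mulrC.
  by apply: mem_mulI => //; apply: PP_1al.
- by [].
- by rewrite hl in hn.
exists I'; split=> //; apply: (equivI_trans hO h3).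
rewrite mulI_scl mulI_scr mulIACA PP_sq mulI_scr (mulIC _ O) (mulI_R hO); last first.
  by apply: rmod_mulI; apply: ideal_rmod.
rewrite -!scM; apply: (equivI_fr (R := O) (x := pi^-1)) => //.
  by apply: (frV hO); apply: (fr_R hO); apply: Ok_O.
by congr (scaleI _ _); field; apply: pi0.
Qed.

Lemma Ok_pi_val x : Ok x -> x != 0 -> exists m y, [/\ Ok y, ~ Ok (y / pi) & x = pi ^+ m * y].
Proof.
elim: (absNk D x).+1 {-2}x (ltnSn (absNk D x)) => // n IH {}x hn hx x0.
have [h|h] := pselect (Ok (x / pi)); last by exists 0%N, x; rewrite expr0 mul1r.
have x10 : x / pi != 0 by rewrite mulf_neq0 ?invr_eq0 ?pi0.
have hlt := absNk_lt hpi (pi0 D) (pi_norm_gt1 D) hx x0 h.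
have [|m [y [h1 h2 h3]]] := IH (x / pi) _ h x10; first exact: leq_trans hlt _.
by exists m.+1, y; split=> //; rewrite exprS -mulrA -h3 mulrC divfK ?pi0.
Qed.

Lemma PP_not_unit (c : algC) : Ok c -> ~ Ok (c / pi) -> ~ PP c.
Proof. by move=> hc h /(PP_Ok hc). Qed.

Lemma PP_al : ~ PP al.
Proof.
rewrite -[al]add0r -[al in 0 + al]mul1r => /(PPE (sring0 hR) (sring1 hR)).
by rewrite add0r mul1r; apply: Ok_piV.
Qed.

Lemma PP_al_pow n : ~ PP (al ^+ n).
Proof.
elim: n => [|n IH].
  by rewrite expr0; apply: PP_not_unit; [apply: sring1|rewrite mul1r; apply: Ok_piV].
rewrite exprS => /PP_prime[||h|//]; [exact: O_al|apply: (sringX hO); exact: O_al|exact: PP_al h].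
Qed.

(** Cancellation of PP: multiplying the hypothesis by PP gives x PP^2 <= pi PP, and PP^2 = (pi). *)
Lemma PP_cancel x : O x -> (forall y, PP y -> scaleI pi O (x * y)) -> PP x.
Proof.
move=> hx h; have p0 := pi0 D.
have hagrp : agrp (scaleI pi PP) by apply: agrp_sc; apply: ideal_agrp hPP.
have gen w : mulI PP PP w -> scaleI pi PP (x * w).
  move: w; apply: (@mulI_sub PP PP (fun w => scaleI pi PP (x * w))) => [|y z hy hz].
    by apply: (agrp_pre hagrp) => [|y z]; rewrite ?mulr0 ?mulrBr.
  have [o [ho eo]] := h _ hy; exists (o * z); rewrite mulrA eo mulrA; split=> //.
  exact: (ideal_mul hPP).
suff : scaleI pi PP (x * pi) by rewrite scE // mulfK.
by apply: gen; rewrite PP_sq; apply: sc_self.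
Qed.

(* The genus character is [-1] at [PP] and [1] on norms. *)
Lemma PP_not_square I : ideal O I -> ~ equivI O (mulI I I) PP.
Proof.
move=> hI0 h0; have [I1 [hI hnP hII1]] := avoid_PP hI0.
have {h0 hII1 hI0 I} := equivI_trans hO hII1 h0; move: I1 hI hnP => I hI hnP.
case=> z [y [hz z0 hy y0 e]].
have hzn := O_norm hz; have hyn := O_norm hy.
set nz := z * sg z in hzn; set ny := y * sg y in hyn.
have nz0 : nz != 0 by rewrite mulf_neq0 ?fmorph_eq0.
have ny0 : ny != 0 by rewrite mulf_neq0 ?fmorph_eq0.
set B := mulI I (conjI sg I).
have hB : ideal O B.
  by apply: ideal_mulI => //; apply: ideal_cj => //; [apply: O_conj|apply: O_conjK].
(* The relation z I^2 = y PP is multiplied by its conjugate and by nz; PP is its own conjugate. *)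
have hBB : mulI (scaleI nz B) (scaleI nz B) = scaleI (nz * ny * pi) O.
  rewrite mulI_scl mulI_scr /B mulIACA mulI_cj -scM.
  have -> : scaleI (nz * nz) (mulI (mulI I I) (conjI sg (mulI I I))) =
      scaleI nz (mulI (scaleI z (mulI I I)) (conjI sg (scaleI z (mulI I I)))).
    by rewrite cj_sc mulI_scl mulI_scr -!scM /nz ?mulrA.
  by rewrite e cj_sc PP_sg mulI_scl mulI_scr PP_sq -!scM !mulrA.
have hB' : ideal O (scaleI nz B) by apply: ideal_sc => //; apply: Ok_O.
have hc : Ok (nz * ny * pi) by ring_mem hR.
have c0 : nz * ny * pi != 0 by apply: mulf_neq0; [apply: mulf_neq0|apply: pi0].
have [u [d [i [j [hu hu' [hd d0] ed es]]]]] := square_ideal_factor hB' hc c0 hBB.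
have pz : psi (absNk D nz) = false := psi_norm hz z0.
have py : psi (absNk D ny) = false := psi_norm hy y0.
(* The character is + 1 at nz and ny and - 1 at pi, so a factor PP remains in [es]. *)
have oi : odd i.
  rewrite -(psi_square_equation hc hu hu' hd d0 ed) (@absNkM _ (nz * ny)) //; last by ring_mem hR.
  rewrite (@absNkM _ nz) // absNk_pi.
  by rewrite !psiM ?muln_gt0 ?nuk_gt0 // pz py psi2.
rewrite oi mulI_scl -scM in es.
have [m [n1 [hn1 hn1pi en1]]] := Ok_pi_val hzn nz0.
have [l [d1 [hd1 hd1pi ed1]]] := Ok_pi_val hd d0.
have p0 := pi0 D; have pX k : pi ^+ k != 0 by rewrite expf_neq0.
have hpiO : O pi := Ok_O hpi; have hn1O := Ok_O hn1; have hd1O := Ok_O hd1.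
have halO : O (al ^+ j) by apply: sringX => //; apply: O_al.
have hBP : ideal O (mulI B PP) by apply: ideal_mulI.
have es' : scaleI (pi ^+ (i./2 + m)) (scaleI (al ^+ j * n1) (mulI B PP)) = scaleI (pi ^+ l) (scaleI d1 O).
  by rewrite -!scM -ed1 -es en1 exprD; congr (scaleI _ _); ring.
(* n1 and d1 lie outside PP. In this case the factor PP on the left would put d1 into PP. *)
have [hl|hl] := leqP l (i./2 + m).
  have e2 : scaleI (pi ^+ (i./2 + m - l)) (scaleI (al ^+ j * n1) (mulI B PP)) = scaleI d1 O.
    by apply: (sc_inj (pX l)); rewrite -es' -scM -exprD subnKC.
  have : scaleI d1 O d1 by apply: sc_self.
  rewrite -e2 => -[_ [[w [hw ->]] ed1']]; apply: (PP_not_unit hd1 hd1pi).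
  rewrite ed1' mulrA; apply: (ideal_mul hPP); first by ring_mem hO.
  by move: w hw {ed1'}; apply: mulI_sub => [|b q hb hq]; [apply: ideal_agrp hPP|apply: (ideal_mul hPP) => //; apply: ideal_sub hb].
(* Otherwise al^j n1 B PP is contained in (pi) = PP^2, which forces B into the prime PP. *)
have e2 : scaleI (al ^+ j * n1) (mulI B PP) = scaleI (pi ^+ (l - (i./2 + m))) (scaleI d1 O).
  by apply: (sc_inj (pX (i./2 + m))); rewrite es' -[in RHS]scM -exprD subnKC // ltnW.
have hBsub b : B b -> PP b.
  move=> hb; have hbO := ideal_sub hB hb.
  have : PP (al ^+ j * n1 * b).
    apply: PP_cancel; first by ring_mem hO.
    move=> q hq; have : scaleI (al ^+ j * n1) (mulI B PP) (al ^+ j * n1 * (b * q)).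
      by apply: sc_mem; apply: mem_mulI.
    rewrite e2 mulrA => -[_ [[w [hw ->]] ->]].
    rewrite -(subnSK hl) exprS -mulrA; apply: sc_mem; ring_mem hO.
  case/PP_prime => //; first by ring_mem hO.
  by case/PP_prime => // [/PP_al_pow //|/(PP_not_unit hn1 hn1pi)].
(* Then x sg x is in PP for x in I, so x is, PP being prime and stable under conjugation. *)
apply: hnP => x hx; have hxO := ideal_sub hI hx.
have : PP (x * sg x) by apply: hBsub; apply: mem_mulI => //; apply: cj_mem.
case/PP_prime => //; first exact: O_conj.
move=> h; rewrite -PP_sg -(O_conjK hxO); exact: cj_mem.
Qed.
End TwoTorsion.

(** * The class group *)

Section FinitelyGenerated.
Variables (R : pset) (d : nat) (b : 'I_d -> algC).
Hypotheses (hR : is_subring R) (hb : lattice R b).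

Definition zgen (I : pset) := exists n (v : 'I_n -> algC), (forall j, I (v j)) /\
  forall x, I x -> exists c : 'I_n -> int, x = \sum_j (c j)%:~R * v j.

(** Generators are the m b_i, and for each residue class modulo m that meets I one element of I in
    it, with 0 for the other classes. *)
Lemma ideal_zgen I (m : nat) : (0 < m)%N -> ideal R I -> I m%:R -> zgen I.
Proof.
move=> m0 hI hm; have hIa := ideal_agrp hI.
have [F FP] := lattice_code hb m0.
have m0' : (m%:R : algC) != 0 by rewrite pnatr_eq0 -lt0n.
have hr (v : {ffun 'I_d -> 'I_m}) : exists r, I r /\ forall x, I x -> F x = v -> F r = v.
  have [[x [hx ex]]|h] := pselect (exists x, I x /\ F x = v); first by exists x.
  exists 0; split=> [|x hx ex]; first exact: agrp0.
  by case: h; exists x.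
pose r v := sval (cid (hr v)).
have rP v : I (r v) by case: (svalP (cid (hr v))).
have rF x : I x -> F (r (F x)) = F x by case: (svalP (cid (hr (F x)))) => _ h hx; apply: h hx _.
have hbR i : R (b i).
  apply/hb; exists (fun j => if j == i then 1 else 0).
  by rewrite (bigD1 i) //= eqxx mul1r big1 ?addr0 // => j /negbTE->; rewrite mul0r.
pose T : finType := ('I_d + {ffun 'I_d -> 'I_m})%type.
pose g (x : T) := match x with inl i => m%:R * b i | inr v => r v end.
exists #|T|, (fun j => g (enum_val j)); split=> [j|x hx].
  by rewrite /g; case: (enum_val j) => // i; apply: (ideal_mulr hI).
have hRr := ideal_sub hI (rP (F x)); have hRx := ideal_sub hI hx.
have [c ec] := (hb _).1 (FP _ _ hRx hRr (esym (rF _ hx))).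
pose k (y : T) : int := match y with inl i => c i | inr v => (v == F x)%:Z end.
exists (fun j => k (enum_val j)).
rewrite -(reindex (@enum_val T predT) (F := fun y => (k y)%:~R * g y) (P := predT)) /=; last first.
  by apply: onW_bij; apply: enum_val_bij.
rewrite big_sumType /=.
have -> : \sum_v ((v == F x)%:Z)%:~R * r v = r (F x).
  by rewrite (bigD1 (F x)) //= eqxx mul1r big1 ?addr0 // => v /negbTE->; rewrite mul0r.
have -> : \sum_(i < d) (c i)%:~R * (m%:R * b i) = m%:R * \sum_(i < d) (c i)%:~R * b i.
  by rewrite mulr_sumr; apply: eq_bigr => i _; rewrite mulrCA.
by rewrite -ec mulrC divfK // subrK.
Qed.

(** x is an eigenvalue of the integer matrix of multiplication by x on the generators of I. *)
Lemma stable_Aint I x : nonz I -> zgen I -> (forall y, I y -> I (x * y)) -> x \in Aint.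
Proof.
move=> [y0 [hy0 y00]] [n [v [hv hg]]] hx.
have hc j : exists c : 'I_n -> int, x * v j = \sum_k (c k)%:~R * v k by apply: hg; apply: hx.
pose c j := sval (cid (hc j)).
have cP j : x * v j = \sum_k (c j k)%:~R * v k by apply: (svalP (cid (hc j))).
pose C : 'M[int]_n := \matrix_(k, j) c j k.
have : eigenvalue (map_mx (intr : int -> algC) C) x.
  apply/eigenvalueP; exists (\row_j v j).
    apply/rowP => j; rewrite !mxE cP; apply: eq_bigr => k _; rewrite !mxE mulrC //.
  apply: contraNneq y00 => h; have [e ->] := hg _ hy0; rewrite big1 // => j _.
  by have /rowP/(_ j) := h; rewrite !mxE => ->; rewrite mulr0.
rewrite eigenvalue_root_char -map_char_poly => h.
apply: root_monic_Aint h _ _; first by rewrite monic_map // char_poly_monic.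
by apply/polyOverP => i; rewrite coef_map intr_int.
Qed.

(** Congruence modulo C; membership in R is carried along so that products preserve it. *)
Definition congI (C : pset) x y := [/\ R x, R y & C (x - y)].

Lemma det_congI (C : pset) n (M N : 'M[algC]_n) : ideal R C ->
  (forall i j, congI C (M i j) (N i j)) -> congI C (\det M) (\det N).
Proof.
move=> hC h; have hCa := ideal_agrp hC.
apply: (big_ind2 (congI C)) => [|x1 y1 x2 y2 [h1 h2 h3] [h4 h5 h6]|s _].
- by split; [exact: sring0|exact: sring0|rewrite subrr; apply: agrp0].
- split; [exact: sringD|exact: sringD|rewrite opprD addrACA; exact: agrpD].
have [h1 h2 h3] : congI C (\prod_i M i (s i)) (\prod_i N i (s i)).
  apply: (big_ind2 (congI C)) => // [|x1 y1 x2 y2 [h1 h2 h3] [h4 h5 h6]].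
    by split; [exact: sring1|exact: sring1|rewrite subrr; apply: agrp0].
  split; [exact: sringM|exact: sringM|].
  have -> : x1 * x2 - y1 * y2 = (x1 - y1) * x2 + y1 * (x2 - y2) by ring.
  by apply: agrpD => //; [apply: (ideal_mulr hC)|apply: (ideal_mul hC)].
have hs : R ((-1) ^+ s) by ring_mem hR.
by split; [exact: sringM|exact: sringM|rewrite -mulrBr; apply: (ideal_mul hC)].
Qed.

(** The generators satisfy v = c v with a matrix c over C, so det (1 - c) = 0, and this determinant
    is 1 modulo C. *)
Lemma nakayama I C : ideal R I -> zgen I -> ideal R C -> mulI I C = I -> C 1.
Proof.
move=> hI [n [v [hv hg]]] hC e; have hCa := ideal_agrp hC.
pose H := fun z => exists c : 'I_n -> algC, (forall j, C (c j)) /\ z = \sum_j c j * v j.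
have hH z : I z -> H z.
  rewrite -{1}e; move: z; apply: mulI_sub => [|x y hx hy].
    split; first by exists (fun=> 0); split=> [j|]; [apply: agrp0|rewrite big1 // => j _; rewrite mul0r].
    move=> _ _ [c [hc ->]] [c' [hc' ->]]; exists (fun j => c j - c' j); split=> [j|].
      exact: agrpB.
    by rewrite -sumrB; apply: eq_bigr => j _; rewrite mulrBl.
  have [c ->] := hg _ hx; exists (fun j => (c j)%:~R * y); split=> [j|].
    by apply: (ideal_mul hC) => //; apply: sring_int.
  by rewrite mulr_suml; apply: eq_bigr => j _; rewrite mulrAC.
have hc j : H (v j) by apply: hH.
pose c j := sval (cid (hc j)).
have cP j : (forall k, C (c j k)) /\ v j = \sum_k c j k * v k by apply: (svalP (cid (hc j))).
pose M : 'M[algC]_n := \matrix_(k, j) ((k == j)%:R - c j k).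
have hdet : \det M = 0.
  apply/eqP/det0P; exists (\row_j v j).
    have [_ _ [x [hx x0]]] := hI; apply: contraNneq x0 => h; have [a ->] := hg _ hx.
    rewrite big1 // => j _.
    by have /rowP/(_ j) := h; rewrite !mxE => ->; rewrite mulr0.
  apply/rowP => j; rewrite !mxE.
  under eq_bigr do rewrite !mxE mulrBr.
  rewrite sumrB [X in _ - X](eq_bigr (fun k => c j k * v k)); last by move=> k _; rewrite mulrC.
  rewrite -(cP j).2 (bigD1 j) //= eqxx mulr1 big1 ?addr0 ?subrr //.
  by move=> k /negbTE ->; rewrite mulr0.
have hcong : congI C (\det M) (\det (1%:M : 'M[algC]_n)).
  apply: det_congI => // i j; rewrite !mxE; have hcC := (cP j).1 i.
  split; [apply: sringB => //; [exact: sring_nat|exact: ideal_sub hcC]|exact: sring_nat|].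
  by rewrite addrAC subrr sub0r; apply: agrpN.
case: hcong => _ _; rewrite hdet det1 sub0r => h.
by rewrite -[1]opprK; apply: agrpN.
Qed.
End FinitelyGenerated.

(** * Finiteness of the class group and inverses *)

Section Finiteness.
Variable D : pquartic.
Local Notation al := (qa D).
Local Notation sg := (qs D).
Local Notation ta := (qt D).
Local Notation O := (O D).

Let hO := O_ring D.

Lemma O_nK_div x : O x -> x != 0 -> O (nK D x / x).
Proof.
move=> hx x0; rewrite (_ : nK D x / x = sg x * ta (x * sg x)); last by rewrite /nK; field.
apply: (sringM hO); first exact: O_conj.
by apply: Ok_O; apply: Ok_conj; apply: O_norm.
Qed.

Lemma ideal_nat I : ideal O I -> exists m : nat, (0 < m)%N /\ I m%:R.
Proof.
move=> hI; case: (hI) => _ _ [x [hx x0]]; have hxO := ideal_sub hI hx.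
exists (absNK D x); split; first exact: absNK_gt0.
rewrite absNKE //; have hn : I (nK D x).
  by rewrite -(divfK x0 (nK D x)); apply: (ideal_mul hI) => //; apply: O_nK_div.
have hr : nK D x \is Num.real by have /ZZP[k ->] := nK_ZZ hxO; apply: realz.
by case: (real_ge0P hr) => _ //; apply: agrpN; first exact: ideal_agrp hI.
Qed.

Lemma O_zgen I : ideal O I -> zgen I.
Proof. by move=> hI; have [m [m0 hm]] := ideal_nat hI; apply: (ideal_zgen (O_lattice D) m0). Qed.

Lemma fr_O_nat x : frac_of O x -> exists y (k : nat), [/\ O y, (0 < k)%N & x = y / k%:R].
Proof.
case=> a [b [ha hb b0 ->]].
have [m [m0 [z [hz em]]]] := ideal_nat (ideal_pr hO hb b0).
exists (a * z), m; split=> //; first exact: sringM.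
have m0' : (m%:R : algC) != 0 by rewrite pnatr_eq0 -lt0n.
have z0 : z != 0 by apply: contraNneq m0' => h; rewrite em h mulr0.
by rewrite em; field; rewrite b0 z0.
Qed.

(** Hurwitz's substitute for Euclidean division. Among the N^4 + 1 multiples m x with m <= N^4, two
    have fractional coordinates in the same box of side 1 / N. Their difference is within O of an
    element all of whose conjugates are at most S / N < 1. *)
Lemma hurwitz : exists L : nat, forall x, frac_of O x ->
  exists m c, [/\ (0 < m <= L)%N, O c & `|nK D (m%:R * x - c)| < 1].
Proof.
have a_gt0 := qa_gt0 D; pose S : algC := \sum_(i < 4) al ^+ i.
have S0 : 0 <= S by rewrite sumr_ge0 // => i _; rewrite exprn_ge0 // ltW.
pose N := (Num.truncn S).+1.
have hSN : S < N%:R by case/andP: (truncn_itv S0).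
exists (N ^ 4)%N => x /fr_O_nat[y [k [hy k0 ->]]].
have [c ec] := (O_lattice D y).1 hy.
have k0' : (k%:R : algC) != 0 by rewrite pnatr_eq0 -lt0n.
have k_gt0 : 0 < k%:R :> algC by rewrite ltr0n.
pose r (m : nat) i : nat := absz ((m%:Z * c i) %% k%:Z)%Z.
have rE m i : ((m%:Z * c i) %% k%:Z)%Z = r m i.
  by rewrite /r gez0_abs // modz_ge0 // eqz_nat -lt0n.
have rk m i : (r m i < k)%N by rewrite -ltz_nat -rE ltz_pmod.
have rN m i : (r m i * N %/ k < N)%N by rewrite ltn_divLR // mulnC ltn_mul2l rk.
have [|m1 [m2 [hne heq]]] := @pigeonhole 'I_(N ^ 4).+1 {ffun 'I_4 -> 'I_N}
  (fun m => [ffun i => Ordinal (rN m i)]).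
  by rewrite card_ffun !card_ord.
wlog hlt : m1 m2 hne heq / (m1 < m2)%N.
  move=> H; move: (hne); rewrite -val_eqE /= neq_ltn => /orP[h|h]; first exact: (H m1 m2).
  by apply: (H m2 m1) => //; rewrite eq_sym.
pose dl i : int := (r m2 i)%:Z - (r m1 i)%:Z.
have hdl i : `|(dl i)%:~R| <= k%:R / N%:R :> algC.
  have N0 : 0 < N%:R :> algC by rewrite ltr0n.
  rewrite ler_pdivlMr // -intr_norm -[N%:R]/(N%:Z%:~R) -[k%:R]/(k%:Z%:~R) -intrM ler_int.
  have /ffunP/(_ i) := heq; rewrite !ffunE => /(congr1 val) /= ei.
  have e1 := divn_eq (r m1 i * N) k; have e2 := divn_eq (r m2 i * N) k.
  have l1 := ltn_pmod (r m1 i * N) k0; have l2 := ltn_pmod (r m2 i * N) k0.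
  rewrite -ei in e2; rewrite /dl.
  move: (r m1 i) (r m2 i) (r m1 i * N %/ k)%N ((r m1 i * N) %% k)%N ((r m2 i * N) %% k)%N e1 e2 l1 l2.
  move=> u1 u2 w v1 v2 e1 e2 l1 l2.
  rewrite -[N%:Z]ger0_norm // -normrM ler_norml mulrBl; lia.
pose y' := \sum_i (dl i)%:~R * al ^+ i.
pose q i : int := ((m2%:Z * c i) %/ k%:Z)%Z - ((m1%:Z * c i) %/ k%:Z)%Z.
exists (m2 - m1)%N, (\sum_i (q i)%:~R * al ^+ i); split.
- by rewrite subn_gt0 hlt /= (leq_trans (leq_subr _ _)) // -ltnS.
- by apply/(O_lattice D); exists q.
have -> : (m2 - m1)%:R * (y / k%:R) - \sum_i (q i)%:~R * al ^+ i = y' * k%:R^-1.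
  rewrite natrB ?(ltnW hlt) // ec; apply: (mulIf k0').
  rewrite mulrBl mulrA !divfK // /y' mulr_sumr mulr_suml -sumrB; apply: eq_bigr => i _.
  have e1 : (m1%:R * (c i)%:~R : algC) = ((m1%:Z * c i) %/ k%:Z)%Z%:~R * k%:R + (r m1 i)%:R.
    by rewrite -[m1%:R]/(m1%:Z%:~R) -intrM {1}(divz_eq (m1%:Z * c i) k%:Z) rE intrD intrM.
  have e2 : (m2%:R * (c i)%:~R : algC) = ((m2%:Z * c i) %/ k%:Z)%Z%:~R * k%:R + (r m2 i)%:R.
    by rewrite -[m2%:R]/(m2%:Z%:~R) -intrM {1}(divz_eq (m2%:Z * c i) k%:Z) rE intrD intrM.
  rewrite !mulrA mulrBl e1 e2 /dl /q !rmorphB /=; ring.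
have hk : nK D k%:R^-1 = (k%:R ^+ 4)^-1.
  by rewrite /nK !(rmorphM, fmorphV, rmorph_nat) /=; field.
rewrite nKM hk normrM normfV normrX normr_nat ltr_pdivrMr ?exprn_gt0 // mul1r.
have N0 : 0 < N%:R :> algC by rewrite ltr0n.
have bd (e : {rmorphism algC -> algC}) : `|e al| = al -> `|e y'| <= k%:R / N%:R * S.
  by move=> he; apply: emb_bound.
have b1 : `|y'| <= k%:R / N%:R * S by apply: (bd idfun); rewrite /= gtr0_norm.
have b2 : `|sg y'| <= k%:R / N%:R * S by apply: bd; rewrite sg_al normrN gtr0_norm.
have b3 : `|ta y'| <= k%:R / N%:R * S by apply: bd; apply: norm_ta_al.
have b4 : `|ta (sg y')| <= k%:R / N%:R * S.
  by apply: (bd (ta \o sg)) => /=; rewrite sg_al rmorphN normrN norm_ta_al.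
have h0 : 0 <= k%:R / N%:R * S by rewrite mulr_ge0 // divr_ge0 ?ler0n.
rewrite nK_norm; apply: le_lt_trans (_ : _ <= (k%:R / N%:R * S) ^+ 4) _.
  rewrite (_ : _ ^+ 4 = (k%:R / N%:R * S) * (k%:R / N%:R * S) * ((k%:R / N%:R * S) * (k%:R / N%:R * S))); last by ring.
  by rewrite !ler_pM ?mulr_ge0.
rewrite ltrXn2r ?nnegrE ?ler0n //= mulrAC ltr_pdivrMr // ltr_pM2l //.
Qed.

(** Let b in I be nonzero of least norm. For a in I, [hurwitz] yields m <= L with m a - c b of
    smaller norm, hence zero; so (L! / b) I lies in O, and it contains L!. *)
Lemma ideal_bounded : exists M : nat, (0 < M)%N /\ forall I, ideal O I ->
  exists J, [/\ ideal O J, equivI O I J & J M%:R].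
Proof.
have [L hL] := hurwitz; exists L`!; split=> [|I hI]; first exact: fact_gt0.
have hex : exists n, `[< exists x, [/\ I x, x != 0 & absNK D x = n] >].
  have [_ _ [x [hx x0]]] := hI; exists (absNK D x); apply/asboolP; by exists x.
case: (ex_minnP hex) => n /asboolP[b [hb b0 eb]] hmin.
have hbO := ideal_sub hI hb.
have F0 : (L`!%:R : algC) != 0 by rewrite pnatr_eq0 -lt0n fact_gt0.
have hdiv a : I a -> O (L`!%:R / b * a).
  move=> ha; have haO := ideal_sub hI ha.
  have [m [c [/andP[m0 mL] hc hlt]]] := hL _ (fr_div hO haO hbO).
  have hI' : I (m%:R * a - c * b).
    by apply: (agrpB (ideal_agrp hI)); apply: (ideal_mul hI) => //; apply: sring_nat.
  have e0 : m%:R * a - c * b = 0.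
    apply/eqP; apply: contraT => h.
    have hO' := ideal_sub hI hI'.
    have := hmin _ (introT (asboolP _) (ex_intro _ _ (And3 hI' h erefl))).
    rewrite -eb leqNgt -(ltr_nat algC) !absNKE //.
    have -> : m%:R * a - c * b = b * (m%:R * (a / b) - c) by field.
    rewrite nKM normrM gtr_pMr ?hlt //.
    by rewrite normr_gt0 nK_eq0.
  have /dvdnP[k ek] : (m %| L`!)%N by apply: dvdn_fact; rewrite m0.
  have -> : L`!%:R / b * a = k%:R * c.
    move/eqP: e0; rewrite subr_eq0 => /eqP e0.
    apply: (mulIf b0); transitivity (k%:R * (m%:R * a)); last by rewrite e0 mulrA.
    by rewrite ek natrM; field.
  by apply: sringM => //; apply: sring_nat.
have Fb0 : L`!%:R / b != 0 by rewrite mulf_neq0 ?invr_eq0.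
exists (scaleI (L`!%:R / b) I); split.
- split; first by apply: rmod_sc; apply: ideal_rmod.
    by move=> _ [x [hx ->]]; apply: hdiv.
  by case: hI => _ _; apply: nonz_sc.
- apply: equivI_sym; apply: (equivI_fr (R := O) (x := L`!%:R / b)) => //.
  by apply: fr_div => //; apply: sring_nat.
by exists b; rewrite divfK.
Qed.

(** Every class contains an ideal containing M, and such an ideal is determined by the finite set of
    residues modulo M that it meets. *)
Lemma finite_code : exists (T : finType) (f : pset -> T),
  forall I J, ideal O I -> ideal O J -> f I = f J -> equivI O I J.
Proof.
have [M [M0 hM]] := ideal_bounded.
have [F FP] := lattice_code (O_lattice D) M0.
pose code J : {set {ffun 'I_4 -> 'I_M}} := [set v | `[< exists x, J x /\ F x = v >]].
have code_sub J J' x : ideal O J -> ideal O J' -> J' M%:R -> code J = code J' -> J x -> J' x.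
  move=> hJ hJ' hJM e hx; have : F x \in code J by rewrite inE; apply/asboolP; exists x.
  rewrite e inE => /asboolP[x' [hx' ex]].
  have h := FP _ _ (ideal_sub hJ hx) (ideal_sub hJ' hx') (esym ex).
  rewrite -(subrK x' x); apply: (agrpD (ideal_agrp hJ')) => //.
  have M0' : (M%:R : algC) != 0 by rewrite pnatr_eq0 -lt0n.
  by rewrite -(divfK M0' (x - x')); apply: (ideal_mul hJ').
have hJ I : exists J, ideal O I -> [/\ ideal O J, equivI O I J & J M%:R].
  have [hI|h] := pselect (ideal O I); last by exists I.
  by have [J hJ] := hM I hI; exists J.
exists {set {ffun 'I_4 -> 'I_M}}, (fun I => code (sval (cid (hJ I)))) => I J hI hJ' e.
have [h1 h2 h3] := svalP (cid (hJ I)) hI; have [h4 h5 h6] := svalP (cid (hJ J)) hJ'.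
apply: (equivI_trans hO h2); apply: (equivI_sym); apply: (equivI_trans hO h5).
rewrite (_ : sval (cid (hJ J)) = sval (cid (hJ I))); first exact: equivI_refl.
by apply: pset_eq => x; apply: code_sub.
Qed.

Definition powI (I : pset) n := iter n (mulI I) O.

Lemma pw_ideal I n : ideal O I -> ideal O (powI I n).
Proof. by move=> hI; elim: n => [|n IH]; [apply: ideal_self|apply: ideal_mulI]. Qed.

Lemma pwD I m n : ideal O I -> powI I (m + n) = mulI (powI I m) (powI I n).
Proof.
move=> hI; elim: m => [|m IH]; last by rewrite addSn /= IH mulIA.
by rewrite mulI_R //; apply: ideal_rmod; apply: pw_ideal.
Qed.

(* Two powers of I are equivalent; Nakayama's lemma allows to cancel the smaller one. *)
Lemma ideal_inverse I : ideal O I -> exists J, ideal O J /\ equivI O (mulI I J) O.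
Proof.
move=> hI; have [T [f hf]] := finite_code.
have [|i [j [nij e]]] := @pigeonhole 'I_#|T|.+1 T (fun i => f (powI I i)).
  by rewrite card_ord.
wlog hlt : i j nij e / (i < j)%N.
  move=> H; move: (nij); rewrite -val_eqE /= neq_ltn => /orP[h|h]; first exact: (H i j).
  by apply: (H j i) => //; rewrite eq_sym.
have hX := pw_ideal i hI; set Y := powI I (j - i).
have hY : ideal O Y by apply: pw_ideal.
have := hf _ _ (pw_ideal j hI) hX (esym e).
rewrite -(subnKC (ltnW hlt)) pwD // -/Y => /equivI_ex[th hth [th0 eth]].
(* Write X = I^i. From X Y = th X, multiplication by y / th maps X into itself, so y / th is
   integral. *)
have hyO y : Y y -> O (y / th).
  move=> hy; apply: O_closed.
    by apply: (frM hO); [apply: (fr_R hO); apply: ideal_sub hy|apply: frV].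
  have [_ _ hnX] := hX; apply: (stable_Aint hnX (O_zgen hX)) => x hx.
  have : mulI (powI I i) Y (x * y) by apply: mem_mulI.
  by rewrite eth scE // [x * y]mulrC mulrAC.
have thV0 : th^-1 != 0 by rewrite invr_eq0.
have hC : ideal O (scaleI th^-1 Y).
  split; first by apply: rmod_sc; apply: ideal_rmod.
    by move=> _ [y [hy ->]]; rewrite mulrC; apply: hyO.
  by case: hY => _ _; apply: nonz_sc.
have eC : mulI (powI I i) (scaleI th^-1 Y) = powI I i.
  by rewrite mulI_scr eth -scM mulVf ?sc1.
(* The ideal Y / th leaves X unchanged, so it contains 1 and Y is generated by th. *)
have h1 := nakayama hO hX (O_zgen hX) hC eC.
have eY : scaleI th^-1 Y = O.
  by apply: rmod1 h1; [apply: ideal_rmod|move=> x; apply: ideal_sub].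
have hYO : equivI O Y O.
  apply: (equivI_fr hth th0); rewrite -eY -scM divff // sc1 //.
case ek : (j - i)%N => [|k]; first by move: hlt; rewrite -subn_gt0 ek.
exists (powI I k); split; first exact: pw_ideal.
by move: hYO; rewrite /Y ek.
Qed.
End Finiteness.

(** Equivalent elements may have different codes under f. Picking one code among those attained on
    the class yields a complete invariant [phi], and each attained value gives one
    representative. *)
Lemma quotient_representatives (U : Type) (V : U -> Prop) (E : U -> U -> Prop) (T : finType) (f : U -> T) :
  (forall x, V x -> E x x) -> (forall x y, E x y -> E y x) ->
  (forall x y z, E x y -> E y z -> E x z) ->
  (forall x y, V x -> V y -> f x = f y -> E x y) ->
  exists h (r : 'I_h -> U), [/\ forall i, V (r i), forall i j, E (r i) (r j) -> i = j &
    forall x, V x -> exists i, E x (r i)].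
Proof.
move=> Er Es Et hf.
pose phi x : option T := [pick v | `[< exists y, [/\ V y, E x y & f y = v] >]].
have phiP x : V x -> exists v, phi x = Some v /\ exists y, [/\ V y, E x y & f y = v].
  move=> hx; rewrite /phi; case: pickP => [v /asboolP h|h]; first by exists v.
  by have /negbT/asboolPn[] := h (f x); exists x; split=> //; apply: Er.
have phiE x y : V x -> V y -> phi x = phi y -> E x y.
  move=> hx hy; have [v [-> [x1 [h1 h2 h3]]]] := phiP _ hx.
  have [w [-> [y1 [h4 h5 h6]]]] := phiP _ hy; case=> evw.
  by apply: Et h2 (Et _ _ _ (hf _ _ h1 h4 _) (Es _ _ h5)); rewrite h3 h6.
have Ephi x y : E x y -> phi x = phi y.
  move=> hxy; apply: eq_pick => v; apply/asboolP/asboolP => -[z [h1 h2 h3]]; exists z; split=> //.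
    exact: Et (Es _ _ hxy) h2.
  exact: Et hxy h2.
pose A := [set v | `[< exists x, V x /\ phi x = Some v >]].
have hA (i : 'I_#|A|) : exists x, V x /\ phi x = Some (enum_val i).
  by have := enum_valP i; rewrite inE => /asboolP.
exists #|A|, (fun i => sval (cid (hA i))).
have rP i := svalP (cid (hA i)).
split=> [i|i j e|x hx].
- by case: (rP i).
- by apply: enum_val_inj; have := Ephi _ _ e; rewrite (rP i).2 (rP j).2 => -[].
have [v [ev _]] := phiP _ hx.
have vA : v \in A by rewrite inE; apply/asboolP; exists x.
exists (enum_rank_in vA v); apply: phiE => //; first by case: (rP (enum_rank_in vA v)).
by rewrite (rP _).2 enum_rankK_in.
Qed.

Section Count.
Local Open Scope group_scope.

(* The quotient by the subgroup generated by [P] has no element of order 2. *)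
Lemma card_mod4 (gT : finGroupType) (P : gT) : (forall x y : gT, x * y = y * x) ->
  P != 1 -> P * P = 1 -> (forall x : gT, x * x = 1 -> x = 1 \/ x = P) ->
  (forall x : gT, x * x <> P) -> (#|gT| %% 4 = 2)%N.
Proof.
move=> hC P1 PP hx hnP.
have oP : #[P] = 2%N.
  by apply: nt_prime_order => //; rewrite expgS expg1.
pose G := [set: gT]%G; pose H := <[P]>%G.
have cH : #|H| = 2%N by rewrite -oP.
have hN : H <| G.
  rewrite /normal subsetT /=; apply: sub_abelian_norm; last exact: subsetT.
  by apply/centsP => x _ y _; apply: hC.
have cG : (#|G| = #|G / H| * 2)%N.
  by rewrite card_quotient ?normal_norm // mulnC -{1}cH Lagrange ?subsetT.
have odd_q : odd #|G / H|.
  apply: contraT; rewrite -dvdn2 => h2.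
  have [xb xbG oxb] := Cauchy (isT : prime 2) h2.
  case/morphimP: xbG => x xN _ ex; rewrite /= in ex.
  have : (coset H x) ^+ 2 = 1 by rewrite -ex -oxb expg_order.
  rewrite -morphX // => /coset_idr; rewrite groupX // => /(_ isT).
  rewrite expgS expg1 /= cycle2g // !inE => /orP[/eqP/hx|/eqP/hnP //] hxP.
  have xH : x \in H by case: hxP => ->; [apply: group1|apply: cycle_id].
  by move: oxb; rewrite ex coset_id // order1.
by rewrite cardsT in cG; rewrite cG; lia.
Qed.
End Count.

Section ClassNumber.
Variable D : pquartic.
Local Notation O := (O D).
Local Notation PP := (PP D).

(** The indices of the representatives carry the group law of the ideal classes, to which
    [card_mod4] applies with the class of PP. *)
Lemma class_number_mod4 : exists (h : nat) (r : 'I_h -> pset),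
  [/\ forall i, ideal O (r i), forall i j, equivI O (r i) (r j) -> i = j,
    forall I, ideal O I -> exists i, equivI O I (r i) & (h %% 4 = 2)%N].
Proof.
have hO := O_ring D; have [T [f hf]] := finite_code D.
have hPP := PP_ideal D; have hOO := ideal_self hO.
have tr := @equivI_trans _ hO; have sy := @equivI_sym O.
have [h [r [r1 r2 r3]]] := quotient_representatives (V := ideal O)
  (fun I _ => equivI_refl hO I) sy (fun x y z => tr y x z) hf.
exists h, r; split=> //.
(* Sets that are not ideals receive the index of O, so that [cl] is total. *)
have hcl I : exists i, ideal O I -> equivI O I (r i).
  have [hI|hI] := pselect (ideal O I); first by have [i hi] := r3 I hI; exists i.
  by have [i _] := r3 _ hOO; exists i.
pose cl I := sval (cid (hcl I)).
have clP I : ideal O I -> equivI O I (r (cl I)) by apply: (svalP (cid (hcl I))).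
have cl_eq I J : ideal O I -> ideal O J -> equivI O I J -> cl I = cl J.
  by move=> hI hJ e; apply: r2; apply: (tr _ _ _ (sy _ _ (clP _ hI))); apply: (tr _ _ _ e); apply: clP.
have clr i : cl (r i) = i by apply: r2; apply: sy; apply: clP.
pose m i j := cl (mulI (r i) (r j)).
have mE i j : equivI O (mulI (r i) (r j)) (r (m i j)) by apply: clP; apply: ideal_mulI.
have hinv i : exists j, m i j = cl O.
  have [J [hJ e]] := ideal_inverse (r1 i); exists (cl J).
  apply: cl_eq => //; first exact: ideal_mulI.
  apply: tr e; apply: equivI_mul => //; first exact: equivI_refl.
  exact: sy (clP _ hJ).
have mC i j : m i j = m j i by rewrite /m mulIC.
have mA : associative m.
  move=> i j k; apply: cl_eq; try exact: ideal_mulI.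
  apply: (tr (mulI (r i) (mulI (r j) (r k)))).
    by apply: equivI_mul => //; [apply: equivI_refl|apply: sy].
  by rewrite mulIA; apply: equivI_mul => //; apply: equivI_refl.
have m1 : left_id (cl O) m.
  move=> i; rewrite -[RHS]clr; apply: cl_eq => //; first exact: ideal_mulI.
  apply: (tr (mulI O (r i))); last by rewrite mulI_R //; [apply: equivI_refl|apply: ideal_rmod].
  by apply: equivI_mul => //; [apply: sy; apply: clP|apply: equivI_refl].
pose inv i := sval (cid (hinv i)).
have mV : left_inverse (cl O) inv m.
  by move=> i; rewrite mC; apply: (svalP (cid (hinv i))).
pose isG := Finite_isGroup.Build 'I_h mA m1 mV.
pose gT : finGroupType := HB.pack 'I_h isG.
rewrite -[h]card_ord; apply: (@card_mod4 gT (cl PP)).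
- exact: mC.
- apply/eqP => e.
  have /equivI_ex[x hx [x0 ex]] : equivI O PP O.
    apply: (tr _ _ _ (clP _ hPP)); apply: sy; apply: (tr _ _ _ (clP _ hOO)).
    by rewrite [cl PP]e; apply: equivI_refl.
  exact: (PP_not_principal ex).
- change (m (cl PP) (cl PP) = cl O); apply: cl_eq => //; first exact: ideal_mulI.
  apply: (tr (mulI PP PP)); first by apply: equivI_mul => //; apply: sy; apply: clP.
  by rewrite PP_sq; apply: equivI_sc => //; [apply: Ok_O; apply: qpi_Ok|apply: pi0].
- move=> i e; have e' : m i i = cl O by [].
  have : equivI O (mulI (r i) (r i)) O.
    by apply: (tr _ _ _ (mE i i)); rewrite e'; apply: sy; apply: clP.
  case/(class_two_torsion (r1 i)) => h'; [left|right]; rewrite -[i]clr; exact: cl_eq.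
move=> i e; have e' : m i i = cl PP by [].
apply: (@PP_not_square D (r i)) => //.
by apply: (tr _ _ _ (mE i i)); rewrite e'; apply: sy; apply: clP.
Qed.
End ClassNumber.

Local Close Scope ring_scope.

Theorem theorem1 (p : nat) :
  prime p -> p %% 16 = 7 ->
  exists h : nat, class_number (genfield (fourth_root p)) h /\ h %% 4 = 2.
Proof.
move=> p_pr p7; have [Q [_ eQ]] := quartic_exists p_pr p7.
have [D eD] := pquartic_exists Q.
have [h [r [h1 h2 h3 h4]]] := class_number_mod4 D.
rewrite -eQ -eD; exists h; split=> //; exists r; split=> [i|i j|I].
- by apply/nz_idealE.
- by move/ideal_equivE/h2.
by move/nz_idealE/h3 => [i hi]; exists i; apply/ideal_equivE.
Qed.
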